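(* Suppose that $k\ge5$ and $0\le s\le k-5$, and let $n=\max\{k^2,\,d(s^2-s+k+d)\}$. Consider the PINNs $(V_\theta,w_\theta,p_\theta,T_\theta)$ with the generalization error $\mathcal E_G[s;\theta]$ and the training error $\mathcal E_T[s;\theta;\mathcal S]$. Then their difference depends on the size of $\mathcal S=(\mathcal S_i,\mathcal S_t,\mathcal S_b)$: $$\Big|\mathcal E_G[s;\theta]^2-\mathcal E_T[s;\theta;\mathcal S]^2\Big|\le C_i|\mathcal S_i|^{-\frac2{d+1}}+C_t|\mathcal S_t|^{-\frac2d}+C_b|\mathcal S_b|^{-\frac2d},$$ where $$C_i=C_sN^{(3d+s+7)(6s+24)}(\ln N)^{6(s+4)^2}+C_Q+\lambda C_sN^{(3d+s+8)(6s+30)}(\ln N)^{6(s+5)^2},$$ $$C_t=C_b=C_sN^{(3d+s+5)(6s+12)}(\ln N)^{6(s+2)^2}.$$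
   Context: Dimension and domain: $d\in\{2,3\}$, $\mathcal T>0$; $k,s$ are integers. For $d=3$, $\mathcal M=(0,1)\times(0,1)$, $\mathcal D=\mathcal M\times(0,1)$, points $\boldsymbol x=(\boldsymbol x',z)$, $\boldsymbol x'=(x,y)$, $\nabla_h=(\partial_x,\partial_y)$, $\Delta_h=\partial_{xx}+\partial_{yy}$. For $d=2$ everything is independent of $y$: $\mathcal M=(0,1)$, coordinates $(x,z)$, and the notation is adapted accordingly. $D^\alpha$ denotes spatial partial derivatives; for vector quantities squares mean squared Euclidean norms. Equations being approximated: the primitive equations $\partial_tV+V\cdot\nabla_hV+w\partial_zV-\nu_h\Delta_hV-\nu_z\partial_{zz}V+f_0V^\perp+\nabla_hp=0$, $\partial_zp+T=0$, $\nabla_h\cdot V+\partial_zw=0$, $\partial_tT+V\cdot\nabla_hT+w\partial_zT-\kappa_h\Delta_hT-\kappa_z\partial_{zz}T=Q$ on $[0,\mathcal T]\times\mathcal D$, for horizontal velocity $V$ ($V=(u,v)$, $V^\perp=(-v,u)$ for $d=3$), vertical velocity $w$, pressure $p$, temperature $T$, with given heat source $Q$, Coriolis parameter $f_0\in\mathbb R$ and initial data $(V,T)|_{t=0}=(V_0,T_0)$; all unknowns are periodic of period 1 in each spatial variable, $V,p$ even in $z$, $w,T$ odd in $z$. Either $\nu_h,\kappa_h,\nu_z,\kappa_z>0$, or $\nu_h,\kappa_h>0$ and $\nu_z=\kappa_z=0$. The data are regular as assumed throughout the paper's error analysis: for some $r>\frac d2+2k$, $V_0\in H^r$ (periodic,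 even in $z$, with $\int_0^1\nabla_h\cdot V_0\,dz=0$), $T_0\in H^r$ (periodic, odd in $z$), and $Q\in C^{k-1}([0,\mathcal T];H^r)$ (periodic, odd in $z$). PINNs and the parameter $N$: $V_\theta$ (with $d-1$ scalar components), $w_\theta,p_\theta,T_\theta$ are tanh neural networks in the variables $(\boldsymbol x,t)$, with two hidden layers, i.e. compositions $\mathcal A_3\circ(\sigma\circ\mathcal A_2)\circ(\sigma\circ\mathcal A_1)$ with $\sigma=\tanh$ componentwise and $\mathcal A_j(x)=\mathcal W_jx+b_j$; $\theta$ collects all weights $\mathcal W_j$ and biases $b_j$. The integer $N>5$ is the size parameter of the network architecture used to approximate the solution of the primitive equations; for the networks of that architecture, with $n$ as in the claim, the width is $\mathcal O(N^{d+1})$ and the weights scale as $\mathcal O(N\ln N)$. PDE residuals: $\mathcal R_{i,V}[\theta]=\partial_tV_\theta+V_\theta\cdot\nabla_hV_\theta+w_\theta\partial_zV_\theta+f_0V_\theta^\perp-\nu_h\Delta_hV_\theta-\nu_z\partial_{zz}V_\theta+\nabla_hp_\theta$, $\ \mathcal R_{i,p}[\theta]=\partial_zp_\theta+T_\theta$, $\mathcal R_{i,T}[\theta]=\partial_tT_\theta+V_\theta\cdot\nabla_hT_\theta+w_\theta\partial_zT_\theta-\kappa_h\Delta_hT_\theta-\kappa_z\partial_{zz}T_\theta-Q$, $\ \mathcal R_{i,div}[\theta]=\nabla_h\cdot V_\theta+\partial_zw_\theta$. Initial residuals: $\mathcal R_{t,V}[\theta]=V_\theta(t=0)-V_0$,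 $\mathcal R_{t,T}[\theta]=T_\theta(t=0)-T_0$. Boundary residual (for $d=3$; drop the $y$ terms for $d=2$), with $t$ suppressed: $$\mathcal R_b[s;\theta]=\Big\{\sum_{\varphi\in\{V_\theta,w_\theta,p_\theta,T_\theta\}}\sum_{|\alpha|\le s}\Big[(D^\alpha\varphi(1,y,z)-D^\alpha\varphi(0,y,z))^2+(D^\alpha\varphi(x,1,z)-D^\alpha\varphi(x,0,z))^2+(D^\alpha\varphi(x,y,1)-D^\alpha\varphi(x,y,0))^2\Big]$$ $$+\sum_{|\alpha|\le s,\ \alpha_3=0}\Big[(D^\alpha w_\theta(x,y,1))^2+(D^\alpha w_\theta(x,y,0))^2\Big]\Big\}^{1/2},$$ where $\alpha_3=0$ means no $z$-derivative. Generalization error, with penalty parameter $\lambda>0$: $\mathcal E_G[s;\theta]=\big(\mathcal E_G^i[s;\theta]^2+\mathcal E_G^t[s;\theta]^2+\mathcal E_G^b[s;\theta]^2+\lambda\,\mathcal E_G^p[s;\theta]^2\big)^{1/2}$, where $\mathcal E_G^i[s;\theta]^2=\int_0^{\mathcal T}\big(\|\mathcal R_{i,V}\|_{H^s(\mathcal D)}^2+\|\mathcal R_{i,p}\|_{H^s(\mathcal D)}^2+\|\mathcal R_{i,T}\|_{H^s(\mathcal D)}^2+\|\mathcal R_{i,div}\|_{H^s(\mathcal D)}^2\big)dt$, $\mathcal E_G^t[s;\theta]^2=\|\mathcal R_{t,V}\|_{H^s(\mathcal D)}^2+\|\mathcal R_{t,T}\|_{H^s(\mathcal D)}^2$, $\mathcal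 E_G^b[s;\theta]^2=\int_0^{\mathcal T}\|\mathcal R_b[s;\theta]\|_{L^2(\partial\mathcal D)}^2dt$, $\mathcal E_G^p[s;\theta]^2=\int_0^{\mathcal T}\big(\|V_\theta\|_{H^{s+3}(\mathcal D)}^2+\|p_\theta\|_{H^{s+3}(\mathcal D)}^2+\|w_\theta\|_{H^{s+3}(\mathcal D)}^2+\|T_\theta\|_{H^{s+3}(\mathcal D)}^2\big)dt$. Sample sets (midpoint rule): $\mathcal S_i$, $\mathcal S_t$, $\mathcal S_b$ are the sets of midpoints of cubes of edge lengths $l_i,l_t,l_b$ in $[0,\mathcal T]\times\mathcal D$, $\mathcal D$, $[0,\mathcal T]\times\partial\mathcal D$ respectively, with $l_i\sim|\mathcal S_i|^{-1/(d+1)}$, $l_t\sim|\mathcal S_t|^{-1/d}$, $l_b\sim|\mathcal S_b|^{-1/d}$. The quadrature weights are $w_n^i=1/|\mathcal S_i|$, $w_n^t=1/|\mathcal S_t|$, $w_n^b=1/|\mathcal S_b|$. Training error: $\mathcal E_T[s;\theta;\mathcal S]=\big(\mathcal E_T^i[s;\theta;\mathcal S_i]^2+\mathcal E_T^t[s;\theta;\mathcal S_t]^2+\mathcal E_T^b[s;\theta;\mathcal S_b]^2+\lambda\mathcal E_T^p[s;\theta;\mathcal S_i]^2\big)^{1/2}$, where $\mathcal E_T^i[s;\theta;\mathcal S_i]^2=\sum_{\mathcal S_i}\sum_{|\alpha|\le s}w_n^i\big[(D^\alpha\mathcal R_{i,V})^2+(D^\alpha\mathcal R_{i,p})^2+(D^\alpha\mathcal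 R_{i,T})^2+(D^\alpha\mathcal R_{i,div})^2\big]$, $\mathcal E_T^t[s;\theta;\mathcal S_t]^2=\sum_{\mathcal S_t}\sum_{|\alpha|\le s}w_n^t\big[(D^\alpha\mathcal R_{t,V})^2+(D^\alpha\mathcal R_{t,T})^2\big]$, $\mathcal E_T^b[s;\theta;\mathcal S_b]^2=\sum_{\mathcal S_b}w_n^b\,(\mathcal R_b[s;\theta])^2$, $\mathcal E_T^p[s;\theta;\mathcal S_i]^2=\sum_{\mathcal S_i}\sum_{|\alpha|\le s+3}w_n^i\big[(D^\alpha V_\theta)^2+(D^\alpha p_\theta)^2+(D^\alpha w_\theta)^2+(D^\alpha T_\theta)^2\big]$, all summands being evaluated at the sample points. Constants: $C_s$ and $C_Q$ are constants whose subscripts emphasize their dependence (on $s$, respectively on $Q$); they do not depend on the trained network parameters, on $N$, or on the sample sets.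
   Formalization: The quadrature weights are taken as the midpoint-rule cell measures T/|S_i|, 1/|S_t| and 2dT/|S_b| instead of 1/|S_i|, 1/|S_t|, 1/|S_b|; with the literal weights the estimate fails, e.g. for constant networks. *)

(* Defs.v *)
From HB Require Import structures.
From mathcomp Require Import all_boot all_order all_algebra.
From mathcomp Require Import all_classical all_reals all_analysis.
Set Implicit Arguments.
Unset Strict Implicit.
Unset Printing Implicit Defensive.
Import Order.TTheory GRing.Theory Num.Theory.
Import numFieldNormedType.Exports.
Local Open Scope classical_set_scope.
Local Open Scope ring_scope.

(* Throughout, h = d - 1 is the number of horizontal dimensions, so that a
   spatial point (x', z) is a row vector of size h.+1 whose last coordinate is
   z, and a space-time field is a function of the time and of the point. *)

Section Calculus.
Variable R : realType.

Definition partial n (i : 'I_n.+1) (f : 'rV[R]_n.+1 -> R) : 'rV[R]_n.+1 -> R :=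
  fun x => 'D_(delta_mx 0 i) f x.

Definition multiindex n s := {ffun 'I_n -> 'I_s.+1}.

Definition mi_order n s (a : multiindex n s) : nat := (\sum_i a i)%N.

Definition Dmulti n s (a : multiindex n.+1 s) (f : 'rV[R]_n.+1 -> R) :
    'rV[R]_n.+1 -> R :=
  foldr (fun i g => iter (a i) (partial i) g) f (enum 'I_n.+1).

Definition dt (V : Type) (u : R -> V -> R) : R -> V -> R :=
  fun t x => derive1 (u^~ x) t.

Definition set_coord n (x : 'rV[R]_n) (i : 'I_n) (c : R) : 'rV[R]_n :=
  \row_j if j == i then c else x 0 j.

Definition time_int (T : R) (g : R -> R) : R :=
  \int[@lebesgue_measure R]_(t in `[0, T]) g t.

(* Integral over [0,1]^n, as an iterated Lebesgue integral; every integrand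
   below is continuous on the closed cube. *)
Fixpoint cube_int n : ('rV[R]_n -> R) -> R :=
  match n with
  | 0 => fun f => f 0
  | n'.+1 => fun f =>
      \int[@lebesgue_measure R]_(x in `[0, 1])
        cube_int (fun y : 'rV[R]_n' => f (row_mx (x%:M : 'rV[R]_1) y))
  end.

(* The point of the face {x_a = b} of [0,1]^(n+1) whose remaining coordinates
   are y. *)
Definition face_point n (a : 'I_n.+1) (b : bool) (y : 'rV[R]_n) : 'rV[R]_n.+1 :=
  \row_j if unlift a j is Some i then y 0 i else b%:R.

Definition boundary_int n (g : 'rV[R]_n.+1 -> R) : R :=
  \sum_(a < n.+1) \sum_(b : bool) cube_int (fun y => g (face_point a b y)).

Definition sobolev_norm2 n s (f : 'rV[R]_n.+1 -> R) : R :=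
  \sum_(a : multiindex n.+1 s | (mi_order a <= s)%N)
    cube_int (fun x => Dmulti a f x ^+ 2).

Definition sobolev_density n s (f : 'rV[R]_n.+1 -> R) (x : 'rV[R]_n.+1) : R :=
  \sum_(a : multiindex n.+1 s | (mi_order a <= s)%N) Dmulti a f x ^+ 2.

End Calculus.

(* The spaces H^r of 1-periodic functions of n variables, r real.  A family c
   of pairs (real part, imaginary part) is the family of Fourier coefficients
   of a real function, and the H^r norm is the usual weighted l^2 norm of c.
   For r > n / 2 the Fourier series converges absolutely, so membership in H^r
   is stated for the continuous representative, as a pointwise equality with
   the sum of the series over growing boxes of frequencies. *)
Section PeriodicSobolev.
Variables (R : realType) (n : nat).

Definition freq := {ffun 'I_n -> int}.
Definition coefs := freq -> R * R.

Definition freq_norm2 (m : freq) : R := \sum_i ((m i) ^+ 2)%:~R.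

Definition phase (m : freq) (x : 'rV[R]_n) : R :=
  2 * pi * \sum_i (m i)%:~R * x 0 i.

Definition hermitian (c : coefs) : Prop :=
  forall m, c (- m) = ((c m).1, - (c m).2).

Definition Hr_norm2 (r : R) (c : coefs) : \bar R :=
  \esum_(m in [set: freq])
    (((1 + freq_norm2 m) `^ r) * ((c m).1 ^+ 2 + (c m).2 ^+ 2))%:E.

Definition box_freq K (q : {ffun 'I_n -> 'I_(K.*2.+1)}) : freq :=
  [ffun i => (q i)%:Z - K%:Z].

Definition fourier_sum (c : coefs) (K : nat) (x : 'rV[R]_n) : R :=
  \sum_(q : {ffun 'I_n -> 'I_(K.*2.+1)})
    ((c (box_freq q)).1 * cos (phase (box_freq q) x)
     - (c (box_freq q)).2 * sin (phase (box_freq q) x)).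

Definition Hr_repr (r : R) (c : coefs) (f : 'rV[R]_n -> R) : Prop :=
  [/\ hermitian c, (Hr_norm2 r c < +oo)%E
    & forall x, fourier_sum c ^~ x @ \oo --> f x].

Definition periodic_Hr (r : R) (f : 'rV[R]_n -> R) : Prop :=
  exists c, Hr_repr r c f.

(* Q is in C^j([0,T]; H^r): A i is the i-th derivative in time of the curve of
   Fourier coefficients of Q. *)
Definition Cj_Hr (j : nat) (T r : R) (Q : R -> 'rV[R]_n -> R) : Prop :=
  exists A : nat -> R -> coefs,
    [/\ forall t, t \in `[0, T] -> Hr_repr r (A 0 t) (Q t),
        forall i t, (i <= j)%N -> t \in `[0, T] ->
          (Hr_norm2 r (A i t) < +oo)%E /\
          Hr_norm2 r (A i u - A i t) @[u --> within `[0, T] (nbhs t)] --> 0%E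
      & forall i t, (i < j)%N -> t \in `[0, T] ->
          Hr_norm2 r ((u - t)^-1 *: (A i u - A i t) - A i.+1 t)
            @[u --> within `[0, T] t^'] --> 0%E].

End PeriodicSobolev.

Section Networks.
Variable R : realType.

Definition tanh (x : R) : R :=
  (expR x - expR (- x)) / (expR x + expR (- x)).

Record tanh_net (din dout : nat) := TanhNet {
  width1 : nat;
  width2 : nat;
  weight1 : 'M[R]_(width1, din);
  bias1 : 'cV[R]_width1;
  weight2 : 'M[R]_(width2, width1);
  bias2 : 'cV[R]_width2;
  weight3 : 'M[R]_(dout, width2);
  bias3 : 'cV[R]_dout }.

Definition net_eval din dout (u : tanh_net din dout) (x : 'cV[R]_din) :
    'cV[R]_dout :=
  let y1 := map_mx tanh (weight1 u *m x + bias1 u) in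
  let y2 := map_mx tanh (weight2 u *m y1 + bias2 u) in
  weight3 u *m y2 + bias3 u.

Definition mx_bounded m n (B : R) (A : 'M[R]_(m, n)) : Prop :=
  forall i j, `|A i j| <= B.

Definition net_bounded din dout (width B : R) (u : tanh_net din dout) : Prop :=
  [/\ (width1 u)%:R <= width /\ (width2 u)%:R <= width,
      mx_bounded B (weight1 u) /\ mx_bounded B (bias1 u),
      mx_bounded B (weight2 u) /\ mx_bounded B (bias2 u)
    & mx_bounded B (weight3 u) /\ mx_bounded B (bias3 u)].

Record pinn (h : nat) := Pinn {
  netV : tanh_net (h.+1 + 1) h;
  netw : tanh_net (h.+1 + 1) 1;
  netp : tanh_net (h.+1 + 1) 1;
  netT : tanh_net (h.+1 + 1) 1 }.

Definition space_time n (x : 'rV[R]_n) (t : R) : 'cV[R]_(n + 1) :=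
  col_mx x^T t%:M.

Section Fields.
Variables (h : nat) (theta : pinn h).

Definition V_ (i : 'I_h) (t : R) (x : 'rV[R]_h.+1) : R :=
  net_eval (netV theta) (space_time x t) i 0.
Definition w_ (t : R) (x : 'rV[R]_h.+1) : R :=
  net_eval (netw theta) (space_time x t) 0 0.
Definition p_ (t : R) (x : 'rV[R]_h.+1) : R :=
  net_eval (netp theta) (space_time x t) 0 0.
Definition T_ (t : R) (x : 'rV[R]_h.+1) : R :=
  net_eval (netT theta) (space_time x t) 0 0.

End Fields.

(* Width O(N^(d+1)), weights and biases O(N ln N), with implied constant K. *)
Definition in_architecture h (K : R) (N : nat) (theta : pinn h) : Prop :=
  let W := K * N%:R ^+ h.+2 in
  let B := K * N%:R * ln N%:R in
  [/\ net_bounded W B (netV theta), net_bounded W B (netw theta),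
      net_bounded W B (netp theta) & net_bounded W B (netT theta)].

End Networks.

Section PrimitiveEquations.
Variables (R : realType) (h : nat).
Let point := 'rV[R]_h.+1.

Record pe_coefs := PeCoefs {
  nu_h : R; nu_z : R; kappa_h : R; kappa_z : R; f0 : R }.

Definition viscosity_assumption (c : pe_coefs) : Prop :=
  [/\ 0 < nu_h c, 0 < kappa_h c
    & (0 < nu_z c /\ 0 < kappa_z c) \/ (nu_z c = 0 /\ kappa_z c = 0)].

Definition hdir (i : 'I_h) : 'I_h.+1 := widen_ord (leqnSn h) i.
Definition zdir : 'I_h.+1 := ord_max.

Definition even_z (f : point -> R) : Prop :=
  forall x, f (set_coord x zdir (- x 0 zdir)) = f x.
Definition odd_z (f : point -> R) : Prop :=
  forall x, f (set_coord x zdir (- x 0 zdir)) = - f x.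

Definition laplace_h (f : point -> R) (x : point) : R :=
  \sum_(j < h) partial (hdir j) (partial (hdir j) f) x.

Definition divergence_h (V : 'I_h -> point -> R) (x : point) : R :=
  \sum_(j < h) partial (hdir j) (V j) x.

Definition dzz (f : point -> R) : point -> R := partial zdir (partial zdir f).

Definition initial_assumption (r : R) (V0 : 'I_h -> point -> R)
    (T0 : point -> R) : Prop :=
  [/\ forall i, periodic_Hr r (V0 i) /\ even_z (V0 i),
      forall x, \int[@lebesgue_measure R]_(z in `[0, 1])
                  divergence_h V0 (set_coord x zdir z) = 0
    & periodic_Hr r T0 /\ odd_z T0].

Definition source_assumption (k : nat) (T r : R) (Q : R -> point -> R) : Prop :=
  Cj_Hr k.-1 T r Q /\ forall t, t \in `[0, T] -> odd_z (Q t).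

End PrimitiveEquations.

(* (u,v)^perp = (-v,u).  For a single horizontal dimension V reduces to its
   first component u and v is absent, so the Coriolis term vanishes. *)
Definition perp (R : realType) (h : nat) : ('I_h -> R) -> 'I_h -> R :=
  match h with
  | 2 => fun V i => if i == ord0 then - V ord_max else V ord0
  | _ => fun _ _ => 0
  end.

Section Errors.
Variables (R : realType) (h : nat).
Let point := 'rV[R]_h.+1.
Variables (Tf : R) (c : pe_coefs R) (Q : R -> point -> R)
  (V0 : 'I_h -> point -> R) (T0 : point -> R).
Variable theta : pinn R h.

Let V := V_ theta.
Let w := w_ theta.
Let p := p_ theta.
Let T := T_ theta.

Definition transport (phi : R -> point -> R) (t : R) (x : point) : R :=
  \sum_(j < h) V j t x * partial (hdir j) (phi t) x
  + w t x * partial (zdir h) (phi t) x.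

Definition res_V (i : 'I_h) (t : R) (x : point) : R :=
  dt (V i) t x + transport (V i) t x + f0 c * perp (fun j => V j t x) i
  - nu_h c * laplace_h (V i t) x - nu_z c * dzz (V i t) x
  + partial (hdir i) (p t) x.

Definition res_p (t : R) (x : point) : R := partial (zdir h) (p t) x + T t x.

Definition res_T (t : R) (x : point) : R :=
  dt T t x + transport T t x
  - kappa_h c * laplace_h (T t) x - kappa_z c * dzz (T t) x - Q t x.

Definition res_div (t : R) (x : point) : R :=
  divergence_h (fun i => V i t) x + partial (zdir h) (w t) x.

Definition res_tV (i : 'I_h) (x : point) : R := V i 0 x - V0 i x.
Definition res_tT (x : point) : R := T 0 x - T0 x.

Definition jumps2 s (phi : R -> point -> R) (t : R) (x : point) : R :=
  \sum_(a : multiindex h.+1 s | (mi_order a <= s)%N)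
    \sum_(i < h.+1) (Dmulti a (phi t) (set_coord x i 1)
                     - Dmulti a (phi t) (set_coord x i 0)) ^+ 2.

Definition res_b s (t : R) (x : point) : R :=
  Num.sqrt
    (\sum_(i < h) jumps2 s (V i) t x
     + jumps2 s w t x + jumps2 s p t x + jumps2 s T t x
     + \sum_(a : multiindex h.+1 s | (mi_order a <= s)%N && (a (zdir h) == ord0))
         (Dmulti a (w t) (set_coord x (zdir h) 1) ^+ 2
          + Dmulti a (w t) (set_coord x (zdir h) 0) ^+ 2)).

(* Squares of the parts of the generalization error. *)

Definition EG_i2 s : R :=
  time_int Tf (fun t =>
    \sum_(i < h) sobolev_norm2 s (res_V i t) + sobolev_norm2 s (res_p t)
    + sobolev_norm2 s (res_T t) + sobolev_norm2 s (res_div t)).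

Definition EG_t2 s : R :=
  \sum_(i < h) sobolev_norm2 s (res_tV i) + sobolev_norm2 s res_tT.

Definition EG_b2 s : R :=
  time_int Tf (fun t => boundary_int (fun x => res_b s t x ^+ 2)).

Definition EG_p2 s : R :=
  time_int Tf (fun t =>
    \sum_(i < h) sobolev_norm2 (s + 3) (V i t) + sobolev_norm2 (s + 3) (p t)
    + sobolev_norm2 (s + 3) (w t) + sobolev_norm2 (s + 3) (T t)).

Definition EG (lambda : R) s : R :=
  Num.sqrt (EG_i2 s + EG_t2 s + EG_b2 s + lambda * EG_p2 s).

(* Weight of the midpoint rule on a domain of measure mes, i.e. the measure of
   one cell.  The weight is 1 / |S| for a domain normalized to measure 1;
   without the factor mes the quadrature sums would not converge to the
   integrals over [0,T] x D and [0,T] x dD. *)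
Definition quad_weight (mes : R) (X : Type) (S : seq X) : R :=
  mes / (size S)%:R.

Definition quadrature (mes : R) (X : Type) (S : seq X) (g : X -> R) : R :=
  \sum_(x <- S) quad_weight mes S * g x.

(* Squares of the parts of the training error; the measures of [0,T] x D, of D
   and of [0,T] x dD are T, 1 and 2 d T. *)

Definition ET_i2 s (Si : seq (R * point)) : R :=
  quadrature Tf Si (fun y =>
    \sum_(i < h) sobolev_density s (res_V i y.1) y.2
    + sobolev_density s (res_p y.1) y.2
    + sobolev_density s (res_T y.1) y.2
    + sobolev_density s (res_div y.1) y.2).

Definition ET_t2 s (St : seq point) : R :=
  quadrature 1 St (fun x =>
    \sum_(i < h) sobolev_density s (res_tV i) x + sobolev_density s res_tT x).

Definition ET_b2 s (Sb : seq (R * point)) : R :=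
  quadrature (2 * h.+1%:R * Tf) Sb (fun y => res_b s y.1 y.2 ^+ 2).

Definition ET_p2 s (Si : seq (R * point)) : R :=
  quadrature Tf Si (fun y =>
    \sum_(i < h) sobolev_density (s + 3) (V i y.1) y.2
    + sobolev_density (s + 3) (p y.1) y.2
    + sobolev_density (s + 3) (w y.1) y.2
    + sobolev_density (s + 3) (T y.1) y.2).

Definition ET (lambda : R) s (Si : seq (R * point)) (St : seq point)
    (Sb : seq (R * point)) : R :=
  Num.sqrt (ET_i2 s Si + ET_t2 s St + ET_b2 s Sb + lambda * ET_p2 s Si).

End Errors.

Section Samples.
Variables (R : realType) (h : nat).

Definition midpoint (M j : nat) : R := (j%:R + 2^-1) / M%:R.

Definition time_midpoints (T : R) (m : nat) : seq R :=
  [seq T * midpoint m j | j <- iota 0 m].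

Definition cube_midpoints n (M : nat) : seq 'rV[R]_n :=
  [seq \row_i midpoint M (q i) | q : {ffun 'I_n -> 'I_M}].

Definition boundary_midpoints (M : nat) : seq 'rV[R]_h.+1 :=
  flatten [seq [seq face_point ab.1 ab.2 y | y <- cube_midpoints h M]
          | ab : 'I_h.+1 * bool].

(* l ~ e, with explicit implied constant K. *)
Definition similar (K l e : R) : Prop := K^-1 * e <= l <= K * e.

(* Cells of edge T / m in time and 1 / M in space.  Exact space-time cubes,
   T / m = 1 / M, are included but exist only for rational T, so both edges
   are only required to be comparable to the prescribed power of |S|. *)

Definition interior_samples (T K : R) (S : seq (R * 'rV[R]_h.+1)) : Prop :=
  exists m M : nat,
    [/\ (0 < m)%N /\ (0 < M)%N,
        S = [seq (t, x) | t <- time_midpoints T m, x <- cube_midpoints h.+1 M],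
        similar K (T / m%:R) ((size S)%:R `^ (- (h.+2%:R^-1)))
      & similar K (M%:R^-1) ((size S)%:R `^ (- (h.+2%:R^-1)))].

Definition initial_samples (K : R) (S : seq 'rV[R]_h.+1) : Prop :=
  exists M : nat,
    [/\ (0 < M)%N, S = cube_midpoints h.+1 M
      & similar K (M%:R^-1) ((size S)%:R `^ (- (h.+1%:R^-1)))].

Definition boundary_samples (T K : R) (S : seq (R * 'rV[R]_h.+1)) : Prop :=
  exists m M : nat,
    [/\ (0 < m)%N /\ (0 < M)%N,
        S = [seq (t, x) | t <- time_midpoints T m, x <- boundary_midpoints M],
        similar K (T / m%:R) ((size S)%:R `^ (- (h.+1%:R^-1)))
      & similar K (M%:R^-1) ((size S)%:R `^ (- (h.+1%:R^-1)))].

End Samples.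

(* Main.v *)
Require Import Defs.
From HB Require Import structures.
From mathcomp Require Import all_boot all_order all_algebra.
From mathcomp Require Import all_classical all_reals all_analysis.
From mathcomp Require Import ring lra zify.
Set Implicit Arguments.
Unset Strict Implicit.
Unset Printing Implicit Defensive.
Import Order.TTheory GRing.Theory Num.Theory.
Import numFieldNormedType.Exports.
Local Open Scope classical_set_scope.
Local Open Scope ring_scope.

(** The square of the generalization error is a sum of integrals of squares of
derivatives, and the square of the training error replaces each integral by a
composite midpoint rule on a product grid.  Such a rule with cells of edge l has
error O(A l^2) as soon as the second differences of step u of the integrand are
at most A u^2, and l^2 is the stated power of the number of samples.  It remains
to bound A for each integrand.

Quadrature.  The class [c11] bounds values, first differences and second
differences along the coordinate axes only.  It is stable under sums, squares
and substitutions of coordinates, and integrating or averaging over some of the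
variables keeps the bounds in the others; so the one-variable rule
[midpoint_rule] can be applied to one coordinate at a time, [midpoint_step].
Since taking squares merely squares the constant, only the residuals and the
fields themselves have to be bounded, with two derivatives beyond the order s of
the error.

Networks.  All derivatives of order j of a tanh network with two hidden layers,
width at most W and weights at most B are bounded by a lam^j, with a of order
W B and lam of order W B^2, [net_Cw].  Every term of a residual is a product of
at most two fields with at most two derivatives in total, so the derivatives of
order s + 2 of a residual are O(a^2 lam^(s+4)).  With W of order N^(d+1) and B of
order N ln N, the squares of these bounds are products of powers of N and of
ln N whose exponents are smaller than those of the theorem.

Data.  The functions V_0, T_0 and Q are sums of Fourier series.  Because
r >= 2 (s + 2) + d, the coefficients are absolutely summable against the weight
of s + 2 derivatives, [l1_of_hr].  The derivatives of the partial sums are then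
bounded uniformly, and bounds on differences pass to the limit, [Cj_Hr_c11]; in
time, Q uses two derivatives of its curve of coefficients, bounded on [0, T] by
compactness.

Separation of the constants.  The temperature residual is a network part minus
Q.  By (A + q)^2 <= 2 A^2 + 2 q^2 the constant of its square is the sum of one
that depends on the network and one that depends on Q, the latter being free of
N and lambda, [block_sub].  The initial data are separated in the same way and
absorbed in C_s, the powers of N and ln N being at least 1. *)

(** * The midpoint rule in one variable *)

Section OneVariable.
Variable R : realType.
Implicit Types (f g phi : R -> R) (a b c u M L T : R).

Lemma mvt_le f (f' : R -> R) a b M :
  a <= b -> {within `[a, b], continuous f} ->
  (forall x : R, a < x < b -> is_derive x 1 f (f' x)) ->
  (forall x : R, a < x < b -> `|f' x| <= M) ->
  `|f b - f a| <= M * (b - a).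
Proof.
rewrite le_eqVlt => /orP[/eqP -> _ _ _|ab cf df Mf].
  by rewrite !subrr normr0 mulr0.
have df' x : x \in `]a, b[ -> is_derive x 1 f (f' x) by rewrite in_itv; exact: df.
have [x + ->] := MVT ab df' cf; rewrite in_itv/= => xab.
rewrite normrM (gtr0_norm (x := b - a)) ?subr_gt0//.
by rewrite ler_wpM2r ?subr_ge0 ?(ltW ab)// Mf.
Qed.

(** The two halves of the second difference are u times values of f' at points
at distance at most 2 u, hence the factor 2. *)
Lemma second_diff_le f (f' : R -> R) c u M :
  0 <= u -> {within `[c - u, c + u], continuous f} ->
  (forall x : R, c - u < x < c + u -> is_derive x 1 f (f' x)) ->
  (forall x y : R, c - u < x < c + u -> c - u < y < c + u ->
     `|f' x - f' y| <= M * `|x - y|) ->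
  `|f (c + u) + f (c - u) - 2 * f c| <= 2 * M * u ^+ 2.
Proof.
rewrite le_eqVlt => /orP[/eqP <- _ _ _|u0 cf df Lf].
  by rewrite !subr0 addr0 expr2 !mulr0 -mulr2n -[_ *+ 2]mulr_natl subrr normr0.
have cf1 : {within `[c, c + u], continuous f}.
  by apply: continuous_subspaceW cf => x /=; rewrite !in_itv /=; lra.
have cf2 : {within `[c - u, c], continuous f}.
  by apply: continuous_subspaceW cf => x /=; rewrite !in_itv /=; lra.
have df1 x : x \in `]c, c + u[ -> is_derive x 1 f (f' x).
  by rewrite in_itv /= => xI; apply: df; lra.
have df2 x : x \in `]c - u, c[ -> is_derive x 1 f (f' x).
  by rewrite in_itv /= => xI; apply: df; lra.
have [x xI E1] := MVT (ltac:(lra) : c < c + u) df1 cf1.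
have [y yI E2] := MVT (ltac:(lra) : c - u < c) df2 cf2.
move: xI yI; rewrite !in_itv /= => xI yI.
have -> : f (c + u) + f (c - u) - 2 * f c = (f' x - f' y) * u.
  have e1 : f (c + u) - f c = f' x * u by rewrite E1; congr (_ * _); ring.
  have e2 : f c - f (c - u) = f' y * u by rewrite E2; congr (_ * _); ring.
  by rewrite mulrBl -e1 -e2; ring.
have := Lf x y ltac:(lra) ltac:(lra); rewrite normrM (gtr0_norm u0) => Lxy.
have M0 : 0 <= M.
  by rewrite -(@pmulr_lge0 _ `|x - y|) ?normr_gt0 ?subr_eq0 ?gt_eqF//; [exact: le_trans Lxy | lra].
have xy : `|x - y| <= 2 * u by rewrite ler_norml; apply/andP; split; lra.
rewrite expr2 mulrA ler_wpM2r ?(ltW u0)//; apply: (le_trans Lxy).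
by rewrite mulrAC mulrC ler_wpM2r.
Qed.

Lemma is_derive_mulr (b x : R) : is_derive x 1 (fun y : R => y * b) b.
Proof.
rewrite (_ : (fun y : R => _) = (b \*: id)); last first.
  by apply/funext => y /=; rewrite mulrC.
by apply: is_derive_eq; rewrite /GRing.scale/= mulr1.
Qed.

(** The mean value inequality applied to f x - x f' 0. *)
Lemma taylor1_le f (f' f'' : R -> R) u M :
  (forall x : R, is_derive x 1 f (f' x)) -> (forall x : R, is_derive x 1 f' (f'' x)) ->
  (forall x : R, `|f'' x| <= M) ->
  `|f u - f 0 - u * f' 0| <= M * u ^+ 2.
Proof.
move=> df df' Mf''.
have cts (g : R -> R) (g' : R -> R) (a b : R) : (forall x : R, is_derive x 1 g (g' x)) ->
    {within `[a, b], continuous g}.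
  by move=> dg; apply: derivable_within_continuous => x _; apply: ex_derive.
have L x : `|f' x - f' 0| <= M * `|x|.
  have [x0|x0] := leP 0 x.
    have := @mvt_le f' f'' 0 x M x0 (cts _ _ _ _ df') (fun x _ => df' x) (fun x _ => Mf'' x).
    by rewrite subr0 (ger0_norm x0).
  have := @mvt_le f' f'' x 0 M (ltW x0) (cts _ _ _ _ df') (fun x _ => df' x) (fun x _ => Mf'' x).
  by rewrite sub0r (ltr0_norm x0) distrC.
have M0 : 0 <= M by apply: le_trans (Mf'' 0).
pose g (x : R) : R := f x - x * f' 0.
have dg (x : R) : is_derive x 1 g (f' x - f' 0).
  rewrite /g; apply: is_deriveB.
  exact: is_derive_mulr.
have -> : f u - f 0 - u * f' 0 = g u - g 0 by rewrite /g; ring.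
have [u0|u0] := leP 0 u.
  have := @mvt_le g _ 0 u (M * u) u0 (cts _ _ _ _ dg) (fun x _ => dg x).
  rewrite subr0 -mulrA -expr2; apply => x /andP[x0 xu].
  by apply: le_trans (L x) _; rewrite gtr0_norm// ler_wpM2l// ltW.
have := @mvt_le g _ u 0 (M * - u) (ltW u0) (cts _ _ _ _ dg) (fun x _ => dg x).
rewrite sub0r -mulrA -expr2 sqrrN distrC; apply => x /andP[x0 xu].
by apply: le_trans (L x) _; rewrite ltr0_norm// ler_wpM2l// lerN2 ltW.
Qed.

Lemma lipschitz_continuous L phi :
  (forall x y, `|phi x - phi y| <= L * `|x - y|) -> continuous phi.
Proof.
move=> Lphi x; apply/cvgrPdist_le => e e0.
have K0 : 0 < `|L| + 1 by rewrite ltr_wpDl.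
near=> y; apply: le_trans (Lphi x y) _.
have : `|x - y| <= e / (`|L| + 1).
  near: y; apply: cvgr_dist_le; first exact: cvg_id.
  by rewrite divr_gt0.
rewrite ler_pdivlMr// => H; apply: le_trans H; rewrite mulrC ler_wpM2l//.
by apply: le_trans (ler_norm _) _; rewrite lerDl.
Unshelve. all: by end_near. Qed.

Lemma lipschitz_integrable L phi a b :
  (forall x y, `|phi x - phi y| <= L * `|x - y|) ->
  (@lebesgue_measure R).-integrable `[a, b] (EFin \o phi).
Proof.
move=> Lphi; apply: continuous_compact_integrable; first exact: segment_compact.
by apply: continuous_subspaceT; apply: lipschitz_continuous Lphi.
Qed.

(** On a cell of centre c, let psi v be the integral of phi over [c - v, c + v]
minus 2 v phi c.  The derivative of psi is the second difference of phi at c, so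
psi is at most M d^3 on the half-edge d of the cell. *)
Lemma midpoint_rule_lip T M L phi m : 0 < T -> (0 < m)%N ->
  (forall x y, `|phi x - phi y| <= L * `|x - y|) ->
  (forall c u, 0 <= u -> 0 <= c - u -> c + u <= T ->
     `|phi (c + u) + phi (c - u) - 2 * phi c| <= M * u ^+ 2) ->
  `|time_int T phi - \sum_(j < m) T / m%:R * phi (T * midpoint R m j)|
    <= T * M * (T / m%:R) ^+ 2.
Proof.
move=> T0 m0 Lphi Sphi.
have iphi a b := @lipschitz_integrable L phi a b Lphi.
(* Starting the primitive at -1 makes it differentiable at 0 and T as well. *)
pose P (x : R) : R := (\int[@lebesgue_measure R]_(t in `[-1, x]) phi t)%R.
have dP (x : R) : -1 < x -> is_derive x 1 P (phi x).
  move=> x1; have xx1 : x < x + 1 by rewrite ltrDl.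
  have cx : {for x, continuous phi} by exact: lipschitz_continuous Lphi x.
  have [dPx Px] := continuous_FTC1_closed xx1 (iphi (-1) (x + 1)) x1 cx.
  by apply: DeriveDef; [exact: dPx | rewrite -derive1E].
have intE : time_int T phi = P T - P 0.
  rewrite /P Rintegral_itvB ?bnd_simp//; [|by rewrite ler0N1 || lra..].
  rewrite Rintegral_itv_obnd_cbnd//.
  by apply: integrableS (iphi (-1) T) => //= x /=; rewrite !in_itv/=; lra.
have m0' : 0 < m%:R :> R by rewrite ltr0n.
set l := T / m%:R.
have l0 : 0 < l by rewrite divr_gt0.
rewrite intE; have -> : P T - P 0 = \sum_(j < m) (P (l * j.+1%:R) - P (l * j%:R)).
  have := @telescope_sumr R 0 m (fun j => P (l * j%:R)) (leq0n _).
  rewrite big_mkord => ->; rewrite mulr0 /l divfK//.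
  by rewrite gt_eqF.
rewrite -sumrB; apply: le_trans (ler_norm_sum _ _ _) _.
have -> : T * M * l ^+ 2 = \sum_(j < m) (l * M * l ^+ 2).
  have e : l * M * l ^+ 2 = m%:R^-1 * (T * M * l ^+ 2) by rewrite {1}/l; ring.
  by rewrite sumr_const card_ord -[_ *+ m]mulr_natl e mulVKf// gt_eqF.
apply: ler_sum => j _.
set c := T * midpoint R m j; set d := l / 2.
have d0 : 0 < d by rewrite divr_gt0.
have cE : c = l * j%:R + d by rewrite /c /d /midpoint /l; field; rewrite gt_eqF.
have -> : l * j.+1%:R = c + d by rewrite cE /d -addn1 natrD; field.
have -> : l * j%:R = c - d by rewrite cE addrK.
have cd0 : 0 <= c - d by rewrite cE addrK mulr_ge0// ltW.
have cdT : c + d <= T.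
  have -> : c + d = l * j.+1%:R by rewrite cE /d -addn1 natrD; field.
  apply: (@le_trans _ _ (l * m%:R)); first by rewrite ler_wpM2l ?(ltW l0)// ler_nat.
  by rewrite /l divfK// gt_eqF.
pose psi (v : R) : R := P (c + v) - P (c - v) - 2 * v * phi c.
have dpsi (v : R) : `|v| < d + 1 -> is_derive v 1 psi (phi (c + v) + phi (c - v) - 2 * phi c).
  rewrite ltr_norml => /andP[v1 v2].
  have h1 : is_derive v 1 (P \o (fun v => c + v)) (phi (c + v) * 1).
    apply: is_derive1_comp; first by apply: dP; lra.
    by apply: is_derive_eq (is_deriveD (is_derive_cst _ _ _) (is_derive_id _ _)) _; rewrite add0r.
  have h2 : is_derive v 1 (P \o (fun v => c - v)) (phi (c - v) * (-1)).
    apply: is_derive1_comp; first by apply: dP; lra.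
    by apply: is_derive_eq (is_deriveB (is_derive_cst _ _ _) (is_derive_id _ _)) _; rewrite sub0r.
  have h3 : is_derive v 1 (fun v => 2 * v * phi c) (2 * phi c).
    rewrite (_ : (fun v => _) = (fun v => v * (2 * phi c))); last by apply/funext => y; ring.
    exact: is_derive_mulr.
  apply: is_derive_eq (is_deriveB (is_deriveB h1 h2) h3) _; ring.
have psiE : psi d - psi 0 = P (c + d) - P (c - d) - l * phi c.
  have -> : l = 2 * d by rewrite /d; field.
  by rewrite /psi addr0 subr0; ring.
have M0 : 0 <= M.
  have := Sphi c d (ltW d0) cd0 cdT => /(le_trans (normr_ge0 _)).
  by rewrite pmulr_lge0// exprn_gt0.
rewrite -psiE; apply: le_trans (mvt_le (M := M * d ^+ 2) (ltW d0) _ _ _) _.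
- apply: derivable_within_continuous => v; rewrite in_itv/= => /andP[v0 vd].
  have /dpsi ? : `|v| < d + 1 by rewrite ger0_norm//; lra.
  exact: ex_derive.
- by move=> v /andP[v0 vd]; apply: dpsi; rewrite gtr0_norm//; lra.
- move=> v /andP[v0 vd]; apply: le_trans (Sphi c v _ _ _) _; [lra..|].
  by rewrite ler_wpM2l// ler_pXn2r ?nnegrE ?ltW.
rewrite subr0 [leLHS]mulrC -[leRHS]mulrA.
have dl : d <= l by rewrite /d; lra.
apply: ler_pM; rewrite ?mulr_ge0 ?exprn_ge0 ?(ltW d0) ?(ltW T0)//.
by rewrite ler_wpM2l// ler_pXn2r// ?nnegrE ?(ltW d0) ?(ltW l0).
Qed.

(** The nearest point of [0, T]: composing with it extends a function from [0, T]
to the line with the same Lipschitz constant. *)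
Definition clamp T x : R := Num.max 0 (Num.min x T).

Lemma clamp_id T x : 0 <= x <= T -> clamp T x = x.
Proof. by case/andP=> x0 xT; rewrite /clamp min_l// max_r. Qed.

Lemma clamp_itv T x : 0 <= T -> 0 <= clamp T x <= T.
Proof.
move=> T0; rewrite /clamp; have [?|?] := leP x T.
  by have [?|?] := leP 0 x; apply/andP; split; lra.
by have [?|?] := leP 0 T; apply/andP; split; lra.
Qed.

Lemma clamp_lip T x y : 0 <= T -> `|clamp T x - clamp T y| <= `|x - y|.
Proof.
move=> T0; rewrite /clamp; set a := Num.min x T; set b := Num.min y T.
apply: (@le_trans _ _ `|a - b|); rewrite ler_norml.
  have := ler_norm (a - b); have := ler_norm (b - a); rewrite [`|b - a|]distrC => h1 h2.
  by have [?|?] := leP 0 a; have [?|?] := leP 0 b; apply/andP; split; lra.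
have := ler_norm (x - y); have := ler_norm (y - x); rewrite [`|y - x|]distrC => h1 h2.
by rewrite /a /b; have [?|?] := leP x T; have [?|?] := leP y T; apply/andP; split; lra.
Qed.

Lemma clamp_lipschitz T L phi : 0 <= T -> 0 <= L ->
  (forall x y, 0 <= x <= T -> 0 <= y <= T ->
     `|phi x - phi y| <= L * `|x - y|) ->
  forall x y, `|phi (clamp T x) - phi (clamp T y)| <= L * `|x - y|.
Proof.
move=> T0 L0 Lphi x y; apply: le_trans (Lphi _ _ (clamp_itv _ T0) (clamp_itv _ T0)) _.
by rewrite ler_wpM2l// clamp_lip.
Qed.

Lemma time_int_clamp T phi : time_int T (phi \o clamp T) = time_int T phi.
Proof.
apply: eq_Rintegral => t; rewrite inE/= in_itv/= => tT.
by rewrite clamp_id.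
Qed.

(** Lipschitz bounds serve as integrability hypotheses for [time_int]. *)
Definition lip_on T L phi :=
  forall x y, 0 <= x <= T -> 0 <= y <= T -> `|phi x - phi y| <= L * `|x - y|.

Lemma time_intB_le T L L' phi psi e : 0 <= T -> 0 <= L -> 0 <= L' ->
  lip_on T L phi -> lip_on T L' psi ->
  (forall t, 0 <= t <= T -> `|phi t - psi t| <= e) ->
  `|time_int T phi - time_int T psi| <= e * T.
Proof.
move=> T0 L0 L'0 Lphi Lpsi e_le.
rewrite -(time_int_clamp T phi) -(time_int_clamp T psi).
have i1 := lipschitz_integrable 0 T (clamp_lipschitz T0 L0 Lphi).
have i2 := lipschitz_integrable 0 T (clamp_lipschitz T0 L'0 Lpsi).
rewrite /time_int -RintegralB//.
have e0 : 0 <= e by apply: le_trans (e_le 0 _) => //; rewrite lexx.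
apply: le_trans (le_normr_Rintegral _ _) _ => //.
  by have := integrableB _ i1 i2; apply.
have -> : e * T = \int[@lebesgue_measure R]_(t in `[0, T]) e.
  by rewrite Rintegral_cst//= lebesgue_measure_itv/= lte_fin; case: ltgtP T0 => //= [?|<-] _; rewrite ?oppr0 ?addr0// subr0.
apply: le_Rintegral => //.
- by have := integrableB _ i1 i2 => /(_ (measurable_itv _)) /integrable_norm.
- by apply: (@lipschitz_integrable 0 (fun=> e)) => x y; rewrite subrr normr0 mul0r.
- by move=> t /=; rewrite in_itv/= => tT; apply: e_le; rewrite clamp_itv.
Qed.

Lemma time_int_sum T (I : Type) (r : seq I) (P : pred I) (L : I -> R)
    (phi : I -> R -> R) : 0 <= T -> (forall i, 0 <= L i) ->
  (forall i, lip_on T (L i) (phi i)) ->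
  time_int T (fun t => \sum_(i <- r | P i) phi i t)
  = \sum_(i <- r | P i) time_int T (phi i).
Proof.
move=> T0 L0 Lphi.
have ip i := lipschitz_integrable 0 T (clamp_lipschitz T0 (L0 i) (Lphi i)).
under eq_bigr => i _ do rewrite -(time_int_clamp T (phi i)).
rewrite -time_int_clamp.
pose phi' i t := if P i then phi i (clamp T t) else 0.
have ip' i : (@lebesgue_measure R).-integrable `[0, T] (EFin \o phi' i).
  rewrite /phi'; case: (P i); first exact: ip.
  by apply: (@lipschitz_integrable 0) => x y; rewrite subrr normr0 mul0r.
have isum s : (@lebesgue_measure R).-integrable `[0, T]
    (EFin \o (fun t => \sum_(i <- s) phi' i t)).
  elim: s => [|i s IH].
    rewrite (_ : (fun t => _) = fun=> 0); last by apply/funext => t; rewrite big_nil.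
    by apply: (@lipschitz_integrable 0) => x y; rewrite subrr normr0 mul0r.
  rewrite (_ : _ \o _ = ((EFin \o phi' i) \+ (EFin \o (fun t => \sum_(i <- s) phi' i t)%R))%E); last first.
    by apply/funext => t; rewrite /= big_cons EFinD.
  by apply: integrableD.
transitivity (time_int T (fun t => \sum_(i <- r) phi' i t)).
  by congr time_int; apply/funext => t /=; rewrite big_mkcond.
rewrite [RHS]big_mkcond /=; elim: r => [|i r IH].
  rewrite big_nil (_ : (fun t => _) = fun=> 0); last by apply/funext => t; rewrite big_nil.
  by rewrite /time_int Rintegral_cst//= mul0r.
rewrite big_cons -IH (_ : (fun t => _) = fun t => phi' i t + \sum_(i <- r) phi' i t); last first.
  by apply/funext => t; rewrite big_cons.
rewrite /time_int RintegralD//; congr (_ + _).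
rewrite /phi'; case: (P i) => //; by rewrite Rintegral_cst//= mul0r.
Qed.

(** Clamping makes the integrand Lipschitz on the whole line, so that its
primitive is differentiable at the endpoints; clamping changes neither the
integral nor the values at the sample points. *)
Lemma midpoint_rule T M L phi m : 0 < T -> 0 <= L -> (0 < m)%N ->
  lip_on T L phi ->
  (forall c u, 0 <= u -> 0 <= c - u -> c + u <= T ->
     `|phi (c + u) + phi (c - u) - 2 * phi c| <= M * u ^+ 2) ->
  `|time_int T phi - \sum_(t <- time_midpoints T m) T / m%:R * phi t|
    <= T * M * (T / m%:R) ^+ 2.
Proof.
move=> T0 L0 m0 Lphi Sphi.
have := @midpoint_rule_lip T M L (phi \o clamp T) m T0 m0
  (clamp_lipschitz (ltW T0) L0 Lphi).
rewrite time_int_clamp /time_midpoints big_map -[m in iota _ m]subn0 -/(index_iota 0 m) big_mkord.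
rewrite (eq_bigr (fun j : 'I_m => T / m%:R * phi (T * midpoint R m j))).
  apply => c u u0 cu0 cuT /=.
  by rewrite !clamp_id ?Sphi//; apply/andP; split; lra.
move=> j _ /=; rewrite clamp_id//; apply/andP; split.
  by rewrite mulr_ge0 ?divr_ge0 ?addr_ge0 ?invr_ge0 ?(ltW T0).
rewrite -[leRHS]mulr1 ler_wpM2l ?(ltW T0)// ler_pdivrMr ?ltr0n// mul1r.
have : j.+1%:R <= m%:R :> R by rewrite ler_nat.
by rewrite -addn1 natrD; lra.
Qed.

End OneVariable.

(** * Bounded second differences and midpoint rules on cubes *)

Section Cube.
Variable R : realType.

(** Bounds in C^{1,1}, stated along the axes because midpoint rules are applied
to one coordinate at a time, and by differences because these bounds, unlike
derivatives, pass to pointwise limits. *)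
Definition csp n (A : R) (f : 'rV[R]_n -> R) : Prop :=
  [/\ forall x, `|f x| <= A,
      forall x i u, `|f (x + u *: delta_mx 0 i) - f x| <= A * `|u|
    & forall x i u, `|f (x + u *: delta_mx 0 i) + f (x - u *: delta_mx 0 i)
                      - 2 * f x| <= A * u ^+ 2].

(** The space-time version of [csp], with time confined to [0, T], where the source
is given. *)
Definition c11 n (T A : R) (F : R -> 'rV[R]_n -> R) : Prop :=
  [/\ forall t, 0 <= t <= T -> csp A (F t),
      forall x, lip_on T A (F^~ x)
    & forall x c u, 0 <= u -> 0 <= c - u -> c + u <= T ->
        `|F (c + u) x + F (c - u) x - 2 * F c x| <= A * u ^+ 2].

Lemma csp_ge0 n A (f : 'rV[R]_n -> R) : csp A f -> 0 <= A.
Proof. by case=> /(_ 0) + _ _; apply: le_trans. Qed.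

Lemma csp_le n A B (f : 'rV[R]_n -> R) : A <= B -> csp A f -> csp B f.
Proof.
move=> AB [h1 h2 h3]; split=> [x|x i u|x i u].
- exact: le_trans AB.
- by apply: le_trans (h2 x i u) _; rewrite ler_wpM2r.
- by apply: le_trans (h3 x i u) _; rewrite ler_wpM2r// sqr_ge0.
Qed.

Lemma c11_ge0 n T A (F : R -> 'rV[R]_n -> R) : 0 <= T -> c11 T A F -> 0 <= A.
Proof. by move=> T0 [/(_ 0) + _ _]; rewrite lexx T0 => /(_ isT) /csp_ge0. Qed.

Lemma c11_le n T A B (F : R -> 'rV[R]_n -> R) : A <= B -> c11 T A F -> c11 T B F.
Proof.
move=> AB [h1 h2 h3]; split=> [t tT|x s t sT tT|x c u u0 c0 cT].
- exact: csp_le (h1 t tT).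
- by apply: le_trans (h2 x s t sT tT) _; rewrite ler_wpM2r.
- by apply: le_trans (h3 x c u u0 c0 cT) _; rewrite ler_wpM2r// sqr_ge0.
Qed.

Lemma cspD n A B (f g : 'rV[R]_n -> R) : csp A f -> csp B g ->
  csp (A + B) (fun x => f x + g x).
Proof.
move=> [f1 f2 f3] [g1 g2 g3]; split=> [x|x i u|x i u].
- by apply: le_trans (ler_normD _ _) _; rewrite lerD.
- rewrite [leRHS]mulrDl (_ : _ - _ = (f (x + u *: delta_mx 0 i) - f x) +
    (g (x + u *: delta_mx 0 i) - g x)); last by ring.
  by apply: le_trans (ler_normD _ _) _; rewrite lerD.
- rewrite [leRHS]mulrDl (_ : f (x + u *: delta_mx 0 i) + g (x + u *: delta_mx 0 i) + _ - _ =
   (f (x + u *: delta_mx 0 i) + f (x - u *: delta_mx 0 i) - 2 * f x) +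
   (g (x + u *: delta_mx 0 i) + g (x - u *: delta_mx 0 i) - 2 * g x)); last by ring.
  by apply: le_trans (ler_normD _ _) _; apply: lerD.
Qed.

Lemma c11D n T A B (F G : R -> 'rV[R]_n -> R) : c11 T A F -> c11 T B G ->
  c11 T (A + B) (fun t x => F t x + G t x).
Proof.
move=> [f1 f2 f3] [g1 g2 g3]; split=> [t tT|x s t sT tT|x c u u0 c0 cT].
- by apply: cspD; [exact: f1 | exact: g1].
- rewrite [leRHS]mulrDl (_ : _ - _ = (F s x - F t x) + (G s x - G t x)); last by ring.
  by apply: le_trans (ler_normD _ _) _; rewrite lerD// ?f2// g2.
- rewrite [leRHS]mulrDl (_ : _ - _ = (F (c + u) x + F (c - u) x - 2 * F c x) +
   (G (c + u) x + G (c - u) x - 2 * G c x)); last by ring.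
  by apply: le_trans (ler_normD _ _) _; rewrite lerD// ?f3// g3.
Qed.

Lemma cspN n A (f : 'rV[R]_n -> R) : csp A f -> csp A (fun x => - f x).
Proof.
move=> [f1 f2 f3]; split=> [x|x i u|x i u]; first by rewrite normrN.
- by rewrite -opprD normrN.
- by rewrite -opprD mulrN -opprD normrN.
Qed.

Lemma c11N n T A (F : R -> 'rV[R]_n -> R) : c11 T A F ->
  c11 T A (fun t x => - F t x).
Proof.
move=> [f1 f2 f3]; split=> [t tT|x s t sT tT|x c u u0 c0 cT].
- by apply: cspN; exact: f1.
- by rewrite -opprD normrN f2.
- by rewrite -opprD mulrN -opprD normrN f3.
Qed.

Lemma c11B n T A B (F G : R -> 'rV[R]_n -> R) : c11 T A F -> c11 T B G ->
  c11 T (A + B) (fun t x => F t x - G t x).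
Proof. by move=> FA /c11N GB; apply: c11D. Qed.

Lemma csp0 n : csp 0 (fun _ : 'rV[R]_n => 0).
Proof.
by split=> [x|x i u|x i u]; rewrite ?(subrr, addr0, mulr0, normr0) ?mul0r.
Qed.

Lemma c11_cst n T A (f : 'rV[R]_n -> R) : csp A f -> c11 T A (fun _ => f).
Proof.
move=> fA; have A0 := csp_ge0 fA; split=> // [x s t _ _|x c u u0 _ _].
  by rewrite subrr normr0 mulr_ge0.
by rewrite -mulr2n -[_ *+ 2]mulr_natl subrr normr0 mulr_ge0 ?sqr_ge0.
Qed.

Lemma c11_sum n T (I : Type) (r : seq I) (P : pred I) (A : I -> R)
    (F : I -> R -> 'rV[R]_n -> R) : (forall i, P i -> c11 T (A i) (F i)) ->
  c11 T (\sum_(i <- r | P i) A i) (fun t x => \sum_(i <- r | P i) F i t x).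
Proof.
move=> FA; elim: r => [|i r IH].
  rewrite big_nil; rewrite (_ : (fun _ => _) = fun _ _ => 0); first exact/c11_cst/csp0.
  by apply/funext => t; apply/funext => x; rewrite big_nil.
rewrite big_cons (_ : (fun _ => _) = fun t x => if P i then
   F i t x + \sum_(i <- r | P i) F i t x else \sum_(i <- r | P i) F i t x); last first.
  by apply/funext => t; apply/funext => x; rewrite big_cons.
by case Pi : (P i) => //; apply: c11D => //; exact: FA.
Qed.

Let sqr_lip (a b A B : R) : `|a| <= A -> `|b| <= A -> `|a - b| <= A * B ->
  `|a ^+ 2 - b ^+ 2| <= (4 * A ^+ 2) * B.
Proof.
move=> aA bA ab; rewrite subr_sqr normrM.
apply: (@le_trans _ _ ((A * B) * (A + A))).
  by apply: ler_pM => //; apply: le_trans (ler_normD _ _) _; rewrite lerD.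
have -> : A * B * (A + A) = 2 * (A * (A * B)) by ring.
have -> : 4 * A ^+ 2 * B = 4 * (A * (A * B)) by ring.
rewrite ler_wpM2r ?ler_nat// mulr_ge0//; first exact: le_trans aA.
exact: le_trans ab.
Qed.

Let sqr_sec (a b c A u : R) : `|c| <= A -> `|a - c| <= A * `|u| ->
  `|b - c| <= A * `|u| -> `|a + b - 2 * c| <= A * u ^+ 2 ->
  `|a ^+ 2 + b ^+ 2 - 2 * c ^+ 2| <= (4 * A ^+ 2) * u ^+ 2.
Proof.
move=> cA ac bc abc.
(* First differences enter quadratically, so they too have order u^2. *)
have -> : a ^+ 2 + b ^+ 2 - 2 * c ^+ 2 =
   (a - c) ^+ 2 + ((b - c) ^+ 2 + 2 * (c * (a + b - 2 * c))) by ring.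
have -> : (4 * A ^+ 2) * u ^+ 2 =
  (A * `|u|) ^+ 2 + ((A * `|u|) ^+ 2 + 2 * (A * (A * u ^+ 2))).
  by rewrite !exprMn real_normK ?num_real//; ring.
have A0 : 0 <= A by apply: le_trans cA.
apply: le_trans (ler_normD _ _) _; rewrite lerD//.
  by rewrite normrX ler_pXn2r ?nnegrE// mulr_ge0.
apply: le_trans (ler_normD _ _) _; rewrite lerD//.
  by rewrite normrX ler_pXn2r ?nnegrE// mulr_ge0.
by rewrite !normrM ger0_norm// ler_wpM2l// ler_pM.
Qed.

Lemma csp_sqr n A (f : 'rV[R]_n -> R) : csp A f -> csp (4 * A ^+ 2) (fun x => f x ^+ 2).
Proof.
move=> fA; have A0 := csp_ge0 fA; case: fA => [f1 f2 f3]; split=> [x|x i u|x i u].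
- rewrite normrX; apply: (@le_trans _ _ (A ^+ 2)); first by rewrite ler_pXn2r ?nnegrE.
  by rewrite ler_peMl ?sqr_ge0// ler1n.
- exact: sqr_lip.
- apply: sqr_sec => //; have := f2 x i (- u); by rewrite normrN scaleNr.
Qed.

Lemma c11_sqr n T A (F : R -> 'rV[R]_n -> R) : 0 <= T -> c11 T A F ->
  c11 T (4 * A ^+ 2) (fun t x => F t x ^+ 2).
Proof.
move=> T0 FA; have A0 := c11_ge0 T0 FA.
case: FA => [f1 f2 f3]; split=> [t tT|x s t sT tT|x c u u0 c0 cT].
- exact/csp_sqr/f1.
- have [fs _ _] := f1 s sT; have [ft _ _] := f1 t tT.
  by apply: sqr_lip => //; exact: f2.
- have cI : 0 <= c <= T by apply/andP; split; lra.
  have [fc _ _] := f1 c cI; apply: sqr_sec => //; last exact: f3.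
    have := f2 x (c + u) c; rewrite addrAC subrr add0r; apply => //; apply/andP; split; lra.
  have := f2 x (c - u) c; rewrite addrAC subrr add0r normrN; apply => //; apply/andP; split; lra.
Qed.

(** Covers restriction to a face and freezing a coordinate: these substitutions
send each axis to an axis or collapse it. *)
Lemma c11_comp n m T A (F : R -> 'rV[R]_n -> R) (h : 'rV[R]_m -> 'rV[R]_n) :
  0 <= T -> (forall i, (exists j, forall x u, h (x + u *: delta_mx 0 i) = h x + u *: delta_mx 0 j)
              \/ (forall x u, h (x + u *: delta_mx 0 i) = h x)) ->
  c11 T A F -> c11 T A (fun t x => F t (h x)).
Proof.
move=> T0 hh FA; have A0 := c11_ge0 T0 FA; case: FA => f1 f2 f3; split=> [t tT|x|x]; last 2 first.
- exact: f2.
- exact: f3.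
have [g1 g2 g3] := f1 t tT; split=> [x|x i u|x i u]; first exact: g1.
  by case: (hh i) => [[j ->]|->]; rewrite ?subrr ?normr0 ?mulr_ge0.
rewrite -scaleNr; case: (hh i) => [[j hj]|hj]; rewrite !hj.
  by rewrite scaleNr.
by rewrite -mulr2n -[_ *+ 2]mulr_natl subrr normr0 mulr_ge0 ?sqr_ge0.
Qed.

Lemma face_pointD n (a : 'I_n.+1) b (i : 'I_n) (x : 'rV[R]_n) u :
  face_point a b (x + u *: delta_mx 0 i) = face_point a b x + u *: delta_mx 0 (lift a i).
Proof.
apply/rowP => j; rewrite !mxE; case: unliftP => [k ->|->].
  by rewrite !mxE eqxx/= (inj_eq lift_inj).
by rewrite (negbTE (neq_lift _ _)) andbF mulr0 addr0.
Qed.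

Lemma set_coordD n (i j : 'I_n) c (x : 'rV[R]_n) u :
  set_coord (x + u *: delta_mx 0 j) i c =
  if j == i then set_coord x i c else set_coord x i c + u *: delta_mx 0 j.
Proof.
apply/rowP => k; case: (eqVneq j i) => [<-|ji]; rewrite !mxE eqxx /=.
  by case: (eqVneq k j) => // _; rewrite mulr0 addr0.
case: (eqVneq k i) => [->|//]; by rewrite (eq_sym i) (negbTE ji) mulr0 addr0.
Qed.

Lemma c11_set_coord n T A (F : R -> 'rV[R]_n -> R) i c : 0 <= T ->
  c11 T A F -> c11 T A (fun t x => F t (set_coord x i c)).
Proof.
move=> T0; apply: c11_comp => // j; case: (eqVneq j i) => ji.
  by right=> x u; rewrite set_coordD ji eqxx.
by left; exists j => x u; rewrite set_coordD (negbTE ji).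
Qed.

Lemma c11_face n T A (F : R -> 'rV[R]_n.+1 -> R) a b : 0 <= T ->
  c11 T A F -> c11 T A (fun t y => F t (face_point a b y)).
Proof.
move=> T0; apply: c11_comp => // j; left; exists (lift a j) => x u.
exact: face_pointD.
Qed.

Lemma row_mxDl n (a u : R) (y : 'rV[R]_n) :
  row_mx (a + u)%:M y = row_mx a%:M y + u *: (delta_mx 0 ord0 : 'rV[R]_n.+1).
Proof.
apply/rowP => j; rewrite !mxE; case: splitP => k jk.
  have -> : j = ord0 by apply: val_inj; rewrite /= jk ord1.
  by rewrite !mxE !ord1 !eqxx /= mulr1n mulr1.
have -> : (j == ord0) = false by apply/eqP => j0; move: jk; rewrite j0.
by rewrite andbF mulr0 addr0.
Qed.

Lemma row_mxDr n (a u : R) (y : 'rV[R]_n) i :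
  row_mx a%:M (y + u *: delta_mx 0 i) =
  row_mx a%:M y + u *: (delta_mx 0 (lift ord0 i) : 'rV[R]_n.+1).
Proof.
apply/rowP => j; rewrite !mxE; case: splitP => k jk.
  by rewrite !mxE -[j == _]val_eqE /= jk ord1 /= mulr0 addr0.
rewrite !mxE eqxx /= -[j == _]val_eqE /= jk /bump /= !add1n eqSS.
by rewrite -[k == i]val_eqE.
Qed.

(** Reading the first coordinate as a time is what drives the inductions on the
dimension. *)
Lemma csp_slice n A (f : 'rV[R]_n.+1 -> R) T : csp A f ->
  c11 T A (fun a (y : 'rV[R]_n) => f (row_mx a%:M y)).
Proof.
move=> [f1 f2 f3]; split=> [t _|x s t _ _|x c u _ _ _].
- split=> [x|x i u|x i u]; first exact: f1.
    by rewrite row_mxDr f2.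
  by rewrite -scaleNr !row_mxDr scaleNr f3.
- by have := f2 (row_mx t%:M x) ord0 (s - t); rewrite -row_mxDl [t + _]addrC subrK.
- by rewrite !row_mxDl scaleNr f3.
Qed.

Lemma cube_intB_le n A B e (f g : 'rV[R]_n -> R) : csp A f -> csp B g ->
  (forall x, `|f x - g x| <= e) -> `|cube_int f - cube_int g| <= e.
Proof.
elim: n A B e f g => [|n IH] A B e f g fA gB fg; first exact: fg.
have lip C (k : 'rV[R]_n.+1 -> R) : csp C k ->
    lip_on 1 C (fun a => cube_int (fun y : 'rV[R]_n => k (row_mx a%:M y))).
  move=> /(csp_slice 1)[k1 k2 k3] s t sT tT; apply: (IH C C); first exact: k1.
    exact: k1.
  by move=> y; apply: (k2 y).
have := time_intB_le ler01 (csp_ge0 fA) (csp_ge0 gB) (lip _ _ fA) (lip _ _ gB).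
rewrite -[leRHS]mulr1; apply => t tT.
have [f1 _ _] := csp_slice 1 fA; have [g1 _ _] := csp_slice 1 gB.
by apply: IH (f1 t tT) (g1 t tT) _ => y; exact: fg.
Qed.

Lemma cube_int_lip n T A (F : R -> 'rV[R]_n -> R) :
  c11 T A F -> lip_on T A (fun t => cube_int (F t)).
Proof.
move=> [f1 f2 f3] s t sT tT; apply: cube_intB_le (f1 s sT) (f1 t tT) _ => x.
exact: (f2 x).
Qed.

Lemma cube_int_sum n (I : Type) (r : seq I) (P : pred I) A
    (f : I -> 'rV[R]_n -> R) : (forall i, csp A (f i)) ->
  cube_int (fun x => \sum_(i <- r | P i) f i x)
  = \sum_(i <- r | P i) cube_int (f i).
Proof.
elim: n A f => [|n IH] A f fA //=.
rewrite -(@time_int_sum R 1 I r P (fun=> A)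
    (fun i a => cube_int (fun y : 'rV[R]_n => f i (row_mx a%:M y)))) //.
- apply: eq_Rintegral => t; rewrite inE/= in_itv/= => tT; apply: (IH A) => i.
  by have [+ _ _] := csp_slice 1 (fA i); apply.
- by move=> i; exact: csp_ge0 (fA i).
- by move=> i; exact/cube_int_lip/csp_slice.
Qed.

Lemma cube_int_ge0 n (f : 'rV[R]_n -> R) : (forall x, 0 <= f x) -> 0 <= cube_int f.
Proof.
elim: n f => [|n IH] f f0 //=; apply: Rintegral_ge0 => t _; apply: IH => y; exact: f0.
Qed.

Definition cube_avg n M (f : 'rV[R]_n -> R) : R :=
  \sum_(y <- cube_midpoints R n M) (M%:R ^+ n)^-1 * f y.

Lemma cube_avgE n M (f : 'rV[R]_n -> R) :
  cube_avg M f =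
  \sum_(q : {ffun 'I_n -> 'I_M}) (M%:R ^+ n)^-1 * f (\row_i midpoint R M (q i)).
Proof. by rewrite /cube_avg /cube_midpoints big_image. Qed.

Lemma cube_avgS n M (f : 'rV[R]_n.+1 -> R) :
  cube_avg M f =
  \sum_(a <- time_midpoints 1 M) 1 / M%:R * cube_avg M (fun y : 'rV[R]_n => f (row_mx a%:M y)).
Proof.
rewrite cube_avgE /time_midpoints big_map -[M in iota _ M]subn0 -/(index_iota 0 M) big_mkord.
under [RHS]eq_bigr => j _ do rewrite cube_avgE mulr_sumr.
rewrite pair_bigA /=.
pose h (p : 'I_M * {ffun 'I_n -> 'I_M}) : {ffun 'I_n.+1 -> 'I_M} :=
  [ffun i => if unlift ord0 i is Some k then p.2 k else p.1].
rewrite (reindex h) /=; last first.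
  exists (fun q => (q ord0, [ffun k => q (lift ord0 k)])).
    move=> [j q] _; rewrite /h !ffunE unlift_none /=; congr pair.
    by apply/ffunP => k; rewrite !ffunE liftK.
  move=> q _; apply/ffunP => k; rewrite !ffunE.
  by case: unliftP => [l ->|->]; rewrite ?ffunE.
apply: eq_bigr => -[j q] _ /=; rewrite exprS invfM mul1r mulrA; congr (_ * f _).
apply/rowP => k; rewrite !mxE ffunE; case: splitP => l kl.
  have -> : k = ord0 by apply: val_inj; rewrite /= kl ord1.
  by rewrite unlift_none mxE ord1 eqxx mulr1n mul1r.
have -> : k = lift ord0 l by apply: val_inj; rewrite /= kl.
by rewrite liftK mxE.
Qed.

Lemma size_cube_midpoints n M : size (cube_midpoints R n M) = (M ^ n)%N.
Proof. by rewrite size_map -cardE card_ffun !card_ord. Qed.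

Lemma cube_avg_cst n M (c : R) : (0 < M)%N -> cube_avg M (fun _ : 'rV[R]_n => c) = c.
Proof.
move=> M0; rewrite /cube_avg big_const_seq count_predT size_cube_midpoints iter_addr_0.
by rewrite -[_ *+ (M ^ n)%N]mulr_natl natrX mulrA mulfV ?mul1r// expf_neq0// pnatr_eq0 -lt0n.
Qed.

Lemma cube_avg_le n M (f : 'rV[R]_n -> R) A : (0 < M)%N ->
  (forall x, `|f x| <= A) -> `|cube_avg M f| <= A.
Proof.
move=> M0 fA; apply: le_trans (ler_norm_sum _ _ _) _.
rewrite -[leRHS](@cube_avg_cst n M A M0) /cube_avg; apply: ler_sum => y _.
by rewrite normrM ger0_norm ?ler_wpM2l// ?invr_ge0 ?exprn_ge0.
Qed.

Lemma cube_avgB n M (f g : 'rV[R]_n -> R) :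
  cube_avg M f - cube_avg M g = cube_avg M (fun x => f x - g x).
Proof. by rewrite /cube_avg -sumrB; apply: eq_bigr => y _; rewrite mulrBr. Qed.

(** The error made in the space variables is integrated over [0, T]; the averages
over the space grid inherit the difference bounds in time, so the one-variable
rule applies to them. *)
Lemma midpoint_step n T A e m M (F : R -> 'rV[R]_n -> R) : 0 < T ->
  (0 < m)%N -> (0 < M)%N -> c11 T A F ->
  (forall t, 0 <= t <= T -> `|cube_int (F t) - cube_avg M (F t)| <= e) ->
  `|time_int T (fun t => cube_int (F t))
    - \sum_(t <- time_midpoints T m) T / m%:R * cube_avg M (F t)|
  <= T * e + T * A * (T / m%:R) ^+ 2.
Proof.
move=> T0 m0 M0 FA Fe; have A0 := c11_ge0 (ltW T0) FA.
have [f1 f2 f3] := FA.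
have avg_lip : lip_on T A (fun t => cube_avg M (F t)).
  by move=> s t sT tT; rewrite cube_avgB; apply: cube_avg_le => // x; exact: (f2 x).
have avg_sec c u : 0 <= u -> 0 <= c - u -> c + u <= T ->
  `|cube_avg M (F (c + u)) + cube_avg M (F (c - u)) - 2 * cube_avg M (F c)| <= A * u ^+ 2.
  move=> u0 c0 cT.
  have -> : cube_avg M (F (c + u)) + cube_avg M (F (c - u)) - 2 * cube_avg M (F c) =
    cube_avg M (fun x => F (c + u) x + F (c - u) x - 2 * F c x).
    rewrite /cube_avg -big_split mulr_sumr -sumrB /=; apply: eq_bigr => y _; ring.
  by apply: cube_avg_le => // x; exact: f3.
have h1 := time_intB_le (ltW T0) A0 A0 (cube_int_lip FA) avg_lip Fe.
have h2 := midpoint_rule T0 A0 m0 avg_lip avg_sec.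
rewrite -(subrKA (time_int T (fun t => cube_avg M (F t)))).
by apply: le_trans (ler_normD _ _) _; rewrite lerD// mulrC.
Qed.

Lemma cube_midpoint_le n A M (f : 'rV[R]_n -> R) : (0 < M)%N -> csp A f ->
  `|cube_int f - cube_avg M f| <= n%:R * A / M%:R ^+ 2.
Proof.
move=> M0; elim: n f => [|n IH] f fA.
  rewrite !mul0r (_ : f = fun=> f 0) ?cube_avg_cst//= ?subrr ?normr0//.
  by apply/funext => x; rewrite [x]thinmx0.
have step := @midpoint_step n 1 A (n%:R * A / M%:R ^+ 2) M M
  (fun a (y : 'rV[R]_n) => f (row_mx a%:M y)) ltr01 M0 M0 (csp_slice 1 fA).
rewrite cube_avgS; apply: le_trans (step _) _.
  by move=> t tT; apply: IH; have [+ _ _] := csp_slice 1 fA; apply.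
by rewrite !mul1r exprVn -[n.+1]addn1 natrD 2!mulrDl mul1r.
Qed.

Lemma space_time_midpoint_le n T A m M (F : R -> 'rV[R]_n -> R) : 0 < T ->
  (0 < m)%N -> (0 < M)%N -> c11 T A F ->
  `|time_int T (fun t => cube_int (F t))
    - \sum_(t <- time_midpoints T m) T / m%:R * cube_avg M (F t)|
  <= T * A * (n%:R * M%:R^-1 ^+ 2 + (T / m%:R) ^+ 2).
Proof.
move=> T0 m0 M0 FA; have [f1 f2 f3] := FA.
have := midpoint_step T0 m0 M0 FA (fun t tT => cube_midpoint_le M0 (f1 t tT)).
suff -> : T * A * (n%:R * M%:R^-1 ^+ 2 + (T / m%:R) ^+ 2) =
  T * (n%:R * A / M%:R ^+ 2) + T * A * (T / m%:R) ^+ 2 by [].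
by rewrite exprVn; ring.
Qed.

End Cube.

(** * Geometric growth of partial derivatives *)

Section Smooth.
Variables (R : realType) (n : nat).
Implicit Types (u v : R -> 'rV[R]_n.+1 -> R) (o : option 'I_n.+1) (a b lam : R).

(** The restriction of u to the line through (t, x) in the direction o, where
[None] stands for time and [Some i] for the i-th space coordinate. *)
Definition line o u (t : R) (x : 'rV[R]_n.+1) : R -> R := fun r =>
  if o is Some i then u t (x + r *: delta_mx 0 i) else u (t + r) x.

Definition is_pd o u v : Prop :=
  forall t x, is_derive (0 : R) 1 (line o u t x) (v t x).

(** All mixed derivatives of u of order j <= k exist and are at most a lam^j.  The
geometric form makes the class stable under products and composition with
constants that do not depend on lam. *)
Fixpoint Cw (k : nat) a lam u : Prop :=
  (forall t x, `|u t x| <= a) /\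
  if k is k'.+1 then forall o, exists2 v, is_pd o u v & Cw k' (a * lam) lam v
  else True.

Definition pd o u : R -> 'rV[R]_n.+1 -> R :=
  if o is Some i then fun t => partial i (u t) else dt u.

Lemma is_derive_along (V : normedModType R) (f : V -> R) (x w : V) (d : R) :
  is_derive (0 : R) 1 (fun r : R => f (x + r *: w)) d -> is_derive x w f d.
Proof.
move=> [df <-].
have E : (fun h : R => h^-1 *: ((f \o shift x) (h *: w) - f x)) =
  (fun h : R => h^-1 *: (((fun r : R => f (x + r *: w)) \o shift 0) (h *: 1)
              - f (x + 0 *: w))).
  apply/funext => h /=; rewrite scale0r !addr0 [_ *: w + x]addrC.
  by rewrite [h *: 1](mulr1 h).
by apply: DeriveDef; [move: df; rewrite /derivable -E | rewrite /derive E].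
Qed.

Lemma is_pd_pd o u v : is_pd o u v -> pd o u = v.
Proof.
move=> duv; apply/funext => t; apply/funext => x; case: o duv => [i|] duv /=.
  by have /is_derive_along[_ <-] := duv t x.
rewrite /dt derive1E.
have : is_derive (0 : R) 1 (fun r : R => (u^~ x) (t + r *: 1)) (v t x).
  have := duv t x; rewrite /line; congr (is_derive _ _ _ _).
  by apply/funext => r; rewrite [r *: 1](mulr1 r).
by move=> H; have [_ <-] := @is_derive_along R^o (u^~ x) t 1 _ H.
Qed.

Lemma is_pd_line o u v t x (r : R) : is_pd o u v ->
  is_derive r 1 (line o u t x) (line o v t x r).
Proof.
move=> duv.
have sh : is_derive r 1 (fun s : R => s - r) 1.
  by apply: is_derive_eq (is_deriveB (is_derive_id _ _) (is_derive_cst _ _ _)) _; rewrite subr0.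
case: o duv => [i|] duv.
  rewrite (_ : line _ u t x = line (Some i) u t (x + r *: delta_mx 0 i) \o (fun s => s - r)).
    rewrite -[line _ v t x r]mulr1; apply: is_derive1_comp; rewrite subrr; exact: duv.
  by apply/funext => s /=; rewrite -addrA -scalerDl [r + _]addrC subrK.
rewrite (_ : line _ u t x = line None u (t + r) x \o (fun s => s - r)).
  rewrite -[line _ v t x r]mulr1; apply: is_derive1_comp; rewrite subrr; exact: duv.
by apply/funext => s /=; congr u; ring.
Qed.

Lemma Cw_bound k a lam u : Cw k a lam u -> forall t x, `|u t x| <= a.
Proof. by case: k => [|k] []. Qed.

Lemma Cw_ge0 k a lam u : Cw k a lam u -> 0 <= a.
Proof. by move/Cw_bound => /(_ 0 0); apply: le_trans. Qed.

Lemma Cw_pd k a lam u o : Cw k.+1 a lam u -> Cw k (a * lam) lam (pd o u).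
Proof. by move=> [_ /(_ o)[v /is_pd_pd -> ]]. Qed.

Lemma Cw_is_pd k a lam u o : Cw k.+1 a lam u -> is_pd o u (pd o u).
Proof. by move=> [_ /(_ o)[v duv _]]; rewrite (is_pd_pd duv). Qed.

Lemma Cw_pred k a lam u : Cw k.+1 a lam u -> Cw k a lam u.
Proof.
elim: k a u => [|k IH] a u [u0 du]; split=> // o.
by have [v duv /IH vk] := du o; exists v.
Qed.

Lemma Cw_leq k m a lam u : (k <= m)%N -> Cw m a lam u -> Cw k a lam u.
Proof.
move=> /subnK <-; elim: (m - k)%N => // d IH /Cw_pred; exact: IH.
Qed.

Lemma Cw_le k a b lam mu u : a <= b -> 0 <= lam -> lam <= mu ->
  Cw k a lam u -> Cw k b mu u.
Proof.
elim: k a b u => [|k IH] a b u ab l0 lmu ua; have a0 := Cw_ge0 ua; case: ua => u0 du.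
  by split=> // t x; apply: le_trans ab.
split=> [t x|o]; first by apply: le_trans ab.
have [v duv vk] := du o; exists v => //.
by apply: IH vk => //; rewrite ler_pM.
Qed.

Lemma Cw_lea k a b lam u : a <= b -> 0 <= lam -> Cw k a lam u -> Cw k b lam u.
Proof. by move=> ab l0; apply: Cw_le. Qed.

Lemma is_pdD o u u' v v' : is_pd o u u' -> is_pd o v v' ->
  is_pd o (fun t x => u t x + v t x) (fun t x => u' t x + v' t x).
Proof.
move=> du dv t x; have := is_deriveD (du t x) (dv t x).
by congr (is_derive _ _ _ _); apply/funext => r; case: o {du dv}.
Qed.

Lemma is_pdZ o c u u' : is_pd o u u' ->
  is_pd o (fun t x => c * u t x) (fun t x => c * u' t x).
Proof.
move=> du t x; have := is_deriveZ c (du t x).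
by congr (is_derive _ _ _ _); apply/funext => r; case: o {du}.
Qed.

Lemma is_pdM o u u' v v' : is_pd o u u' -> is_pd o v v' ->
  is_pd o (fun t x => u t x * v t x) (fun t x => u' t x * v t x + u t x * v' t x).
Proof.
move=> du dv t x; have := is_deriveM (du t x) (dv t x).
have E w : line o w t x 0 = w t x.
  by case: o {du dv} => [i|] /=; rewrite ?scale0r addr0.
rewrite !E [v t x *: _](mulrC (v t x)) addrC.
by congr (is_derive _ _ _ _); apply/funext => r; case: o {du dv E}.
Qed.

Lemma is_pd_cst o (c : R) : is_pd o (fun _ _ => c) (fun _ _ => 0).
Proof.
move=> t x; rewrite (_ : line o _ t x = cst c); first exact: is_derive_cst.
by apply/funext => r; case: o.
Qed.

Lemma is_pd_comp o (g g' : R -> R) u u' : (forall x : R, is_derive x 1 g (g' x)) ->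
  is_pd o u u' -> is_pd o (fun t x => g (u t x)) (fun t x => g' (u t x) * u' t x).
Proof.
move=> dg du t x.
have E : line o u t x 0 = u t x by case: o {du} => [i|] /=; rewrite ?scale0r addr0.
have := is_derive1_comp (dg (line o u t x 0)) (du t x); rewrite E.
by congr (is_derive _ _ _ _); apply/funext => r; case: o {du E}.
Qed.

Lemma CwD k a b lam u v : Cw k a lam u -> Cw k b lam v ->
  Cw k (a + b) lam (fun t x => u t x + v t x).
Proof.
elim: k a b u v => [|k IH] a b u v [u0 du] [v0 dv].
  by split=> // t x; apply: le_trans (ler_normD _ _) _; rewrite lerD.
split=> [t x|o]; first by apply: le_trans (ler_normD _ _) _; rewrite lerD.
have [u' du' uk] := du o; have [v' dv' vk] := dv o.
by exists (fun t x => u' t x + v' t x); [exact: is_pdD | rewrite mulrDl; exact: IH].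
Qed.

Lemma CwZ k a lam c u : Cw k a lam u -> Cw k (`|c| * a) lam (fun t x => c * u t x).
Proof.
elim: k a u => [|k IH] a u [u0 du].
  by split=> // t x; rewrite normrM ler_wpM2l.
split=> [t x|o]; first by rewrite normrM ler_wpM2l.
have [u' du' uk] := du o.
by exists (fun t x => c * u' t x); [exact: is_pdZ | rewrite -mulrA; exact: IH].
Qed.

Lemma Cw_cst k a lam c : 0 <= lam -> `|c| <= a -> Cw k a lam (fun _ _ => c).
Proof.
move=> l0; elim: k a c => [|k IH] a c ca; split=> // o.
exists (fun _ _ => 0); first exact: is_pd_cst.
by apply: IH; rewrite normr0 mulr_ge0// (le_trans _ ca).
Qed.

Lemma CwB k a b lam u v : Cw k a lam u -> Cw k b lam v ->
  Cw k (a + b) lam (fun t x => u t x - v t x).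
Proof.
move=> ua vb.
rewrite (_ : (fun _ _ => _) = fun t x => u t x + (-1) * v t x); last first.
  by apply/funext => t; apply/funext => x; rewrite mulN1r.
by apply: CwD => //; have := CwZ (-1) vb; rewrite normrN normr1 mul1r.
Qed.

(** Leibniz's rule: each of the k derivatives falls on one of the two factors. *)
Lemma CwM k a b lam u v : 0 <= lam -> Cw k a lam u -> Cw k b lam v ->
  Cw k (2 ^+ k * (a * b)) lam (fun t x => u t x * v t x).
Proof.
move=> l0; elim: k a b u v => [|k IH] a b u v ua vb.
  case: ua vb => [u0 _] [v0 _].
  by split=> // t x; rewrite expr0 mul1r normrM ler_pM.
have a0 := Cw_ge0 ua; have b0 := Cw_ge0 vb.
split=> [t x|o].
  apply: (@le_trans _ _ (a * b)); first by rewrite normrM ler_pM// (Cw_bound ua, Cw_bound vb).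
  by rewrite ler_peMl ?mulr_ge0// exprn_ege1// ler1n.
exists (fun t x => pd o u t x * v t x + u t x * pd o v t x).
  by apply: is_pdM; apply: Cw_is_pd; [exact: ua | exact: vb].
have := CwD (IH _ _ _ _ (Cw_pd o ua) (Cw_pred vb)) (IH _ _ _ _ (Cw_pred ua) (Cw_pd o vb)).
by congr (Cw _ _ _ _); rewrite exprS; ring.
Qed.

Lemma Cw_sum k lam (I : Type) (r : seq I) (a : I -> R)
    (u : I -> R -> 'rV[R]_n.+1 -> R) : 0 <= lam -> (forall i, Cw k (a i) lam (u i)) ->
  Cw k (\sum_(i <- r) a i) lam (fun t x => \sum_(i <- r) u i t x).
Proof.
move=> l0 ua; elim: r => [|i r IH].
  rewrite big_nil (_ : (fun _ _ => _) = fun _ _ => 0).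
    by apply: Cw_cst => //; rewrite normr0.
  by apply/funext => t; apply/funext => x; rewrite big_nil.
rewrite big_cons (_ : (fun _ _ => _) = fun t x => u i t x + \sum_(i <- r) u i t x).
  exact: CwD.
by apply/funext => t; apply/funext => x; rewrite big_cons.
Qed.

(** The mean value inequality on each coordinate line. *)
Lemma Cw_c11 T a lam u : 0 <= T -> 1 <= lam -> Cw 2 a lam u ->
  c11 T (2 * (a * lam ^+ 2)) u.
Proof.
move=> T0 l1 ua; have a0 := Cw_ge0 ua.
have l0 : 0 <= lam by apply: le_trans l1.
have bnd o t x : `|pd o u t x| <= a * lam by exact: Cw_bound (Cw_pd o ua) t x.
have bnd2 o t x : `|pd o (pd o u) t x| <= a * lam ^+ 2.
  by have := Cw_bound (Cw_pd o (Cw_pd o ua)) t x; rewrite -mulrA -expr2.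
have bl o t x r : `|line o (pd o u) t x r| <= a * lam by case: o => [i|]; exact: bnd.
have bl2 o t x r : `|line o (pd o (pd o u)) t x r| <= a * lam ^+ 2.
  by case: o => [i|]; exact: bnd2.
have d1 o t x r := is_pd_line t x r (Cw_is_pd o ua).
have d2 o t x r := is_pd_line t x r (Cw_is_pd o (Cw_pd o ua)).
have ll2 : a * lam <= 2 * (a * lam ^+ 2).
  have : a * lam <= a * lam ^+ 2 by rewrite ler_wpM2l// expr2 ler_peMl.
  have : 0 <= a * lam by rewrite mulr_ge0.
  lra.
have al2 : a <= 2 * (a * lam ^+ 2).
  by apply: le_trans ll2; rewrite ler_peMr.
have cts (f f' : R -> R) (p q : R) : (forall x : R, is_derive x 1 f (f' x)) ->
    {within `[p, q], continuous f}.
  by move=> df; apply: derivable_within_continuous => r _; apply: ex_derive.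
have lip (f f' : R -> R) M : (forall r : R, is_derive r 1 f (f' r)) ->
    (forall r, `|f' r| <= M) -> forall p q, `|f p - f q| <= M * `|p - q|.
  move=> df f'M p q; have [pq|qp] := leP p q.
    rewrite distrC [`|p - q|]distrC (ger0_norm (x := q - p)) ?subr_ge0//.
    by apply: mvt_le (cts _ _ _ _ df) (fun r _ => df r) (fun r _ => f'M r).
  rewrite (gtr0_norm (x := p - q)) ?subr_gt0//.
  by apply: mvt_le (ltW qp) (cts _ _ _ _ df) (fun r _ => df r) (fun r _ => f'M r).
have L1 o t x r : `|line o u t x r - line o u t x 0| <= 2 * (a * lam ^+ 2) * `|r|.
  apply: le_trans (lip _ _ _ (d1 o t x) (bl o t x) r 0) _.
  by rewrite subr0 ler_wpM2r.
have L2 o t x r : `|line o u t x r + line o u t x (- r) - 2 * line o u t x 0|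
    <= 2 * (a * lam ^+ 2) * r ^+ 2.
  wlog r0 : r / 0 <= r.
    move=> h; have [|r0] := leP 0 r; first exact: h.
    by have := h (- r); rewrite opprK sqrrN [line o u t x (- r) + _]addrC; apply; rewrite oppr_ge0 ltW.
  have := @second_diff_le R (line o u t x) _ 0 r (a * lam ^+ 2) r0 (cts _ _ _ _ (d1 o t x))
    (fun r _ => d1 o t x r) (fun p q _ _ => lip _ _ _ (d2 o t x) (bl2 o t x) p q).
  by rewrite add0r sub0r.
split=> [t _|x s t _ _|x c r r0 _ _].
- split=> [x|x i r|x i r]; first exact: le_trans (Cw_bound ua t x) al2.
    by have := L1 (Some i) t x r; rewrite /= scale0r addr0.
  by have := L2 (Some i) t x r; rewrite /= scale0r addr0 scaleNr.
- by have := L1 None t x (s - t); rewrite /= addr0 [t + _]addrC subrK.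
- by have := L2 None c x r; rewrite /= addr0.
Qed.

End Smooth.

(** * Iterated partial derivatives *)

Section IteratedPartials.
Variables (R : realType) (n : nat).
Implicit Types f g : 'rV[R]_n.+1 -> R.

(** A word of directions instead of a multi-index, so that inductions can remove
the innermost derivative. *)
Definition dpart (l : seq 'I_n.+1) f : 'rV[R]_n.+1 -> R :=
  foldr (fun i g => partial i g) f l.

Lemma Dmulti_dpart s (a : multiindex n.+1 s) :
  exists2 l, size l = mi_order a & forall f, Dmulti a f = dpart l f.
Proof.
exists (flatten [seq nseq (a i) i | i <- enum 'I_n.+1]).
  rewrite size_flatten /shape -map_comp sumnE big_map big_enum /=.
  by apply: eq_bigr => i _; rewrite size_nseq.
move=> f; rewrite /Dmulti /dpart; elim: (enum 'I_n.+1) => //= i e ->.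
rewrite foldr_cat; elim: (nat_of_ord (a i)) => //= m <-.
by [].
Qed.

(** What makes iterated partial derivatives up to order k additive. *)
Fixpoint ndiff k f : Prop :=
  if k is k'.+1 then
    forall i, (forall x, derivable f x (delta_mx 0 i)) /\ ndiff k' (partial i f)
  else True.

Lemma ndiff_leq k m f : (k <= m)%N -> ndiff m f -> ndiff k f.
Proof.
elim: m k f => [|m IH] [|k] f //= km df i.
by have [d1 d2] := df i; split=> //; exact: IH km d2.
Qed.

Lemma dpart_rcons l i f : dpart (rcons l i) f = dpart l (partial i f).
Proof. by rewrite /dpart -cats1 foldr_cat. Qed.

Lemma dpartB l f g : ndiff (size l) f -> ndiff (size l) g ->
  dpart l (fun x => f x - g x) = fun x => dpart l f x - dpart l g x.
Proof.
elim/last_ind: l f g => [//|l i IH] f g; rewrite size_rcons !dpart_rcons => df dg.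
have [df1 df2] := df i; have [dg1 dg2] := dg i.
rewrite -IH//; congr dpart; apply/funext => x.
by rewrite /partial (_ : (fun _ => _) = f - g)// deriveB.
Qed.

Lemma Cw_ndiff k a lam (u : R -> 'rV[R]_n.+1 -> R) t : Cw k a lam u -> ndiff k (u t).
Proof.
elim: k a u => [//|k IH] a u ua i; split=> [x|].
  by have /is_derive_along[] := Cw_is_pd (Some i) ua t x.
exact: IH (Cw_pd (Some i) ua).
Qed.

Lemma Cw_dpart k l a lam (u : R -> 'rV[R]_n.+1 -> R) : Cw (k + size l) a lam u ->
  Cw k (a * lam ^+ size l) lam (fun t => dpart l (u t)).
Proof.
elim/last_ind: l a u => [|l i IH] a u; first by rewrite addn0 expr0 mulr1.
rewrite size_rcons addnS exprS mulrA => /(Cw_pd (Some i)) /IH.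
by under [fun t => dpart (rcons _ _) _]funext => t do rewrite dpart_rcons.
Qed.

End IteratedPartials.

(** * Derivatives of tanh networks *)

Section TanhNets.
Variables (R : realType) (n : nat).

Lemma is_derive_tanh (x : R) : is_derive x 1 (@tanh R) (1 - tanh x ^+ 2).
Proof.
have s0 : expR x + expR (- x) != 0 by rewrite gt_eqF// addr_gt0// expR_gt0.
have dN : is_derive x 1 (fun y : R => expR (- y)) (- expR (- x)).
  have := is_derive1_comp (is_derive_expR (- x)) (is_deriveNid x 1).
  by rewrite mulrN1.
have dnum := is_deriveB (is_derive_expR x) dN.
have dden := is_deriveD (is_derive_expR x) dN.
have dinv := @is_deriveV R _ x _ 1 s0 dden.
apply: is_derive_eq (is_deriveM dnum dinv) _.
rewrite /GRing.scale /= /tanh !fctE; field.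
exact: s0.
Qed.

Lemma tanh_le1 (x : R) : `|tanh x| <= 1.
Proof.
have p := expR_gt0 x; have q := expR_gt0 (- x).
rewrite /tanh normrM normfV (gtr0_norm (addr_gt0 p q)).
by rewrite ler_pdivrMr ?addr_gt0// mul1r ler_norml; apply/andP; split; lra.
Qed.

(** The recursion of [tanh_Cw]: two products, by [CwM], and tanh' = 1 - tanh^2. *)
Fixpoint tanh_const (k : nat) : R :=
  if k is k'.+1 then 2 ^+ k' * (1 + 2 ^+ k' * tanh_const k' ^+ 2) else 1.

Lemma tanh_const_ge1 k : 1 <= tanh_const k.
Proof.
elim: k => [//|k IH] /=.
have h : 1 <= 2 ^+ k :> R by rewrite exprn_ege1// ler1n.
rewrite -[leLHS]mulr1 ler_pM// lerDl mulr_ge0 ?sqr_ge0//; exact: le_trans h.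
Qed.

(** The chain rule closes on itself since tanh' = 1 - tanh^2.  Only the derivatives
of u enter, so the constant is insensitive to the size of u. *)
Lemma tanh_Cw k lam (u : R -> 'rV[R]_n.+1 -> R) : 1 <= lam ->
  (forall o, exists2 v, is_pd o u v & Cw k.-1 lam lam v) ->
  Cw k (tanh_const k) lam (fun t x => tanh (u t x)).
Proof.
move=> l1; have l0 : 0 <= lam by apply: le_trans l1.
elim: k => [|k IH] du; first by split=> // t x; exact: tanh_le1.
split=> [t x|o].
  by apply: le_trans (tanh_le1 _) (tanh_const_ge1 k.+1).
have [v duv vk] := du o.
exists (fun t x => (1 - tanh (u t x) ^+ 2) * v t x).
  exact: (is_pd_comp is_derive_tanh duv).
have yk : Cw k (tanh_const k) lam (fun t x => tanh (u t x)).
  apply: IH => o'; have [w duw wk] := du o'; exists w => //.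
  by apply: Cw_leq wk; exact: leq_pred.
have := CwM l0 (CwB (Cw_cst n k l0 (lexx `|1|)) (CwM l0 yk yk)) vk.
rewrite normr1 -expr2 mulrA.
rewrite [(fun _ _ => _)](_ : _ = (fun t x => (1 - tanh (u t x) ^+ 2) * v t x))//.
Qed.

Definition input_coord (o : option 'I_n.+1) : 'I_(n.+1 + 1) :=
  if o is Some i then lshift 1 i else rshift n.+1 ord0.

Lemma is_pd_affine m (A : 'M[R]_(m, n.+1 + 1)) (b : 'cV[R]_m) j o :
  is_pd o (fun t x => (A *m space_time x t + b) j 0)
          (fun _ _ => A j (input_coord o)).
Proof.
move=> t x.
have st r : (if o is Some i then space_time (x + r *: delta_mx 0 i) t
             else space_time x (t + r)) =
            space_time x t + r *: delta_mx (input_coord o) 0.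
  apply/colP => k; rewrite [RHS]mxE [X in _ = _ + X]mxE [X in _ * X]mxE eqxx andbT /space_time.
  case: o => [i|]; case: (split_ordP k) => l ->; rewrite !(col_mxEu, col_mxEd) !mxE.
  - by rewrite eq_lshift.
  - by rewrite eq_rlshift mulr0 addr0.
  - by rewrite eq_lrshift mulr0 addr0.
  - by rewrite eq_rshift !ord1 /= !mulr1n mulr1.
rewrite (_ : line _ _ t x = fun r => (A *m space_time x t + b) j 0 + r * A j (input_coord o)).
  have := is_deriveD (is_derive_cst ((A *m space_time x t + b) j 0) (0 : R) 1)
                     (is_derive_mulr (A j (input_coord o)) 0).
  by rewrite add0r.
apply/funext => r; rewrite /line.
transitivity ((A *m (space_time x t + r *: delta_mx (input_coord o) 0) + b) j 0).
  by rewrite -st; case: o {st}.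
rewrite mulmxDr -scalemxAr [LHS]mxE [X in X + _]mxE [X in _ + X + _]mxE [in RHS]mxE addrAC.
by rewrite -(colE (input_coord o) A) [X in _ + r * X = _]mxE.
Qed.

(** A derivative of a first-layer neuron costs a factor B.  The preactivations of
the second layer sum at most W such neurons with weights at most B, so their
derivatives of order j >= 1 are at most c W B B^j, which is at most lam^j for
lam = c W B^2.  The second tanh keeps the scale lam, and the last layer multiplies
the values by at most W B. *)
Lemma net_Cw k W B dout (u : tanh_net R (n.+1 + 1) dout) i : 1 <= W -> 1 <= B ->
  net_bounded W B u ->
  Cw k (2 * tanh_const k * (W * B)) (tanh_const k * (W * B ^+ 2))
    (fun t x => net_eval u (space_time x t) i 0).
Proof.
move=> W1 B1 [[w1 w2] [A1 b1] [A2 b2] [A3 b3]].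
have W0 : 0 <= W by apply: le_trans W1.
have B0 : 0 <= B by apply: le_trans B1.
have c1 := tanh_const_ge1 k; set c := tanh_const k in c1 *.
have c0 : 0 <= c by apply: le_trans c1.
set lam := c * (W * B ^+ 2).
have Wc : 1 <= c * W by rewrite -[leLHS]mulr1 ler_pM.
have Blam : B <= lam.
  by rewrite /lam mulrA expr2 mulrA ler_peMl// -[leLHS]mulr1 ler_pM.
have lam1 : 1 <= lam by apply: le_trans Blam.
have lam0 : 0 <= lam by apply: le_trans lam1.
pose y1 j (t : R) (x : 'rV[R]_n.+1) := tanh ((weight1 u *m space_time x t + bias1 u) j 0).
have y1C m j : Cw m (tanh_const m) B (y1 j).
  apply: tanh_Cw => // o; exists (fun _ _ => weight1 u j (input_coord o)); first exact: is_pd_affine.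
  by apply: Cw_cst => //; exact: A1.
have layer m m' (w : nat) (z : 'I_w -> R -> 'rV[R]_n.+1 -> R) (A : 'M[R]_(m', w)) cc ll j :
    0 <= ll -> 0 <= cc -> w%:R <= W -> mx_bounded B A -> (forall l, Cw m cc ll (z l)) ->
    Cw m (W * B * cc) ll (fun t x => \sum_l A j l * z l t x).
  move=> ll0 cc0 wW AB zC.
  apply: Cw_lea (Cw_sum _ ll0 (fun l => CwZ (A j l) (zC l))) => //.
  apply: (@le_trans _ _ (\sum_(l < w) B * cc)).
    by apply: ler_sum => l _; rewrite ler_wpM2r// AB.
  by rewrite sumr_const card_ord -mulr_natl -mulrA ler_wpM2r// mulr_ge0.
pose pre2 j (t : R) (x : 'rV[R]_n.+1) := (\sum_l weight2 u j l * y1 l t x) + bias2 u j 0.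
have y2C j : Cw k c lam (fun t x => tanh (pre2 j t x)).
  have [k0|k0] := posnP k.
    by rewrite /c k0; split=> // t x; exact: tanh_le1.
  apply: tanh_Cw => // o; exists (pd o (fun t x => \sum_l weight2 u j l * y1 l t x)).
    have H := Cw_is_pd o (layer 1%N _ _ y1 (weight2 u) _ B j B0 (le_trans ler01 (tanh_const_ge1 1)) w1 A2 (y1C 1%N)).
    have := is_pdD H (is_pd_cst o (bias2 u j 0)).
    rewrite [X in is_pd _ _ X](_ : _ = pd o (fun t x => \sum_l weight2 u j l * y1 l t x)) //.
    by apply/funext => t; apply/funext => x; rewrite addr0.
  have H := layer k _ _ y1 (weight2 u) _ B j B0 c0 w1 A2 (y1C _).
  move: H; rewrite -{1}(prednK k0) => /(Cw_pd o); apply: Cw_le => //.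
  (* This is where the scale lam comes from. *)
  by have -> : W * B * c * B = lam by rewrite /lam; ring.
have outC := layer k _ _ (fun j t x => tanh (pre2 j t x)) (weight3 u) c lam i lam0 c0 w2 A3 y2C.
have := CwD outC (Cw_cst n k lam0 (b3 i 0)).
rewrite [(fun _ _ => _)](_ : _ = (fun t x => net_eval u (space_time x t) i 0)).
  apply: Cw_lea => //.
  have : B <= W * B * c by rewrite mulrAC ler_peMl// mulrC.
  by rewrite -mulrA; lra.
apply/funext => t; apply/funext => x; rewrite /net_eval !mxE; congr (_ + _).
apply: eq_bigr => l _; apply: (congr1 (fun z => weight3 u i l * z)).
rewrite [RHS]mxE; apply: (congr1 (@tanh R)).
rewrite [RHS]mxE [X in _ = X + _]mxE; apply: (congr1 (fun z => z + bias2 u l 0)).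
by apply: eq_bigr => l' _; apply: (congr1 (fun z => weight2 u l l' * z)); rewrite [RHS]mxE.
Qed.

End TanhNets.

(** * Termwise differentiation of Fourier series *)

Section Fourier.
Variables (R : realType) (n : nat).
Notation coefs := (coefs R n.+1).
Notation freq := (freq n.+1).
Implicit Types (c : coefs) (m : freq) (f : 'rV[R]_n.+1 -> R).

(** The coefficients of the i-th partial derivative, i.e. the product of c by
2 pi m_i times the imaginary unit, on pairs of real and imaginary parts. *)
Definition dcoef (i : 'I_n.+1) c : coefs := fun m =>
  (- (2 * pi * (m i)%:~R * (c m).2), 2 * pi * (m i)%:~R * (c m).1).

Definition mode c m (x : 'rV[R]_n.+1) : R :=
  (c m).1 * cos (phase m x) - (c m).2 * sin (phase m x).

Definition weight m : R := 1 + freq_norm2 R m.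

Definition norm1 c m : R := `|(c m).1| + `|(c m).2|.

(** Absolute summability against w^j, as a bound uniform in the box of
frequencies; each derivative is paid by one power of the weight w. *)
Definition l1bound (j : nat) (A : R) c : Prop := forall K,
  \sum_(q : {ffun 'I_n.+1 -> 'I_(K.*2.+1)})
    weight (box_freq q) ^+ j * norm1 c (box_freq q) <= A.

Lemma weight_coord m i : 1 + (m i)%:~R ^+ 2 <= weight m.
Proof.
rewrite /weight lerD2l /freq_norm2 (bigD1 i)//= rmorphXn/= lerDl.
by apply: sumr_ge0 => k _; rewrite rmorphXn/= sqr_ge0.
Qed.

Lemma weight_ge1 m : 1 <= weight m.
Proof. by apply: le_trans (weight_coord m ord0); rewrite lerDl sqr_ge0. Qed.

Lemma weight_ge0 m : 0 <= weight m.
Proof. exact: le_trans (weight_ge1 m). Qed.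

Lemma norm1_ge0 c m : 0 <= norm1 c m.
Proof. by rewrite addr_ge0. Qed.

Lemma twopi_ge1 : 1 <= 2 * pi :> R.
Proof. have := @pi_ge2 R; lra. Qed.

Lemma norm1_dcoef i c m : norm1 (dcoef i c) m <= 2 * pi * (weight m * norm1 c m).
Proof.
have p0 : 0 <= 2 * pi :> R by apply: le_trans twopi_ge1.
have aux (P a b d : R) : 0 <= P -> `|- (P * a * b)| + `|P * a * d| = P * (`|a| * (`|d| + `|b|)).
  by move=> P0; rewrite normrN !normrM (ger0_norm P0); ring.
rewrite /norm1 /dcoef /= aux//.
rewrite ler_wpM2l// ler_wpM2r ?addr_ge0//.
apply: le_trans (weight_coord m i).
have := sqr_ge0 (`|(m i)%:~R| - 1 : R); rewrite sqrrB real_normK ?num_real// mulr1 expr1n.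
set a := `|_|; have := normr_ge0 ((m i)%:~R : R); rewrite -/a; lra.
Qed.

Lemma l1bound_dcoef j A i c : l1bound j.+1 A c -> l1bound j (2 * pi * A) (dcoef i c).
Proof.
move=> cA K; have p0 : 0 <= 2 * pi :> R by apply: le_trans twopi_ge1.
apply: le_trans (ler_wpM2l p0 (cA K)); rewrite mulr_sumr; apply: ler_sum => q _.
rewrite exprSr -mulrA mulrCA ler_wpM2l ?exprn_ge0 ?weight_ge0//.
exact: norm1_dcoef.
Qed.

Lemma l1bound_leq j k A c : (j <= k)%N -> l1bound k A c -> l1bound j A c.
Proof.
move=> jk cA K; apply: le_trans (cA K); apply: ler_sum => q _.
by rewrite ler_wpM2r ?norm1_ge0// ler_weXn2l// weight_ge1.
Qed.

Lemma mode_le c m x : `|mode c m x| <= norm1 c m.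
Proof.
apply: le_trans (ler_normB _ _) _; rewrite !normrM.
by rewrite lerD// ler_piMr// ler_norml ?cos_le1 ?cos_geN1 ?sin_le1 ?sin_geN1.
Qed.

Lemma fourier_sum_le j A c K x : l1bound j A c -> `|fourier_sum c K x| <= A.
Proof.
move=> /(l1bound_leq (leq0n _)) cA; apply: le_trans (cA K).
apply: le_trans (ler_norm_sum _ _ _) _; apply: ler_sum => q _.
by rewrite expr0 mul1r; exact: mode_le.
Qed.

Lemma phaseD m x i (r : R) :
  phase m (x + r *: delta_mx 0 i) = phase m x + r * (2 * pi * (m i)%:~R).
Proof.
rewrite /phase; have -> : \sum_i0 (m i0)%:~R * (x + r *: delta_mx 0 i) 0 i0 =
  \sum_i0 (m i0)%:~R * x 0 i0 + (m i)%:~R * r.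
  under eq_bigr do rewrite !mxE mulrDr; rewrite big_split /=; congr (_ + _).
  rewrite (bigD1 i)//= eqxx mulr1 big1 ?addr0// => k ki.
  by rewrite (negbTE ki) !mulr0.
ring.
Qed.

Lemma is_derive_mode i c m x :
  is_derive (0 : R) 1 (fun r : R => mode c m (x + r *: delta_mx 0 i)) (mode (dcoef i c) m x).
Proof.
pose b : R := 2 * pi * (m i)%:~R.
have dph : is_derive (0 : R) 1 (fun r : R => phase m x + r * b) b.
  have := is_deriveD (is_derive_cst (phase m x) (0 : R) 1) (is_derive_mulr b 0).
  by rewrite add0r.
have e0 : phase m x + 0 * b = phase m x by rewrite mul0r addr0.
have dc := @is_derive1_comp R cos (fun r : R => phase m x + r * b) 0 _ _ (is_derive_cos _) dph.
have ds := @is_derive1_comp R sin (fun r : R => phase m x + r * b) 0 _ _ (is_derive_sin _) dph.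
have := is_deriveB (is_deriveZ (c m).1 dc) (is_deriveZ (c m).2 ds).
rewrite e0 (_ : _ - _ = (fun r : R => mode c m (x + r *: delta_mx 0 i))); last first.
  by apply/funext => r; rewrite /mode phaseD.
move=> H; apply: is_derive_eq H _.
by rewrite /mode /dcoef /= -/b /GRing.scale /=; ring.
Qed.

Lemma is_derive_sumI (I : Type) (s : seq I) (F : I -> R -> R) (F' : I -> R) (x : R) :
  (forall i, is_derive x 1 (F i) (F' i)) ->
  is_derive x 1 (fun r => \sum_(i <- s) F i r) (\sum_(i <- s) F' i).
Proof.
move=> dF; elim: s => [|i s IH].
  rewrite big_nil (_ : (fun r => _) = cst 0); first exact: is_derive_cst.
  by apply/funext => r; rewrite big_nil.
rewrite big_cons (_ : (fun r => _) = F i + (fun r => \sum_(i <- s) F i r)).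
  exact: is_deriveD.
by apply/funext => r; rewrite big_cons.
Qed.

Lemma is_pd_fourier_sum i c K :
  is_pd (Some i) (fun _ => fourier_sum c K) (fun _ => fourier_sum (dcoef i c) K).
Proof.
move=> t x; have := is_derive_sumI (index_enum {ffun 'I_n.+1 -> 'I_(K.*2.+1)})
  (fun q => is_derive_mode i c (box_freq q) x).
exact.
Qed.

(** The bounds are uniform in K, hence inherited by the sum of the series through
its differences.  The partial sums are seen as fields that are constant in time. *)
Lemma fourier_sum_Cw k A c K : l1bound k A c ->
  Cw k A (2 * pi) (fun _ => fourier_sum c K).
Proof.
have p1 := twopi_ge1; have p0 : 0 <= 2 * pi :> R by apply: le_trans p1.
elim: k A c => [|k IH] A c cA.
  by split=> // t x; exact: fourier_sum_le cA.
split=> [t x|[i|]]; first exact: fourier_sum_le cA.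
  exists (fun _ => fourier_sum (dcoef i c) K).
    exact: is_pd_fourier_sum.
  by apply: IH; rewrite mulrC; exact: l1bound_dcoef.
exists (fun _ _ => 0); first by move=> t x; exact: is_derive_cst.
apply: Cw_cst => //; rewrite normr0 mulr_ge0//.
exact: le_trans (normr_ge0 _) (fourier_sum_le K 0 cA).
Qed.

Definition frep c f : Prop := forall x, fourier_sum c ^~ x @ \oo --> f x.

Lemma cvg_norm_le (u : nat -> R) (l A : R) : u @ \oo --> l ->
  (forall K, `|u K| <= A) -> `|l| <= A.
Proof.
move=> ul uA; have nul : `|u K| @[K --> \oo] --> `|l| by exact: cvg_norm.
rewrite -(cvg_lim _ nul)//; apply: limr_le; first by apply/cvg_ex; eexists; exact: nul.
exact: nearW.
Qed.

(** The three inequalities hold for all partial sums with one constant and are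
closed conditions. *)
Lemma frep_csp A c f : l1bound 2 A c -> frep c f ->
  csp (2 * (A * (2 * pi) ^+ 2)) f.
Proof.
move=> cA cf.
have S K : csp (2 * (A * (2 * pi) ^+ 2)) (fourier_sum c K).
  have [+ _ _] := Cw_c11 (lexx 0) twopi_ge1 (fourier_sum_Cw K cA).
  by move=> /(_ 0); apply; rewrite lexx.
split=> [x|x i u|x i u].
- by apply: cvg_norm_le (cf x) _ => K; have [+ _ _] := S K; apply.
- apply: cvg_norm_le (cvgB (cf (x + u *: delta_mx 0 i)) (cf x)) _ => K.
  by have [_ + _] := S K; apply.
- apply: cvg_norm_le (cvgB (cvgD (cf (x + u *: delta_mx 0 i)) (cf (x - u *: delta_mx 0 i)))
     (cvgM (cvg_cst (2 : R)) (cf x))) _ => K.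
  by have [_ _ +] := S K; apply.
Qed.

Lemma is_derive_eps (g : R -> R) (t d : R) :
  (forall e : R, 0 < e -> exists2 r : R, 0 < r &
    forall u, 0 < `|u| < r -> `|u^-1 * (g (t + u) - g t) - d| <= e) ->
  is_derive t 1 g d.
Proof.
move=> h.
have cv : (fun u : R => u^-1 *: ((g \o shift t) (u *: 1) - g t)) @ 0^' --> d.
  apply/cvgrPdist_le => e /h[r r0 hr].
  near=> u; rewrite distrC /= [u *: 1](mulr1 u) [u + t]addrC; apply: hr.
  rewrite normr_gt0; apply/andP; split; first by near: u; exact: nbhs_dnbhs_neq.
  by near: u; exact: dnbhs0_lt.
by apply: DeriveDef; [apply/cvg_ex; exists d | exact: cvg_lim cv].
Unshelve. all: by end_near. Qed.

(** Taylor's formula holds with the same remainder M u^2 for all partial sums.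
So their difference quotients of step u, which converge, approximate their
derivatives up to M u uniformly in K: the derivatives are a Cauchy sequence, and
Taylor's formula in the limit identifies their limit as the derivative of f. *)
Lemma frep_partial A c f i : l1bound 2 A c -> frep c f ->
  (forall x, derivable f x (delta_mx 0 i)) /\ frep (dcoef i c) (partial i f).
Proof.
move=> cA cf; pose M := A * (2 * pi) ^+ 2.
have M0 : 0 <= M.
  by rewrite mulr_ge0 ?sqr_ge0//; apply: le_trans (normr_ge0 _) (fourier_sum_le 0%N 0 cA).
have T1 K x u : `|fourier_sum c K (x + u *: delta_mx 0 i) - fourier_sum c K x
                  - u * fourier_sum (dcoef i c) K x| <= M * u ^+ 2.
  have C2 := fourier_sum_Cw K cA.
  have d1 r := is_pd_line 0 x r (Cw_is_pd (Some i) C2).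
  have d2 r := is_pd_line 0 x r (Cw_is_pd (Some i) (Cw_pd (Some i) C2)).
  have pdE : pd (Some i) (fun _ => fourier_sum c K) = fun _ => fourier_sum (dcoef i c) K.
    exact/is_pd_pd/is_pd_fourier_sum.
  have b2 r : `|line (Some i) (pd (Some i) (pd (Some i) (fun _ => fourier_sum c K))) 0 x r| <= M.
    apply: le_trans (Cw_bound (Cw_pd (Some i) (Cw_pd (Some i) C2)) _ _) _.
    by rewrite /M -mulrA -expr2.
  have := taylor1_le u d1 d2 b2; rewrite pdE /= scale0r addr0.
  exact.
have cvg1 x : cvg (fourier_sum (dcoef i c) ^~ x @ \oo).
  apply: cauchy_cvg; apply: cauchy_exP => e e0.
  have M1 : 0 < M + 1 by rewrite ltr_wpDl.
  (* A step for which M u is at most e / 8; the values at x and x + u are then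
     wanted up to e u / 8, as they get divided by u. *)
  pose u := e / (8 * (M + 1)).
  have u0 : 0 < u by rewrite divr_gt0// mulr_gt0.
  have Mu : M * u ^+ 2 <= e * u / 8.
    have -> : e * u / 8 = (M + 1) * u ^+ 2 by rewrite /u; field; rewrite gt_eqF.
    by rewrite ler_wpM2r ?sqr_ge0// lerDl.
  have eu : 0 < e * u / 8 by rewrite divr_gt0// mulr_gt0.
  have /cvgrPdist_le /(_ _ eu) N1 := cf (x + u *: delta_mx 0 i).
  have /cvgrPdist_le /(_ _ eu) N2 := cf x.
  have [N [N1N N2N]] := filter_ex (filterI N1 N2).
  exists (fourier_sum (dcoef i c) N x).
  suff : \forall K \near \oo, `|fourier_sum (dcoef i c) N x - fourier_sum (dcoef i c) K x| < e by [].
  near=> K.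
  have N1K : `|f (x + u *: delta_mx 0 i) - fourier_sum c K (x + u *: delta_mx 0 i)| <= e * u / 8.
    by near: K; exact: N1.
  have N2K : `|f x - fourier_sum c K x| <= e * u / 8 by near: K; exact: N2.
  have TK := le_trans (T1 K x u) Mu; have TN := le_trans (T1 N x u) Mu.
  rewrite -(@ltr_pM2l _ u)// -{1}(gtr0_norm u0) -normrM mulrBr [u * e]mulrC.
  move: N1N N2N N1K N2K TK TN; rewrite !ler_norml ltr_norml => /andP[a1 a2] /andP[b1 b2]
    /andP[c1 c2] /andP[d1 d2] /andP[e1 e2] /andP[f1 f2].
  by apply/andP; split; lra.
have T2 x u : `|f (x + u *: delta_mx 0 i) - f x
                - u * lim (fourier_sum (dcoef i c) ^~ x @ \oo)| <= M * u ^+ 2.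
  apply: cvg_norm_le (fun K => T1 K x u).
  apply: cvgB; first by apply: cvgB; exact: cf.
  by apply: cvgM; [exact: cvg_cst | exact: cvg1].
have D x : is_derive x (delta_mx 0 i) f (lim (fourier_sum (dcoef i c) ^~ x @ \oo)).
  apply: is_derive_along; apply: is_derive_eps => e e0.
  have M1 : 0 < M + 1 by rewrite ltr_wpDl.
  exists (e / (M + 1)); first by rewrite divr_gt0.
  move=> u /andP[u0 ue]; rewrite add0r scale0r addr0.
  have un0 : u != 0 by rewrite -normr_gt0.
  rewrite -(@ler_pM2l _ `|u|)// -normrM mulrBr mulVKf//.
  apply: le_trans (T2 x u) _; rewrite -real_normK ?num_real// expr2 mulrCA ler_wpM2l//.
  rewrite ltr_pdivlMr// in ue; apply: le_trans (ltW ue); rewrite mulrC ler_wpM2l//.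
  by rewrite lerDl.
split=> x; first by have [] := D x.
by rewrite /partial; have [_ ->] := D x; exact: cvg1.
Unshelve. all: by end_near. Qed.

Definition dcoefs (l : seq 'I_n.+1) c : coefs := foldr dcoef c l.

Lemma dcoefs_rcons l i c : dcoefs (rcons l i) c = dcoefs l (dcoef i c).
Proof. by rewrite /dcoefs -cats1 foldr_cat. Qed.

Lemma l1bound_dcoefs j l A c : l1bound (j + size l) A c ->
  l1bound j ((2 * pi) ^+ size l * A) (dcoefs l c).
Proof.
elim/last_ind: l A c => [|l i IH] A c; first by rewrite addn0 expr0 mul1r.
by rewrite size_rcons addnS dcoefs_rcons exprSr -mulrA => /l1bound_dcoef -/(_ i) /IH.
Qed.

Lemma frep_ndiff k A c f : l1bound k.+1 A c -> frep c f -> ndiff k f.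
Proof.
elim: k A c f => [//|k IH] A c f cA cf i.
have [df cdf] := frep_partial i (l1bound_leq (isT : (2 <= k.+2)%N) cA) cf.
split=> //; exact: IH (l1bound_dcoef i cA) cdf.
Qed.

Lemma frep_dpart l A c f : l1bound (size l).+1 A c -> frep c f ->
  frep (dcoefs l c) (dpart l f).
Proof.
elim/last_ind: l A c f => [//|l i IH] A c f; rewrite size_rcons => cA cf.
have [df cdf] := frep_partial i (l1bound_leq (isT : (2 <= (size l).+2)%N) cA) cf.
rewrite dcoefs_rcons dpart_rcons; exact: IH (l1bound_dcoef i cA) cdf.
Qed.

End Fourier.

(** * Regularity of functions and curves in periodic Sobolev spaces *)

Section Sobolev.
Variables (R : realType) (n : nat).
Notation coefs := (coefs R n.+1).
Notation freq := (freq n.+1).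
Implicit Types (c : coefs) (m : freq) (r H : R).

Lemma Hr_norm2_seq_le r c (s : seq freq) : uniq s ->
  ((\sum_(m <- s) weight R m `^ r * ((c m).1 ^+ 2 + (c m).2 ^+ 2))%:E
   <= Hr_norm2 r c)%E.
Proof.
move=> us; apply: esum_ge; exists [set` s].
  by split=> //; exact: finite_seq.
by rewrite -fsbig_seq// sumEFin.
Qed.

Lemma box_freq_inj K : injective (@box_freq n.+1 K).
Proof.
move=> p q pq; apply/ffunP => i; apply: val_inj.
have := congr1 (fun f : freq => f i) pq; rewrite !ffunE => /addIr.
by case.
Qed.

(** The part of the squared H^r norm carried by a box of frequencies: a real
number, unlike [Hr_norm2]. *)
Definition hrsum r c K : R := \sum_(q : {ffun 'I_n.+1 -> 'I_(K.*2.+1)})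
  weight R (box_freq q) `^ r * ((c (box_freq q)).1 ^+ 2 + (c (box_freq q)).2 ^+ 2).

Lemma hrsum_leE r c K : ((hrsum r c K)%:E <= Hr_norm2 r c)%E.
Proof.
have us : uniq [seq box_freq q | q <- index_enum {ffun 'I_n.+1 -> 'I_(K.*2.+1)}].
  by rewrite map_inj_uniq ?index_enum_uniq//; exact: box_freq_inj.
by apply: le_trans (Hr_norm2_seq_le r c us); rewrite big_map.
Qed.

Lemma Hr_norm2_ge0 r c : (0 <= Hr_norm2 r c)%E.
Proof. by apply: le_trans (Hr_norm2_seq_le r c (isT : uniq [::])); rewrite big_nil. Qed.

Lemma hrsum_le r c K : (Hr_norm2 r c < +oo)%E -> hrsum r c K <= fine (Hr_norm2 r c).
Proof.
move=> fin; rewrite -lee_fin fineK ?hrsum_leE// ge0_fin_numE//.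
exact: Hr_norm2_ge0.
Qed.

(** Each coefficient is controlled by the norm, so continuity and derivatives in
H^r of a curve give those of its coefficients. *)
Lemma Hr_component r c m : 0 <= r ->
  (((c m).1 ^+ 2)%:E <= Hr_norm2 r c)%E /\ (((c m).2 ^+ 2)%:E <= Hr_norm2 r c)%E.
Proof.
move=> r0; have := Hr_norm2_seq_le r c (isT : uniq [:: m]); rewrite big_seq1 => h.
have w1 : 1 <= weight R m `^ r by rewrite -(powRr0 (weight R m)) ler_powR ?weight_ge1.
have S0 : 0 <= (c m).1 ^+ 2 + (c m).2 ^+ 2 by rewrite addr_ge0 ?sqr_ge0.
split; apply: le_trans h; rewrite lee_fin; apply: le_trans (ler_peMl S0 w1).
  by rewrite lerDl sqr_ge0.
by rewrite lerDr sqr_ge0.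
Qed.

(** By induction on K, as 2 / (1 + k^2) <= 4 / k - 4 / (k + 1). *)
Lemma sum_inv_sqr_le K :
  \sum_(j < K.*2.+1) (1 + ((j%:Z - K%:Z)%:~R : R) ^+ 2)^-1 <= 5 - 4 / K.+1%:R.
Proof.
elim: K => [|K IH].
  by rewrite big_ord1 /= subr0 expr0n addr0 invr1 mulr1; lra.
rewrite doubleS big_ord_recl big_ord_recr /=.
have -> : \sum_(i < K.*2.+1) (1 + (((bump 0 i)%:Z - K.+1%:Z)%:~R : R) ^+ 2)^-1 =
  \sum_(j < K.*2.+1) (1 + ((j%:Z - K%:Z)%:~R : R) ^+ 2)^-1.
  apply: eq_bigr => i _; congr ((1 + _%:~R ^+ 2)^-1); rewrite /bump /=; lia.
have e1 : ((0%:Z - K.+1%:Z)%:~R : R) ^+ 2 = K.+1%:R ^+ 2.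
  by rewrite sub0r rmorphN/= sqrrN -pmulrn.
have e2 : (((bump 0 K.*2.+1)%:Z - K.+1%:Z)%:~R : R) ^+ 2 = K.+1%:R ^+ 2.
  congr (_ ^+ 2); rewrite (_ : _ - _ = K.+1%:Z) ?pmulrn//; rewrite /bump /=; lia.
rewrite e1 e2; set k : R := K.+1%:R in IH *.
have k1 : 1 <= k by rewrite /k ler1n.
have -> : K.+2%:R = k + 1 :> R by rewrite /k -addn1 natrD.
have kk : (1 + k ^+ 2)^-1 <= 2 / k - 2 / (k + 1).
  have -> : 2 / k - 2 / (k + 1) = 2 / (k * (k + 1)) by field; apply/andP; split; rewrite gt_eqF//; lra.
  rewrite -[leLHS]mul1r ler_pdivrMr ?(ltr_wpDr (sqr_ge0 k))// mulrAC ler_pdivlMr; last by rewrite mulr_gt0//; lra.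
  rewrite mul1r expr2; have : k <= k * k by rewrite ler_peMr//; lra.
  lra.
have E1 : 4 / k = 2 * (2 / k) by ring.
have E2 : 4 / (k + 1) = 2 * (2 / (k + 1)) by ring.
rewrite E1 in IH; rewrite E2.
apply: (@le_trans _ _ ((1 + k ^+ 2)^-1 + (5 - 2 * (2 / k) + (1 + k ^+ 2)^-1))).
  by rewrite lerD2l lerD2r; exact: IH.
move: kk; set a := (1 + k ^+ 2)^-1; set b := 2 / k; set c := 2 / (k + 1); lra.
Qed.

(** The weight dominates 1 + m_i^2 for every i, so the sum is dominated by a
product of one-dimensional sums. *)
Lemma sum_weight_inv_le K :
  \sum_(q : {ffun 'I_n.+1 -> 'I_(K.*2.+1)}) (weight R (box_freq q) ^+ n.+1)^-1
  <= 5 ^+ n.+1.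
Proof.
pose F (i : 'I_n.+1) (j : 'I_(K.*2.+1)) : R := (1 + ((j%:Z - K%:Z)%:~R : R) ^+ 2)^-1.
apply: (@le_trans _ _ (\sum_(q : {ffun 'I_n.+1 -> 'I_(K.*2.+1)}) \prod_i F i (q i))).
  apply: ler_sum => q _.
  have -> : (weight R (box_freq q) ^+ n.+1)^-1 = \prod_(i < n.+1) (weight R (box_freq q))^-1.
    by rewrite prodr_const card_ord exprVn.
  apply: ler_prod => i _; rewrite invr_ge0 weight_ge0 /=.
  have h := weight_coord R (box_freq q) i; rewrite ffunE in h.
  by rewrite lef_pV2// posrE ?(lt_le_trans ltr01 (weight_ge1 _ _))// ltr_wpDr ?sqr_ge0.
rewrite -(bigA_distr_bigA F) /= -[n.+1 in leRHS]card_ord -prodr_const.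
apply: ler_prod => i _; apply/andP; split.
  by apply: sumr_ge0 => j _; rewrite invr_ge0 addr_ge0 ?sqr_ge0.
apply: le_trans (sum_inv_sqr_le K) _; rewrite lerBlDr lerDl divr_ge0//.
Qed.

(** Cauchy-Schwarz in the form X <= X^2 y + 1 / y, with X = w^j |c_m| and
y = w^d, whose inverse is summable over the frequencies. *)
Lemma l1_of_hr j r H c : (2 * j + n.+1)%:R <= r ->
  (forall K, hrsum r c K <= H) -> l1bound j (H + 2 * 5 ^+ n.+1) c.
Proof.
move=> jr cH K; apply: le_trans (lerD (cH K) (ler_wpM2l _ (sum_weight_inv_le K))) => //.
rewrite mulr_sumr -big_split /=; apply: ler_sum => q _.
set m := box_freq q; set w := weight R m.
have w1 : 1 <= w := weight_ge1 R m.
have w0 : 0 < w by apply: lt_le_trans w1.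
have y0 : 0 < w ^+ n.+1 by rewrite exprn_gt0.
have amgm (a : R) : w ^+ j * `|a| <= w ^+ (2 * j + n.+1) * a ^+ 2 + (w ^+ n.+1)^-1.
  set y := w ^+ n.+1 in y0 *; set X := w ^+ j * `|a|.
  have -> : w ^+ (2 * j + n.+1) * a ^+ 2 = X ^+ 2 * y.
    by rewrite /X exprMn real_normK ?num_real// exprD mulnC exprM -/y; ring.
  have -> : X ^+ 2 * y + y^-1 = X + ((X * y - 1) ^+ 2 + X * y) / y.
    by field; rewrite gt_eqF.
  by rewrite lerDl divr_ge0 ?addr_ge0 ?sqr_ge0 ?mulr_ge0 ?exprn_ge0 ?(ltW w0) ?(ltW y0).
have wr : w ^+ (2 * j + n.+1) <= w `^ r by rewrite -powR_mulrn ?(ltW w0)// ler_powR.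
apply: (@le_trans _ _ (w ^+ (2 * j + n.+1) * ((c m).1 ^+ 2 + (c m).2 ^+ 2) + 2 / w ^+ n.+1)).
  by have := amgm (c m).1; have := amgm (c m).2; rewrite /norm1 !mulrDr; lra.
by rewrite lerD2r ler_wpM2r// addr_ge0 ?sqr_ge0.
Qed.

Lemma cvg_of_sqr (F : set_system R) (FF : Filter F) (g : R -> \bar R) (f : R -> R) (l : R) :
  g @ F --> 0%E -> (forall u, (((f u - l) ^+ 2)%:E <= g u)%E) -> f @ F --> l.
Proof.
move=> /fine_cvgP[gfin g0] fg; apply/cvgrPdist_le => e e0.
have e20 : 0 < e ^+ 2 by rewrite exprn_gt0.
move/cvgrPdist_le : g0 => /(_ _ e20) g0.
near=> u.
have gu : g u \is a fin_num by near: u.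
have : `|0 - (fine \o g) u| <= e ^+ 2 by near: u.
rewrite sub0r normrN /= => /(le_trans (ler_norm _)) h.
have := fg u; rewrite -(fineK gu) lee_fin => /le_trans /(_ h) h2.
by rewrite distrC -(@ler_pXn2r _ 2)// ?nnegrE ?(ltW e0)// real_normK ?num_real.
Unshelve. all: by end_near. Qed.

Section Curve.
Variables (T r : R) (r_ge0 : 0 <= r).
Implicit Types A B : R -> coefs.

Definition Hr_continuous A : Prop := forall t, t \in `[0, T] ->
  Hr_norm2 r (A u - A t) @[u --> within `[0, T] (nbhs t)] --> 0%E.

Definition Hr_derivative A B : Prop := forall t, t \in `[0, T] ->
  Hr_norm2 r ((u - t)^-1 *: (A u - A t) - B t) @[u --> within `[0, T] t^'] --> 0%E.

Lemma Hr_continuous_comp A m : Hr_continuous A ->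
  {within `[0, T], continuous (fun t => (A t m).1)} /\
  {within `[0, T], continuous (fun t => (A t m).2)}.
Proof.
move=> cA; split; apply/subspace_continuousP => t tT;
  apply: cvg_of_sqr (cA t tT) _ => u.
  by have [+ _] := Hr_component (A u - A t) m r_ge0.
by have [_ +] := Hr_component (A u - A t) m r_ge0.
Qed.

Lemma is_derive_within (f : R -> R) (t d : R) : 0 < t < T ->
  (u - t)^-1 * (f u - f t) @[u --> within `[0, T] t^'] --> d ->
  is_derive t 1 f d.
Proof.
move=> tT fd; apply: is_derive_eps => e e0.
move/cvgrPdist_le : fd => /(_ _ e0); rewrite near_withinE.
have tT' : t \in `]0, T[ by rewrite in_itv.
move=> /nbhs_ballP[p /= p0 hp].
have [q /= q0 hq] := near_in_itvoo tT'.
exists (Num.min p q); first by rewrite lt_min p0.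
move=> u /andP[u0]; rewrite lt_min => /andP[up uq].
have := hp (t + u); rewrite /ball /= opprD addNKr normrN => /(_ up).
have -> : t + u - t = u by rewrite addrAC subrr add0r.
rewrite distrC; apply.
  by rewrite -subr_eq0 addrAC subrr add0r -normr_gt0.
have := hq (t + u); rewrite /= opprD addNKr normrN => /(_ uq).
by rewrite !in_itv /= => /andP[? ?]; rewrite !ltW.
Qed.

Lemma Hr_derivative_comp A B m t : Hr_derivative A B -> 0 < t < T ->
  is_derive t 1 (fun t => (A t m).1) (B t m).1 /\
  is_derive t 1 (fun t => (A t m).2) (B t m).2.
Proof.
move=> dA tT; have tT' : t \in `[0, T] by rewrite in_itv /=; case/andP: tT => ? ?; rewrite !ltW.
split; apply: is_derive_within => //; apply: cvg_of_sqr (dA t tT') _ => u.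
  by have [+ _] := Hr_component ((u - t)^-1 *: (A u - A t) - B t) m r_ge0.
by have [_ +] := Hr_component ((u - t)^-1 *: (A u - A t) - B t) m r_ge0.
Qed.

(** Compactness of [0, T]: close to t, the squared norm is at most 2 plus twice
its value at t. *)
Lemma Hr_curve_bound A : Hr_continuous A ->
  (forall t, t \in `[0, T] -> (Hr_norm2 r (A t) < +oo)%E) ->
  exists H : R, forall t, t \in `[0, T] -> forall K, hrsum r (A t) K <= H.
Proof.
move=> cA fA.
have := @segment_compact R 0 T; rewrite compact_near_coveringP.
move=> /(_ nat \oo (fun N t => t \in `[0, T] -> forall K, hrsum r (A t) K <= N%:R) _) [].
  move=> t /= tT.
  have /fine_cvgP[gfin g0] := cA t tT.
  move/cvgrPdist_le : g0 => /(_ _ ltr01); rewrite near_withinE => g0.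
  rewrite near_withinE in gfin.
  have G : \forall u \near t, u \in `[0, T] -> forall K,
      hrsum r (A u) K <= 2 + 2 * fine (Hr_norm2 r (A t)).
    near=> u => uT K.
    have gu : Hr_norm2 r (A u - A t) \is a fin_num.
      by move: uT; near: u.
    have g1 : fine (Hr_norm2 r (A u - A t)) <= 1.
      have : `|0 - (fine \o (fun u => Hr_norm2 r (A u - A t))) u| <= 1.
        by move: uT; near: u.
      by rewrite sub0r normrN /=; apply: le_trans (ler_norm _).
    have gu' : (Hr_norm2 r (A u - A t)%R < +oo)%E.
      by rewrite -ge0_fin_numE// Hr_norm2_ge0.
    have h1 := le_trans (hrsum_le K gu') g1.
    have h2 := hrsum_le K (fA t tT).
    apply: (@le_trans _ _ (2 * hrsum r (A u - A t) K + 2 * hrsum r (A t) K)); last by lra.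
    rewrite /hrsum !mulr_sumr -big_split /=; apply: ler_sum => q _.
    rewrite mulrCA [X in _ <= _ + X]mulrCA -mulrDr ler_wpM2l ?powR_ge0//.
    have aux (a b a' b' : R) : a ^+ 2 + b ^+ 2 <=
        2 * ((a - a') ^+ 2 + (b - b') ^+ 2) + 2 * (a' ^+ 2 + b' ^+ 2).
      by have := sqr_ge0 (a - 2 * a'); have := sqr_ge0 (b - 2 * b'); lra.
    exact: aux.
  (* The covering argument needs bounds indexed by a filter; they are rounded up
     to natural numbers. *)
  pose N0 := (Num.truncn (2 + 2 * fine (Hr_norm2 r (A t)))).+1.
  exists ([set u | u \in `[0, T] -> forall K,
      hrsum r (A u) K <= 2 + 2 * fine (Hr_norm2 r (A t))], [set N | (N0 <= N)%N]).
    by split => //=; exists N0.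
  move=> [u N] [/= hu hN] uT K; apply: le_trans (hu uT K) _.
  apply: (@le_trans _ _ N0%:R); last by rewrite ler_nat.
  by rewrite ltW// truncnS_gt.
move=> N _ hN; exists N%:R => t tT K; exact: (hN N (leqnn N) t tT tT K).
Unshelve. all: by end_near. Qed.

(** Iterated derivatives multiply each coefficient by a fixed complex number,
which does not depend on time when c moves along a curve. *)
Lemma dcoefs_lin l c m :
  (dcoefs l c m).1 = (c m).1 * (dcoefs l (fun=> (1, 0)) m).1
                     + (c m).2 * (dcoefs l (fun=> (0, 1)) m).1 /\
  (dcoefs l c m).2 = (c m).1 * (dcoefs l (fun=> (1, 0)) m).2
                     + (c m).2 * (dcoefs l (fun=> (0, 1)) m).2.
Proof.
elim: l => [|i l [IH1 IH2]] /=; first by split; ring.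
by rewrite IH1 IH2; split; ring.
Qed.

Lemma mode_dcoefs l c m x :
  mode (dcoefs l c) m x = (c m).1 * mode (dcoefs l (fun=> (1, 0))) m x
                          + (c m).2 * mode (dcoefs l (fun=> (0, 1))) m x.
Proof. by rewrite /mode; have [-> ->] := dcoefs_lin l c m; ring. Qed.

Lemma cvg_sum_seq (I : Type) (s : seq I) (F : set_system R) (FF : Filter F)
    (f : I -> R -> R) (l : I -> R) : (forall i, f i @ F --> l i) ->
  (fun u => \sum_(i <- s) f i u) @ F --> \sum_(i <- s) l i.
Proof.
move=> fl; elim: s => [|i s IH].
  rewrite big_nil (_ : (fun u => _) = cst 0); first exact: cvg_cst.
  by apply/funext => u; rewrite big_nil.
rewrite big_cons (_ : (fun u => _) = fun u => f i u + \sum_(i <- s) f i u).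
  by apply: cvgD; [exact: fl | exact: IH].
by apply/funext => u; rewrite big_cons.
Qed.

Let phi l A K x t := fourier_sum (dcoefs l (A t)) K x.

Lemma fourier_curve_continuous l A K x : Hr_continuous A ->
  {within `[0, T], continuous (phi l A K x)}.
Proof.
move=> cA; apply/subspace_continuousP => t tT.
apply: (@cvg_sum_seq _ _ _ _ (fun q u => mode (dcoefs l (A u)) (box_freq q) x)
                             (fun q => mode (dcoefs l (A t)) (box_freq q) x)) => q.
rewrite mode_dcoefs.
rewrite (_ : (fun u => mode _ _ _) = fun u =>
    (A u (box_freq q)).1 * mode (dcoefs l (fun=> (1, 0))) (box_freq q) x +
    (A u (box_freq q)).2 * mode (dcoefs l (fun=> (0, 1))) (box_freq q) x); last first.
  by apply/funext => u; rewrite mode_dcoefs.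
have [/subspace_continuousP c1 /subspace_continuousP c2] := Hr_continuous_comp (box_freq q) cA.
by apply: cvgD; apply: cvgM; [exact: c1 | exact: cvg_cst | exact: c2 | exact: cvg_cst].
Qed.

Lemma fourier_curve_derive l A B K x t : Hr_derivative A B -> 0 < t < T ->
  is_derive t 1 (phi l A K x) (phi l B K x t).
Proof.
move=> dA tT; rewrite /phi /fourier_sum; apply: is_derive_sumI => q.
rewrite -!/(mode _ _ _) mode_dcoefs.
rewrite (_ : (fun u => _) = fun u =>
    (A u (box_freq q)).1 * mode (dcoefs l (fun=> (1, 0))) (box_freq q) x +
    (A u (box_freq q)).2 * mode (dcoefs l (fun=> (0, 1))) (box_freq q) x); last first.
  by apply/funext => u; rewrite -/(mode _ _ _) mode_dcoefs.
have [d1 d2] := Hr_derivative_comp (box_freq q) dA tT.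
have := is_deriveD (is_derive1_comp (is_derive_mulr (mode (dcoefs l (fun=> (1, 0))) (box_freq q) x) _) d1)
                   (is_derive1_comp (is_derive_mulr (mode (dcoefs l (fun=> (0, 1))) (box_freq q) x) _) d2).
rewrite [X in is_derive _ _ _ (X + _)]mulrC [X in is_derive _ _ _ (_ + X)]mulrC.
exact.
Qed.

End Curve.

(** Two derivatives are needed beyond those in [l], for second differences. *)
Lemma periodic_Hr_csp r f (l : seq 'I_n.+1) : (2 * (size l + 2) + n.+1)%:R <= r ->
  periodic_Hr r f -> (exists A, csp A (dpart l f)) /\ ndiff (size l) f.
Proof.
move=> lr [c [_ fin cf]].
have cH := l1_of_hr lr (fun K => hrsum_le K fin).
split; last by apply: frep_ndiff cf; apply: l1bound_leq cH; rewrite addn2.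
have cf' : frep (dcoefs l c) (dpart l f).
  by apply: frep_dpart cf; apply: l1bound_leq cH; rewrite addn2.
by eexists; apply: frep_csp cf'; apply: l1bound_dcoefs; rewrite addnC; exact: cH.
Qed.

(** The bounds in time hold for the partial sums, through the derivatives of the
coefficients up to order 2, and pass to the limit. *)
Lemma Cj_Hr_c11 j (T r : R) Q (l : seq 'I_n.+1) : 0 < T -> (2 <= j)%N ->
  (2 * (size l + 2) + n.+1)%:R <= r -> Cj_Hr j T r Q ->
  (exists A, c11 T A (fun t => dpart l (Q t))) /\
  forall t, 0 <= t <= T -> ndiff (size l) (Q t).
Proof.
move=> T0 j2 lr [A [repr cA dA]].
have r0 : 0 <= r by apply: le_trans lr.
have itv t : 0 <= t <= T -> t \in `[0, T] by rewrite in_itv.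
have c i : (i <= 2)%N -> Hr_continuous T r (A i).
  by move=> i2 t tT; have [] := cA i t (leq_trans i2 j2) tT.
have fin i : (i <= 2)%N -> forall t, t \in `[0, T] -> (Hr_norm2 r (A i t) < +oo)%E.
  by move=> i2 t tT; have [] := cA i t (leq_trans i2 j2) tT.
have d i : (i < 2)%N -> Hr_derivative T r (A i) (A i.+1).
  by move=> i2 t tT; exact: dA (leq_trans i2 j2) tT.
have l1 i : (i <= 2)%N -> exists H, forall t, t \in `[0, T] -> l1bound (size l + 2) H (A i t).
  move=> i2; have [H hH] := Hr_curve_bound (c i i2) (fin i i2).
  by eexists => t tT; apply: l1_of_hr lr (hH t tT).
have [H0 h0] := l1 0%N isT; have [H1 h1] := l1 1%N isT; have [H2 h2] := l1 2%N isT.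
pose D H := (2 * pi) ^+ size l * H.
have bnd i H t K x : (forall t, t \in `[0, T] -> l1bound (size l + 2) H (A i t)) ->
    0 <= t <= T -> `|fourier_sum (dcoefs l (A i t)) K x| <= D H.
  move=> hH tT; apply: fourier_sum_le; apply: (@l1bound_dcoefs _ _ 2).
  by rewrite addnC; apply: hH; exact: itv.
have rep t : 0 <= t <= T -> frep (A 0%N t) (Q t).
  by move=> /itv /repr [].
have rep' t : 0 <= t <= T -> frep (dcoefs l (A 0%N t)) (dpart l (Q t)).
  move=> tT; apply: frep_dpart (rep t tT).
  by apply: l1bound_leq (h0 t (itv t tT)); rewrite addn2.
split; last first.
  move=> t tT; apply: frep_ndiff (rep t tT).
  by apply: l1bound_leq (h0 t (itv t tT)); rewrite addn2.
have T0T : (0 : R) <= (0 : R) <= T by rewrite lexx ltW.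
have D0 i H : (forall t, t \in `[0, T] -> l1bound (size l + 2) H (A i t)) -> 0 <= D H.
  by move=> hH; apply: le_trans (normr_ge0 _) (bnd i H 0 0%N 0 hH T0T).
have cts i K x (p q : R) : (i <= 2)%N -> 0 <= p -> q <= T ->
    {within `[p, q], continuous (fun t => fourier_sum (dcoefs l (A i t)) K x)}.
  move=> i2 p0 qT.
  have H := @fourier_curve_continuous T r r0 l (A i) K x (c i i2).
  apply: continuous_subspaceW H => u /=.
  by rewrite !in_itv /= => /andP[pu uq]; rewrite (le_trans p0 pu) (le_trans uq qT).
have lip i H : (i < 2)%N -> (forall t, t \in `[0, T] -> l1bound (size l + 2) H (A i.+1 t)) ->
    forall K x s t, 0 <= s <= T -> 0 <= t <= T ->
    `|fourier_sum (dcoefs l (A i s)) K x - fourier_sum (dcoefs l (A i t)) K x| <= D H * `|s - t|.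
  move=> i2 hH K x; have key s t : 0 <= s <= T -> 0 <= t <= T -> s <= t ->
    `|fourier_sum (dcoefs l (A i t)) K x - fourier_sum (dcoefs l (A i s)) K x| <= D H * (t - s).
    move=> sT tT st.
    apply: (@mvt_le R (fun t => fourier_sum (dcoefs l (A i t)) K x) (fun t => fourier_sum (dcoefs l (A i.+1 t)) K x)) => //.
    - by apply: cts; [exact: ltnW | case/andP: sT | case/andP: tT].
    - by move=> u ust; apply: fourier_curve_derive (d i i2) _ => //; lra.
    - by move=> u ust; apply: bnd => //; lra.
  move=> s t sT tT; have [st|ts] := leP s t.
    by rewrite distrC [`|s - t|]distrC (ger0_norm (x := t - s)) ?subr_ge0//; exact: key.
  by rewrite (gtr0_norm (x := s - t)) ?subr_gt0//; exact: key (ltW ts).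
exists (2 * (D H0 * (2 * pi) ^+ 2) + (D H1 + 2 * D H2)).
have C0 : 0 <= D H0 * (2 * pi) ^+ 2 by rewrite mulr_ge0 ?sqr_ge0 ?(D0 0%N).
have C1 : 0 <= D H1 by apply: (D0 1%N).
have C2 : 0 <= D H2 by apply: (D0 2%N).
split=> [t tT|x s t sT tT|x u v v0 uv0 uvT].
- apply: (@csp_le _ _ (2 * (D H0 * (2 * pi) ^+ 2))); first by lra.
  apply: frep_csp (rep' t tT); apply: l1bound_dcoefs; rewrite addnC.
  exact: h0 (itv t tT).
- apply: (@le_trans _ _ (D H1 * `|s - t|)); last by rewrite ler_wpM2r//; lra.
  apply: cvg_norm_le (cvgB (rep' s sT x) (rep' t tT x)) _ => K.
  exact: lip.
- apply: (@le_trans _ _ (2 * D H2 * v ^+ 2)); last by rewrite ler_wpM2r ?sqr_ge0//; lra.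
  have p1 : 0 <= u + v <= T by apply/andP; split; lra.
  have p2 : 0 <= u - v <= T by apply/andP; split; lra.
  have p3 : 0 <= u <= T by apply/andP; split; lra.
  apply: cvg_norm_le (cvgB (cvgD (rep' _ p1 x) (rep' _ p2 x)) (cvgM (cvg_cst (2 : R)) (rep' _ p3 x))) _ => K.
  apply: (@second_diff_le R (fun t => fourier_sum (dcoefs l (A 0%N t)) K x) (fun t => fourier_sum (dcoefs l (A 1%N t)) K x)) => //.
  + exact: cts.
  + by move=> w wI; apply: fourier_curve_derive (d 0%N isT) _ => //; lra.
  + by move=> w w' wI wI'; apply: lip => //; lra.
Qed.

End Sobolev.

(** * Additivity of the iterated integral and Sobolev densities *)

Section Additivity.
Variables (R : realType) (n : nat).
Implicit Types f g : 'rV[R]_n -> R.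

(** A class of integrands on which the iterated integral is additive. *)
Definition tame f : Prop := exists A, csp A f.

Lemma tameD f g : tame f -> tame g -> tame (fun x => f x + g x).
Proof. by move=> [A fA] [B gB]; exists (A + B); exact: cspD. Qed.

Lemma tame_sqr f : tame f -> tame (fun x => f x ^+ 2).
Proof. by move=> [A fA]; exists (4 * A ^+ 2); exact: csp_sqr. Qed.

Lemma tame_sum (I : Type) (r : seq I) (P : pred I) (f : I -> 'rV[R]_n -> R) :
  (forall i, P i -> tame (f i)) -> tame (fun x => \sum_(i <- r | P i) f i x).
Proof.
move=> ft; elim: r => [|i r IH].
  rewrite (_ : (fun x => _) = fun=> 0); first by exists 0; exact: csp0.
  by apply/funext => x; rewrite big_nil.
rewrite (_ : (fun x => _) = fun x => if P i then
   f i x + \sum_(i <- r | P i) f i x else \sum_(i <- r | P i) f i x); last first.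
  by apply/funext => x; rewrite big_cons.
by case Pi : (P i) => //; apply: tameD => //; exact: ft.
Qed.

Lemma cube_intD f g : tame f -> tame g ->
  cube_int (fun x => f x + g x) = cube_int f + cube_int g.
Proof.
move=> [A fA] [B gB].
have H := @cube_int_sum R n bool [:: true; false] predT (A + B) (fun b => if b then f else g).
rewrite !big_cons !big_nil /= addr0 in H; rewrite -H.
  by congr cube_int; apply/funext => x; rewrite !big_cons big_nil addr0.
case.
  by apply: csp_le fA; rewrite lerDl (csp_ge0 gB).
by apply: csp_le gB; rewrite lerDr (csp_ge0 fA).
Qed.

Lemma cube_int_tame_sum (I : Type) (r : seq I) (P : pred I) (f : I -> 'rV[R]_n -> R) :
  (forall i, P i -> tame (f i)) ->
  cube_int (fun x => \sum_(i <- r | P i) f i x) = \sum_(i <- r | P i) cube_int (f i).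
Proof.
move=> ft; elim: r => [|i r IH].
  rewrite big_nil (_ : (fun x => _) = fun=> 0); last by apply/funext => x; rewrite big_nil.
  rewrite -[RHS](@big_nil _ 0 +%R bool predT (fun=> cube_int (fun _ : 'rV[R]_n => 0))).
  rewrite -(@cube_int_sum R n bool [::] predT 0 (fun _ _ => 0) (fun _ => csp0 R n)).
  by congr cube_int; apply/funext => x; rewrite big_nil.
rewrite big_cons -IH; case Pi : (P i).
  rewrite -cube_intD; [|exact: ft|exact: tame_sum].
  by congr cube_int; apply/funext => x; rewrite big_cons Pi.
by congr cube_int; apply/funext => x; rewrite big_cons Pi.
Qed.

Lemma c11_tame T A (F : R -> 'rV[R]_n -> R) t : c11 T A F -> 0 <= t <= T -> tame (F t).
Proof. by move=> [+ _ _] tT => /(_ t tT) ?; exists A. Qed.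

Lemma c11_ext T A (F G : R -> 'rV[R]_n -> R) :
  (forall t, 0 <= t <= T -> F t = G t) -> c11 T A F -> c11 T A G.
Proof.
move=> FG [h1 h2 h3]; split=> [t tT|x s t sT tT|x c u u0 c0 cT].
- by rewrite -FG//; exact: h1.
- by rewrite -!FG//; exact: h2.
- by rewrite -!FG ?h3//; apply/andP; split; lra.
Qed.

End Additivity.

Section Density.
Variables (R : realType) (n s : nat).
Implicit Types (f : 'rV[R]_n.+1 -> R) (F : R -> 'rV[R]_n.+1 -> R).

Lemma sobolev_norm2E f : (forall a : multiindex n.+1 s, (mi_order a <= s)%N -> tame (Dmulti a f)) ->
  sobolev_norm2 s f = cube_int (sobolev_density s f).
Proof.
move=> ft; rewrite /sobolev_norm2 /sobolev_density cube_int_tame_sum// => a sa.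
exact/tame_sqr/ft.
Qed.

Definition num_mi : R := #|{: multiindex n.+1 s}|%:R.

Lemma num_mi_ge0 : 0 <= num_mi. Proof. by rewrite ler0n. Qed.

Lemma sum_mi_le (P : pred (multiindex n.+1 s)) (A : R) : 0 <= A -> \sum_(a | P a) A <= num_mi * A.
Proof.
move=> A0; rewrite sumr_const -mulr_natl ler_wpM2r// ler_nat.
exact: max_card.
Qed.

Lemma density_c11 T A F : 0 <= T -> 0 <= A ->
  (forall a : multiindex n.+1 s, (mi_order a <= s)%N -> c11 T A (fun t => Dmulti a (F t))) ->
  c11 T (num_mi * (4 * A ^+ 2)) (fun t => sobolev_density s (F t)).
Proof.
move=> T0 A0 FA.
apply: (@c11_le _ _ _ (\sum_(a : multiindex n.+1 s | (mi_order a <= s)%N) (4 * A ^+ 2))).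
  by apply: sum_mi_le; rewrite mulr_ge0 ?sqr_ge0.
by apply: c11_sum => a sa; apply: c11_sqr => //; exact: FA.
Qed.

Lemma Cw_Dmulti_c11 T k a lam F : 0 <= T -> 1 <= lam ->
  Cw (k + 2) a lam F -> (k <= s)%N ->
  forall i : multiindex n.+1 s, (mi_order i <= k)%N ->
  c11 T (2 * (a * lam ^+ (k + 2))) (fun t => Dmulti i (F t)).
Proof.
move=> T0 l1 FC ks i ik; have a0 := Cw_ge0 FC.
have l0 : 0 <= lam by apply: le_trans l1.
have [l sl lE] := Dmulti_dpart R i.
rewrite (_ : (fun t => Dmulti i (F t)) = fun t => dpart l (F t)); last first.
  by apply/funext => t; rewrite lE.
have FC' : Cw (2 + size l) a lam F by apply: Cw_leq FC; rewrite sl addnC leq_add2r.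
have := Cw_c11 T0 l1 (Cw_dpart FC'); apply: c11_le.
by rewrite ler_wpM2l// -mulrA -exprD ler_wpM2l// ler_weXn2l// leq_add2r sl.
Qed.

End Density.

(** * Residuals of the primitive equations *)

Lemma perp_cases (R : realType) h (i : 'I_h) :
  (forall V : 'I_h -> R, perp V i = 0) \/
  exists j (b : bool), forall V : 'I_h -> R, perp V i = (-1) ^+ b * V j.
Proof.
case: h i => [|[|[|h]]] i; [by left | by left | right | by left].
case: (eqVneq i ord0) => i0.
  by exists ord_max, true => V; rewrite /perp i0 eqxx expr1 mulN1r.
by exists ord0, false => V; rewrite /perp (negbTE i0) expr0 mul1r.
Qed.

Section Residuals.
Variables (R : realType) (h s : nat) (c : pe_coefs R).
Variables (theta : pinn R h) (a lam : R).
Hypotheses (a_ge1 : 1 <= a) (lam_ge1 : 1 <= lam).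
Hypotheses (VC : forall i, Cw (s + 5) a lam (V_ theta i))
  (wC : Cw (s + 5) a lam (w_ theta)) (pC : Cw (s + 5) a lam (p_ theta))
  (TC : Cw (s + 5) a lam (T_ theta)).

Let a0 : 0 <= a. Proof. exact: le_trans a_ge1. Qed.
Let l0 : 0 <= lam. Proof. exact: le_trans lam_ge1. Qed.
(* Every term of a residual has at most two factors and at most two derivatives
   in total, so S is a common unit for all of them. *)
Let S := a ^+ 2 * lam ^+ 2.
Let K (c : R) := Cw (n := h) (s + 2) (c * S) lam.

Let S_ge u v : (u <= 2)%N -> (v <= 2)%N -> a ^+ u * lam ^+ v <= S.
Proof. by move=> u2 v2; apply: ler_pM; rewrite ?exprn_ge0// ler_weXn2l. Qed.

Let K0 u : Cw (s + 5) a lam u -> K 1 u.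
Proof.
move=> uC; apply: Cw_lea (Cw_leq _ uC) => //; last by rewrite leq_add2l.
by rewrite mul1r; have := @S_ge 1 0 isT isT; rewrite expr1 expr0 mulr1.
Qed.

Let K1 u o : Cw (s + 5) a lam u -> K 1 (pd o u).
Proof.
move=> uC.
have uC' : Cw (s + 3) a lam u by apply: Cw_leq uC; rewrite leq_add2l.
rewrite addnS in uC'; apply: Cw_lea (Cw_pd o uC') => //.
by rewrite mul1r; have := @S_ge 1 1 isT isT; rewrite !expr1.
Qed.

Let K2 u o o' : Cw (s + 5) a lam u -> K 1 (pd o (pd o' u)).
Proof.
move=> uC.
have uC' : Cw (s + 4) a lam u by apply: Cw_leq uC; rewrite leq_add2l.
rewrite !addnS in uC'; have := Cw_pd o (Cw_pd o' uC').
rewrite -!addnS; apply: Cw_lea => //.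
by rewrite mul1r -mulrA; have := @S_ge 1 2 isT isT; rewrite !expr1 expr2.
Qed.

Let KM u v o : Cw (s + 5) a lam u -> Cw (s + 5) a lam v ->
  K (2 ^+ (s + 2)) (fun t x => u t x * pd o v t x).
Proof.
move=> uC vC.
have uC' : Cw (s + 2) a lam u by apply: Cw_leq uC; rewrite leq_add2l.
have vC' : Cw (s + 3) a lam v by apply: Cw_leq vC; rewrite leq_add2l.
rewrite addnS in vC'; apply: Cw_lea (CwM l0 uC' (Cw_pd o vC')) => //.
rewrite ler_wpM2l ?exprn_ge0// mulrA -expr2.
by have := @S_ge 2 1 isT isT; rewrite expr1.
Qed.

Let KD x y u v : K x u -> K y v -> K (x + y) (fun t x => u t x + v t x).
Proof. by move=> uK vK; rewrite /K mulrDl; exact: CwD. Qed.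

Let KB x y u v : K x u -> K y v -> K (x + y) (fun t x => u t x - v t x).
Proof. by move=> uK vK; rewrite /K mulrDl; exact: CwB. Qed.

Let KZ x y u : K x u -> K (`|y| * x) (fun t x => y * u t x).
Proof. by move=> uK; rewrite /K -mulrA; exact: CwZ. Qed.

Let Ksum (x : R) (u : 'I_h -> R -> 'rV[R]_h.+1 -> R) : (forall i, K x (u i)) ->
  K (h%:R * x) (fun t y => \sum_(i < h) u i t y).
Proof.
move=> uK; have := Cw_sum (index_enum 'I_h) l0 uK.
by rewrite sumr_const card_ord /K -[_ *+ h]mulr_natl mulrA.
Qed.

Let Ktransport u : Cw (s + 5) a lam u ->
  K (h%:R * 2 ^+ (s + 2) + 2 ^+ (s + 2)) (transport theta u).
Proof.
move=> uC; apply: KD; last exact: KM (Some (zdir h)) wC uC.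
by apply: Ksum => i; exact: KM (Some (hdir i)) (VC i) uC.
Qed.

Let Klaplace u : Cw (s + 5) a lam u -> K (h%:R * 1) (fun t => laplace_h (u t)).
Proof. by move=> uC; apply: Ksum => i; exact: K2 (Some _) (Some _) uC. Qed.

Let Kperp i : K 1 (fun t x => perp (fun j => V_ theta j t x) i).
Proof.
have cst0 : K 1 (fun _ _ => 0).
  by apply: Cw_cst => //; rewrite normr0 mul1r mulr_ge0 ?exprn_ge0.
have [p0|[j [b pE]]] := perp_cases R i.
  by rewrite (_ : (fun _ _ => _) = fun _ _ => 0)//; apply/funext => t; apply/funext => x; rewrite p0.
rewrite (_ : (fun _ _ => _) = fun t x => (-1) ^+ b * V_ theta j t x); last first.
  by apply/funext => t; apply/funext => x; rewrite pE.
by have := KZ ((-1) ^+ b) (K0 (VC j)); rewrite normrX normrN1 expr1n mul1r.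
Qed.

(** Dominates, for each residual, the sum of the constants of its terms; the powers of 2 come from
Leibniz's rule in the transport terms. *)
Definition res_const : R :=
  2 + (h%:R * 2 ^+ (s + 2) + 2 ^+ (s + 2)) + `|f0 c| + `|nu_h c| * h%:R + `|nu_z c|
  + `|kappa_h c| * h%:R + `|kappa_z c| + h%:R.

Let Kle x u : x <= res_const -> K x u -> K res_const u.
Proof. by move=> xr; apply: Cw_lea => //; rewrite ler_wpM2r// mulr_ge0 ?exprn_ge0. Qed.

Lemma res_V_Cw i : Cw (s + 2) (res_const * (a ^+ 2 * lam ^+ 2)) lam (res_V c theta i).
Proof.
have h1 := KD (K1 None (VC i)) (Ktransport (VC i)).
have h2 := KB (KB (KD h1 (KZ (f0 c) (Kperp i))) (KZ (nu_h c) (Klaplace (VC i))))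
  (KZ (nu_z c) (K2 (Some (zdir h)) (Some (zdir h)) (VC i))).
have h3 := KD h2 (K1 (Some (hdir i)) pC).
apply: Kle h3; rewrite /res_const !mulr1.
have := normr_ge0 (kappa_h c); have := normr_ge0 (kappa_z c); have h0 := ler0n R h.
move=> ? kh; have := mulr_ge0 kh h0; lra.
Qed.

Lemma res_p_Cw : Cw (s + 2) (res_const * (a ^+ 2 * lam ^+ 2)) lam (res_p theta).
Proof.
have h1 := KD (K1 (Some (zdir h)) pC) (K0 TC).
apply: Kle h1; rewrite /res_const.
have := normr_ge0 (kappa_h c); have := normr_ge0 (kappa_z c); have h0 := ler0n R h.
have := normr_ge0 (nu_h c); have := normr_ge0 (nu_z c); have := normr_ge0 (f0 c).
have p0 : 0 <= 2 ^+ (s + 2) :> R by rewrite exprn_ge0.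
move=> ? ? nh ? kh; have := mulr_ge0 kh h0; have := mulr_ge0 nh h0; have := mulr_ge0 h0 p0; lra.
Qed.

Lemma res_div_Cw : Cw (s + 2) (res_const * (a ^+ 2 * lam ^+ 2)) lam (res_div theta).
Proof.
have h1 := KD (Ksum (fun i => K1 (Some (hdir i)) (VC i))) (K1 (Some (zdir h)) wC).
apply: Kle h1; rewrite /res_const mulr1.
have := normr_ge0 (kappa_h c); have := normr_ge0 (kappa_z c); have h0 := ler0n R h.
have := normr_ge0 (nu_h c); have := normr_ge0 (nu_z c); have := normr_ge0 (f0 c).
have p0 : 0 <= 2 ^+ (s + 2) :> R by rewrite exprn_ge0.
move=> ? ? nh ? kh; have := mulr_ge0 kh h0; have := mulr_ge0 nh h0; have := mulr_ge0 h0 p0; lra.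
Qed.

Lemma res_T_Cw : Cw (s + 2) (res_const * (a ^+ 2 * lam ^+ 2)) lam
  (res_T c (fun _ _ => 0) theta).
Proof.
have h1 := KD (K1 None TC) (Ktransport TC).
have h2 := KB (KB h1 (KZ (kappa_h c) (Klaplace TC)))
  (KZ (kappa_z c) (K2 (Some (zdir h)) (Some (zdir h)) TC)).
rewrite (_ : res_T _ _ _ = fun t x => dt (T_ theta) t x + transport theta (T_ theta) t x
  - kappa_h c * laplace_h (T_ theta t) x - kappa_z c * dzz (T_ theta t) x).
  apply: Kle h2; rewrite /res_const !mulr1.
  have := normr_ge0 (nu_h c); have := normr_ge0 (nu_z c); have := normr_ge0 (f0 c); have h0 := ler0n R h.
  move=> ? ? nh; have := mulr_ge0 nh h0; lra.
by apply/funext => t; apply/funext => x; rewrite /res_T subr0.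
Qed.

End Residuals.

(** * Quadrature errors on sample sets *)

Section Quadrature.
Variable R : realType.

Lemma quadrature_interior n (T : R) m M (g : R * 'rV[R]_n -> R) :
  quadrature T [seq (t, x) | t <- time_midpoints T m, x <- cube_midpoints R n M] g =
  \sum_(t <- time_midpoints T m) T / m%:R * cube_avg M (fun x => g (t, x)).
Proof.
rewrite /quadrature big_allpairs_dep /quad_weight size_allpairs size_cube_midpoints.
rewrite size_map size_iota natrM natrX invfM; apply: eq_bigr => t _.
rewrite /cube_avg mulr_sumr; apply: eq_bigr => x _; ring.
Qed.

Lemma quadrature_initial n M (g : 'rV[R]_n -> R) :
  quadrature 1 (cube_midpoints R n M) g = cube_avg M g.
Proof.
by rewrite /quadrature /quad_weight size_cube_midpoints natrX mul1r.
Qed.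

Lemma size_boundary_midpoints h M :
  size (boundary_midpoints R h M) = (h.+1 * 2 * M ^ h)%N.
Proof.
rewrite /boundary_midpoints size_flatten /shape -map_comp sumnE big_map big_enum /=.
under eq_bigr do rewrite size_map size_cube_midpoints.
by rewrite sum_nat_const card_prod card_ord card_bool.
Qed.

Lemma quadrature_boundary h (T : R) m M (g : R * 'rV[R]_h.+1 -> R) :
  quadrature (2 * h.+1%:R * T)
    [seq (t, x) | t <- time_midpoints T m, x <- boundary_midpoints R h M] g =
  \sum_(a < h.+1) \sum_(b : bool)
    \sum_(t <- time_midpoints T m) T / m%:R * cube_avg M (fun y => g (t, face_point a b y)).
Proof.
rewrite pair_bigA exchange_big /=.
rewrite /quadrature big_allpairs_dep /quad_weight size_allpairs size_boundary_midpoints.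
rewrite size_map size_iota !natrM natrX; apply: eq_bigr => t _.
rewrite /boundary_midpoints big_flatten /= big_map big_enum /=; apply: eq_bigr => ab _.
rewrite big_map /cube_avg mulr_sumr; apply: eq_bigr => x _.
rewrite !invfM; set x1 := m%:R^-1; set y1 := (M%:R ^+ h)^-1.
have -> : 2 * h.+1%:R * T * (x1 * (h.+1%:R^-1 * 2^-1 * y1)) = T * x1 * y1.
  have hn : h.+1%:R != 0 :> R by rewrite pnatr_eq0.
  by move: (h.+1%:R) hn => H hn; field.
by rewrite mulrA.
Qed.

Lemma similar_sqr (L l S k : R) : 0 <= L -> 0 <= l -> 0 <= S ->
  Defs.similar L l (S `^ (- (k^-1))) -> l ^+ 2 <= L ^+ 2 * S `^ (- (2 / k)).
Proof.
move=> L0 l0 S0 /andP[_ h].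
have -> : S `^ (- (2 / k)) = (S `^ (- (k^-1))) ^+ 2.
  by rewrite -powR_mulrn ?powR_ge0// -powRrM; congr (_ `^ _); ring.
by rewrite -exprMn ler_pXn2r// nnegrE// mulr_ge0 ?powR_ge0.
Qed.

Lemma combine_error (T A k k' x y L S : R) : 0 <= T -> 0 <= A -> 0 <= k ->
  k' = k + 1 -> x <= L * S -> y <= L * S ->
  T * A * (k * x + y) <= T * A * (k' * L) * S.
Proof.
move=> T0 A0 k0 -> xe ye.
rewrite -[leRHS]mulrA ler_wpM2l ?mulr_ge0// -mulrA mulrDl mul1r lerD//.
by rewrite ler_wpM2l.
Qed.

Lemma interior_error h (T L A : R) (F : R -> 'rV[R]_h.+1 -> R) Si :
  0 < T -> 0 < L -> c11 T A F -> interior_samples T L Si ->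
  `|time_int T (fun t => cube_int (F t)) - quadrature T Si (fun y => F y.1 y.2)|
  <= T * A * (h.+2%:R * L ^+ 2) * (size Si)%:R `^ (- (2 / h.+2%:R)).
Proof.
move=> T0 L0 FA [m [M [[m0 M0] SiE h1 h2]]].
have A0 := c11_ge0 (ltW T0) FA.
have e1 := similar_sqr (ltW L0) (divr_ge0 (ltW T0) (ler0n _ m)) (ler0n _ _) h1.
have e2 : M%:R^-1 ^+ 2 <= _ := similar_sqr (ltW L0) _ (ler0n _ _) h2.
rewrite {1}SiE quadrature_interior; apply: le_trans (space_time_midpoint_le T0 m0 M0 FA) _.
apply: combine_error => //; rewrite ?(ltW T0)//; last by apply: e2; rewrite invr_ge0.
by rewrite -addn1 natrD.
Qed.

Lemma initial_error h (L A : R) (f : 'rV[R]_h.+1 -> R) St :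
  0 < L -> csp A f -> initial_samples L St ->
  `|cube_int f - quadrature 1 St f|
  <= A * (h.+1%:R * L ^+ 2) * (size St)%:R `^ (- (2 / h.+1%:R)).
Proof.
move=> L0 fA [M [M0 StE h2]]; have A0 := csp_ge0 fA.
have M1 : 0 <= M%:R^-1 :> R by rewrite invr_ge0.
have e2 := similar_sqr (ltW L0) M1 (ler0n _ _) h2.
rewrite {1}StE quadrature_initial; apply: le_trans (cube_midpoint_le M0 fA) _.
rewrite [_ * A]mulrC -!mulrA ler_wpM2l// ler_wpM2l//.
by move: e2; rewrite exprVn expr2 -mulrA.
Qed.

Lemma boundary_error h (T L A : R) (F : R -> 'rV[R]_h.+1 -> R) Sb :
  0 < T -> 0 < L -> c11 T A F -> boundary_samples T L Sb ->
  `|time_int T (fun t => boundary_int (F t))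
    - quadrature (2 * h.+1%:R * T) Sb (fun y => F y.1 y.2)|
  <= 2 * h.+1%:R * T * A * (h.+1%:R * L ^+ 2) * (size Sb)%:R `^ (- (2 / h.+1%:R)).
Proof.
move=> T0 L0 FA [m [M [[m0 M0] SbE h1 h2]]].
have A0 := c11_ge0 (ltW T0) FA.
have M1 : 0 <= M%:R^-1 :> R by rewrite invr_ge0.
have e1 := similar_sqr (ltW L0) (divr_ge0 (ltW T0) (ler0n _ m)) (ler0n _ _) h1.
have e2 := similar_sqr (ltW L0) M1 (ler0n _ _) h2.
have FF a b := c11_face a b (ltW T0) FA.
rewrite {1}SbE quadrature_boundary /boundary_int.
rewrite (_ : time_int T _ = \sum_(a < h.+1) \sum_(b : bool)
    time_int T (fun t => cube_int (fun y => F t (face_point a b y)))); last first.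
  have -> : (fun t => \sum_(a < h.+1) \sum_(b : bool) cube_int (fun y => F t (face_point a b y)))
    = (fun t => \sum_(ab : 'I_h.+1 * bool) cube_int (fun y => F t (face_point ab.1 ab.2 y))).
    by apply/funext => t; rewrite pair_bigA.
  rewrite pair_bigA /=; apply: (time_int_sum _ _ (ltW T0) (fun _ => A0)) => ab.
  exact: cube_int_lip (FF ab.1 ab.2).
rewrite !pair_bigA -sumrB; apply: le_trans (ler_norm_sum _ _ _) _.
apply: (@le_trans _ _ (\sum_(ab : 'I_h.+1 * bool)
   (T * A * (h.+1%:R * L ^+ 2) * (size Sb)%:R `^ (- (2 / h.+1%:R))))).
  apply: ler_sum => -[a b] _ /=.
  apply: le_trans (space_time_midpoint_le T0 m0 M0 (FF a b)) _.
  by apply: combine_error => //; rewrite ?(ltW T0)// -addn1 natrD.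
rewrite sumr_const card_prod card_ord card_bool -[_ *+ (h.+1 * 2)]mulr_natl natrM.
by rewrite !mulrA [_ * 2]mulrC.
Qed.

End Quadrature.

(** * Sobolev norms as integrals of regular densities *)

Section Blocks.
Variables (R : realType) (n s : nat) (T : R) (T_ge0 : 0 <= T).
Implicit Types F P : R -> 'rV[R]_n.+1 -> R.

(** What the estimate of an error asks from each field: an integrand to which the
midpoint rule applies, and the exchange of sum and integral that makes it the
integrand of the squared norm. *)
Definition block A F : Prop :=
  c11 T A (fun t => sobolev_density s (F t)) /\
  forall t, 0 <= t <= T -> sobolev_norm2 s (F t) = cube_int (sobolev_density s (F t)).

Lemma block_of A F : 0 <= A ->
  (forall a : multiindex n.+1 s, (mi_order a <= s)%N -> c11 T A (fun t => Dmulti a (F t))) ->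
  block (num_mi R n s * (4 * A ^+ 2)) F.
Proof.
move=> A0 FA; split; first exact: density_c11.
move=> t tT; apply: sobolev_norm2E => a sa; exact: c11_tame (FA a sa) tT.
Qed.

Lemma block_le A B F : A <= B -> block A F -> block B F.
Proof. by move=> AB [h1 h2]; split=> //; exact: c11_le AB h1. Qed.

Lemma block_Cw a lam F : 1 <= lam -> Cw (s + 2) a lam F ->
  block (num_mi R n s * (16 * (a * lam ^+ (s + 2)) ^+ 2)) F.
Proof.
move=> l1 FC; have a0 := Cw_ge0 FC.
have l0 : 0 <= lam by apply: le_trans l1.
have B0 : 0 <= 2 * (a * lam ^+ (s + 2)) by rewrite !mulr_ge0 ?exprn_ge0.
have := block_of B0 (fun i => Cw_Dmulti_c11 T_ge0 l1 FC (leqnn s) (i := i)).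
by rewrite (_ : 4 * _ = 16 * (a * lam ^+ (s + 2)) ^+ 2)//; ring.
Qed.

(** The inequality (A + q)^2 <= 2 A^2 + 2 q^2 removes the cross terms, so that the
constants of the two functions enter separately. *)
Lemma block_sub A q F P : 0 <= A -> 0 <= q ->
  (forall a : multiindex n.+1 s, (mi_order a <= s)%N -> c11 T A (fun t => Dmulti a (F t))) ->
  (forall a : multiindex n.+1 s, (mi_order a <= s)%N -> c11 T q (fun t => Dmulti a (P t))) ->
  (forall t, 0 <= t <= T -> ndiff s (F t) /\ ndiff s (P t)) ->
  block (num_mi R n s * (8 * A ^+ 2 + 8 * q ^+ 2)) (fun t x => F t x - P t x).
Proof.
move=> A0 q0 FA PA FP; apply: (@block_le (num_mi R n s * (4 * (A + q) ^+ 2))).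
  rewrite ler_wpM2l ?num_mi_ge0//; have := sqr_ge0 (A - q); lra.
apply: block_of; first by rewrite addr_ge0.
move=> a sa; apply: c11_ext (c11B (FA a sa) (PA a sa)) => t tT.
have [l sl lE] := Dmulti_dpart R a.
have [Fd Pd] := FP t tT.
rewrite !lE -dpartB//; first by rewrite sl; exact: ndiff_leq sa _.
by rewrite sl; exact: ndiff_leq sa _.
Qed.

End Blocks.

(** * The four parts of the error *)

Section Bounds.
Variables (R : realType) (h s : nat) (T : R) (T_gt0 : 0 < T).
Implicit Types F P : R -> 'rV[R]_h.+1 -> R.
Let T0 : 0 <= T := ltW T_gt0.

Lemma time_int_ext (f g : R -> R) : (forall t, 0 <= t <= T -> f t = g t) ->
  time_int T f = time_int T g.
Proof.
by move=> fg; apply: eq_Rintegral => t; rewrite inE/= in_itv/=; exact: fg.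
Qed.

(** The interior and the penalty parts have this common shape; B is the constant
of the field that carries the source in the former. *)
Lemma four_blocks r A B (FV : 'I_h -> R -> 'rV[R]_h.+1 -> R) F1 F2 F3 :
  (forall i, block r T A (FV i)) -> block r T A F1 -> block r T B F2 -> block r T A F3 ->
  c11 T (h%:R * A + A + B + A) (fun t x => \sum_(i < h) sobolev_density r (FV i t) x
     + sobolev_density r (F1 t) x + sobolev_density r (F2 t) x
     + sobolev_density r (F3 t) x) /\
  time_int T (fun t => \sum_(i < h) sobolev_norm2 r (FV i t) + sobolev_norm2 r (F1 t)
     + sobolev_norm2 r (F2 t) + sobolev_norm2 r (F3 t)) =
  time_int T (fun t => cube_int (fun x => \sum_(i < h) sobolev_density r (FV i t) x
     + sobolev_density r (F1 t) x + sobolev_density r (F2 t) x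
     + sobolev_density r (F3 t) x)).
Proof.
move=> bV [c1 e1] [c2 e2] [c3 e3]; split.
  apply: c11D c3; apply: c11D c2; apply: c11D c1.
  have -> : h%:R * A = \sum_(i < h) A by rewrite sumr_const card_ord mulr_natl.
  by apply: c11_sum => i _; have [] := bV i.
apply: time_int_ext => t tT.
have tV : tame (fun x => \sum_(i < h) sobolev_density r (FV i t) x).
  by apply: tame_sum => i _; have [cV _] := bV i; exact: c11_tame cV tT.
have t1 := c11_tame c1 tT; have t2 := c11_tame c2 tT; have t3 := c11_tame c3 tT.
rewrite cube_intD//; last by apply: tameD => //; exact: tameD.
rewrite cube_intD//; last exact: tameD.
have sumE : cube_int (fun x => \sum_(i < h) sobolev_density r (FV i t) x) =
    \sum_(i < h) cube_int (sobolev_density r (FV i t)).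
  by apply: cube_int_tame_sum => i _; have [cV _] := bV i; exact: c11_tame cV tT.
rewrite cube_intD// e1// e2// e3// sumE; do 3 congr (_ + _).
by apply: eq_bigr => i _; have [_ ->] := bV i.
Qed.

Section Net.
Variables (c : pe_coefs R) (theta : pinn R h) (a lam : R).
Hypotheses (a_ge1 : 1 <= a) (lam_ge1 : 1 <= lam).
Hypotheses (VC : forall i, Cw (s + 5) a lam (V_ theta i))
  (wC : Cw (s + 5) a lam (w_ theta)) (pC : Cw (s + 5) a lam (p_ theta))
  (TC : Cw (s + 5) a lam (T_ theta)).
Let nm := num_mi R h s.
Let l0 : 0 <= lam. Proof. exact: le_trans lam_ge1. Qed.
Let a0 : 0 <= a. Proof. exact: le_trans a_ge1. Qed.

(** Bounds the squares of the derivatives of the residuals up to order s + 2. *)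
Definition res_size : R := (res_const h s c * (a ^+ 2 * lam ^+ 2) * lam ^+ (s + 2)) ^+ 2.

Lemma interior_bound (L q : R) (Q : R -> 'rV[R]_h.+1 -> R) Si : 0 < L -> 0 <= q ->
  (forall i : multiindex h.+1 s, (mi_order i <= s)%N -> c11 T q (fun t => Dmulti i (Q t))) ->
  (forall t, 0 <= t <= T -> ndiff s (Q t)) -> interior_samples T L Si ->
  `|EG_i2 T c Q theta s - ET_i2 T c Q theta s Si|
  <= T * (nm * ((16 * h%:R + 64) * res_size + 8 * q ^+ 2)) * (h.+2%:R * L ^+ 2)
     * (size Si)%:R `^ (- (2 / h.+2%:R)).
Proof.
move=> L0 q0 Qc Qd SiE.
have CV i := res_V_Cw c a_ge1 lam_ge1 VC wC pC i.
have Cp := res_p_Cw c a_ge1 lam_ge1 pC TC.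
have Cd := res_div_Cw c a_ge1 lam_ge1 VC wC.
have CT := res_T_Cw c a_ge1 lam_ge1 VC wC TC.
have bT : block s T (nm * (32 * res_size + 8 * q ^+ 2)) (res_T c Q theta).
  have b0 := Cw_ge0 CT.
  have B0 : 0 <= 2 * (res_const h s c * (a ^+ 2 * lam ^+ 2) * lam ^+ (s + 2)).
    exact: mulr_ge0 (mulr_ge0 b0 (exprn_ge0 _ l0)).
  have := block_sub T0 B0 q0 (fun i => Cw_Dmulti_c11 T0 lam_ge1 CT (leqnn s) (i := i)) Qc
    (fun t tT => conj (ndiff_leq (leq_addr 2 s) (Cw_ndiff t CT)) (Qd t tT)).
  rewrite (_ : (fun t x => _ - _) = res_T c Q theta); last first.
    by apply/funext => t; apply/funext => x; rewrite /res_T subr0.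
  by apply: block_le; rewrite -/nm /res_size exprMn; lra.
have [c1 e1] := four_blocks (fun i => block_Cw T0 lam_ge1 (CV i))
   (block_Cw T0 lam_ge1 Cp) bT (block_Cw T0 lam_ge1 Cd).
rewrite /EG_i2 e1; apply: le_trans (interior_error T_gt0 L0 c1 SiE) _.
rewrite -/nm -/res_size -/(res_size).
set Z := res_size.
have -> : h%:R * (nm * (16 * Z)) + nm * (16 * Z) + nm * (32 * Z + 8 * q ^+ 2) + nm * (16 * Z)
  = nm * ((16 * h%:R + 64) * Z + 8 * q ^+ 2) by ring.
by [].
Qed.

Lemma penalty_bound (L : R) Si : 0 < L -> interior_samples T L Si ->
  `|EG_p2 T theta s - ET_p2 T theta s Si|
  <= T * (num_mi R h (s + 3) * ((16 * h%:R + 48) * (a * lam ^+ (s + 5)) ^+ 2))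
     * (h.+2%:R * L ^+ 2) * (size Si)%:R `^ (- (2 / h.+2%:R)).
Proof.
move=> L0 SiE.
have E : (s + 5 = s + 3 + 2)%N by rewrite -addnA.
have [c1 e1] := four_blocks (fun i => block_Cw T0 lam_ge1 (eq_ind _ (fun k => Cw k a lam _) (VC i) _ E))
   (block_Cw T0 lam_ge1 (eq_ind _ (fun k => Cw k a lam _) pC _ E))
   (block_Cw T0 lam_ge1 (eq_ind _ (fun k => Cw k a lam _) wC _ E))
   (block_Cw T0 lam_ge1 (eq_ind _ (fun k => Cw k a lam _) TC _ E)).
rewrite /EG_p2 e1; apply: le_trans (interior_error T_gt0 L0 c1 SiE) _.
rewrite E; set n3 := num_mi R h _; set Z := (a * _) ^+ 2.
have -> : h%:R * (n3 * (16 * Z)) + n3 * (16 * Z) + n3 * (16 * Z) + n3 * (16 * Z)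
  = n3 * ((16 * h%:R + 48) * Z) by ring.
by [].
Qed.

Let W2 (u : R -> 'rV[R]_h.+1 -> R) : Cw (s + 5) a lam u -> Cw (s + 2) a lam u.
Proof. by apply: Cw_leq; rewrite leq_add2l. Qed.

(** Bounds the squares of the derivatives of the fields up to order s + 2. *)
Definition net_size : R := (a * lam ^+ (s + 2)) ^+ 2.

Lemma initial_bound (L v : R) (V0 : 'I_h -> 'rV[R]_h.+1 -> R) (T00 : 'rV[R]_h.+1 -> R) St :
  0 < L -> 0 <= v ->
  (forall j (i : multiindex h.+1 s), (mi_order i <= s)%N -> csp v (Dmulti i (V0 j))) ->
  (forall i : multiindex h.+1 s, (mi_order i <= s)%N -> csp v (Dmulti i T00)) ->
  (forall j, ndiff s (V0 j)) -> ndiff s T00 -> initial_samples L St ->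
  `|EG_t2 V0 T00 theta s - ET_t2 V0 T00 theta s St|
  <= nm * (h.+1%:R * (32 * net_size + 8 * v ^+ 2)) * (h.+1%:R * L ^+ 2)
     * (size St)%:R `^ (- (2 / h.+1%:R)).
Proof.
move=> L0 v0 Vc Tc Vd Td StE.
have t00 : 0 <= (0 : R) <= T by rewrite lexx.
have key u f : Cw (s + 5) a lam u ->
    (forall i : multiindex h.+1 s, (mi_order i <= s)%N -> csp v (Dmulti i f)) -> ndiff s f ->
    csp (nm * (32 * net_size + 8 * v ^+ 2)) (sobolev_density s (fun x => u 0 x - f x)) /\
    sobolev_norm2 s (fun x => u 0 x - f x) = cube_int (sobolev_density s (fun x => u 0 x - f x)).
  move=> uC fc fd.
  have B0 : 0 <= 2 * (a * lam ^+ (s + 2)) by rewrite !mulr_ge0 ?exprn_ge0.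
  have uc (i : multiindex h.+1 s) : (mi_order i <= s)%N ->
      c11 T (2 * (a * lam ^+ (s + 2))) (fun t => Dmulti i (u 0)).
    move=> ik; apply: c11_cst.
    by have [+ _ _] := Cw_Dmulti_c11 T0 lam_ge1 (W2 uC) (leqnn s) ik; apply.
  have := block_sub T0 B0 v0 uc (fun i ik => c11_cst T (fc i ik))
    (fun t tT => conj (ndiff_leq (leq_addr 5 s) (Cw_ndiff 0 uC)) fd).
  move=> [[+ _ _] /(_ 0 t00) ->] => /(_ 0 t00) cs; split=> //.
  apply: csp_le cs; rewrite -/nm /net_size exprMn; lra.
have kV i := key _ _ (VC i) (Vc i) (Vd i).
have [cT eT] := key _ _ TC Tc Td.
have cE : csp (nm * (h.+1%:R * (32 * net_size + 8 * v ^+ 2)))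
   (fun x => \sum_(i < h) sobolev_density s (res_tV V0 theta i) x + sobolev_density s (res_tT T00 theta) x).
  set A := nm * (32 * net_size + 8 * v ^+ 2) in kV cT.
  have -> : nm * (h.+1%:R * (32 * net_size + 8 * v ^+ 2)) = \sum_(i < h) A + A.
    by rewrite sumr_const card_ord -[A *+ h]mulr_natl -[h.+1]addn1 natrD /A; ring.
  have [+ _ _] : c11 T (\sum_(i < h) A + A) (fun t x => \sum_(i < h) sobolev_density s (res_tV V0 theta i) x
      + sobolev_density s (res_tT T00 theta) x).
    apply: c11D; last exact: c11_cst.
    apply: (@c11_sum _ _ _ _ _ _ _ (fun i t x => sobolev_density s (res_tV V0 theta i) x)) => i _.
    by apply: c11_cst; have [] := kV i.
  by move=> /(_ 0 t00).
have -> : EG_t2 V0 T00 theta s = cube_int (fun x => \sum_(i < h) sobolev_density s (res_tV V0 theta i) x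
   + sobolev_density s (res_tT T00 theta) x).
  rewrite cube_intD; [|by apply: tame_sum => i _; have [? _] := kV i; eexists; eassumption|by eexists; exact: cT].
  have sumE : cube_int (fun x => \sum_(i < h) sobolev_density s (res_tV V0 theta i) x) =
      \sum_(i < h) cube_int (sobolev_density s (res_tV V0 theta i)).
    by apply: cube_int_tame_sum => i _; have [? _] := kV i; eexists; eassumption.
  rewrite sumE /EG_t2 /res_tT eT; congr (_ + _).
  by apply: eq_bigr => i _; have [_ ->] := kV i.
exact: initial_error L0 cE StE.
Qed.

Lemma jumps2_c11 F : Cw (s + 5) a lam F ->
  c11 T (nm * (h.+1%:R * (64 * net_size))) (jumps2 s F).
Proof.
move=> FC; have n0 : 0 <= net_size by rewrite /net_size sqr_ge0.
apply: (@c11_le _ _ _ (\sum_(i : multiindex h.+1 s | (mi_order i <= s)%N)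
    \sum_(j < h.+1) (64 * net_size))).
  under eq_bigr do rewrite sumr_const card_ord -[_ *+ h.+1]mulr_natl.
  apply: sum_mi_le.
  by rewrite mulr_ge0// mulr_ge0.
rewrite /jumps2; apply: c11_sum => i ik; apply: c11_sum => j _.
have D := Cw_Dmulti_c11 T0 lam_ge1 (W2 FC) (leqnn s) ik.
have := c11_sqr T0 (c11B (c11_set_coord j 1 T0 D) (c11_set_coord j 0 T0 D)).
by apply: c11_le; rewrite /net_size; lra.
Qed.

Lemma res_b_c11 :
  c11 T (nm * ((h%:R + 3) * (h.+1%:R * (64 * net_size)) + 32 * net_size))
    (fun t x => res_b theta s t x ^+ 2).
Proof.
have n0 : 0 <= net_size by rewrite /net_size sqr_ge0.
set J := nm * (h.+1%:R * (64 * net_size)).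
have jV : c11 T (h%:R * J) (fun t x => \sum_(i < h) jumps2 s (V_ theta i) t x).
  have -> : h%:R * J = \sum_(i < h) J by rewrite sumr_const card_ord mulr_natl.
  by apply: c11_sum => i _; exact: jumps2_c11 (VC i).
have cw : c11 T (nm * (32 * net_size)) (fun t x =>
   \sum_(i : multiindex h.+1 s | (mi_order i <= s)%N && (i (zdir h) == ord0))
         (Dmulti i (w_ theta t) (set_coord x (zdir h) 1) ^+ 2
          + Dmulti i (w_ theta t) (set_coord x (zdir h) 0) ^+ 2)).
  apply: (@c11_le _ _ _ (\sum_(i : multiindex h.+1 s | (mi_order i <= s)%N && (i (zdir h) == ord0))
    (32 * net_size))).
    by apply: sum_mi_le; rewrite mulr_ge0.
  apply: c11_sum => i /andP[ik _].
  have D := Cw_Dmulti_c11 T0 lam_ge1 (W2 wC) (leqnn s) ik.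
  have := c11D (c11_sqr T0 (c11_set_coord (zdir h) 1 T0 D)) (c11_sqr T0 (c11_set_coord (zdir h) 0 T0 D)).
  by apply: c11_le; rewrite /net_size; lra.
have := c11D (c11D (c11D (c11D jV (jumps2_c11 wC)) (jumps2_c11 pC)) (jumps2_c11 TC)) cw.
have -> : h%:R * J + J + J + J + nm * (32 * net_size) =
  nm * ((h%:R + 3) * (h.+1%:R * (64 * net_size)) + 32 * net_size) by rewrite /J; ring.
apply: c11_ext => t _; apply/funext => x; rewrite /res_b sqr_sqrtr//.
have jp (F : R -> 'rV[R]_h.+1 -> R) : 0 <= jumps2 s F t x.
  by apply: sumr_ge0 => i _; apply: sumr_ge0 => j _; rewrite sqr_ge0.
rewrite !addr_ge0//; first by apply: sumr_ge0.
by apply: sumr_ge0 => i _; rewrite addr_ge0 ?sqr_ge0.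
Qed.

Lemma boundary_bound (L : R) Sb : 0 < L -> boundary_samples T L Sb ->
  `|EG_b2 T theta s - ET_b2 T theta s Sb|
  <= 2 * h.+1%:R * T
     * (nm * ((h%:R + 3) * (h.+1%:R * (64 * net_size)) + 32 * net_size))
     * (h.+1%:R * L ^+ 2) * (size Sb)%:R `^ (- (2 / h.+1%:R)).
Proof. by move=> L0 SbE; exact: boundary_error T_gt0 L0 res_b_c11 SbE. Qed.

End Net.

Lemma sobolev_norm2_ge0 r (f : 'rV[R]_h.+1 -> R) : 0 <= sobolev_norm2 r f.
Proof. by apply: sumr_ge0 => i _; apply: cube_int_ge0 => x; rewrite sqr_ge0. Qed.

Lemma density_ge0 r (f : 'rV[R]_h.+1 -> R) x : 0 <= sobolev_density r f x.
Proof. by apply: sumr_ge0 => i _; rewrite sqr_ge0. Qed.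

Lemma quadrature_ge0 (mes : R) (X : Type) (Sx : seq X) (g : X -> R) : 0 <= mes ->
  (forall x, 0 <= g x) -> 0 <= quadrature mes Sx g.
Proof.
by move=> m0 g0; apply: sumr_ge0 => x _; rewrite mulr_ge0// divr_ge0.
Qed.

Lemma EG_sqr c Q V0 T00 (theta : pinn R h) (lambda : R) : 0 <= lambda ->
  EG T c Q V0 T00 theta lambda s ^+ 2 =
  EG_i2 T c Q theta s + EG_t2 V0 T00 theta s + EG_b2 T theta s + lambda * EG_p2 T theta s.
Proof.
move=> lam0; rewrite sqr_sqrtr// !addr_ge0 ?mulr_ge0//.
- apply: Rintegral_ge0 => t _; rewrite !addr_ge0 ?sobolev_norm2_ge0//.
  by apply: sumr_ge0 => i _; exact: sobolev_norm2_ge0.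
- by apply: sumr_ge0 => i _; exact: sobolev_norm2_ge0.
- exact: sobolev_norm2_ge0.
- apply: Rintegral_ge0 => t _; apply: sumr_ge0 => i _; apply: sumr_ge0 => b _.
  by apply: cube_int_ge0 => y; rewrite sqr_ge0.
- apply: Rintegral_ge0 => t _; rewrite !addr_ge0 ?sobolev_norm2_ge0//.
  by apply: sumr_ge0 => i _; exact: sobolev_norm2_ge0.
Qed.

Lemma ET_sqr c Q V0 T00 (theta : pinn R h) (lambda : R) Si St Sb : 0 <= lambda ->
  ET T c Q V0 T00 theta lambda s Si St Sb ^+ 2 =
  ET_i2 T c Q theta s Si + ET_t2 V0 T00 theta s St + ET_b2 T theta s Sb
  + lambda * ET_p2 T theta s Si.
Proof.
have d0 : 0 <= 2 * h.+1%:R * T by rewrite mulr_ge0.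
move=> lam0; rewrite sqr_sqrtr// !addr_ge0 ?mulr_ge0//;
  apply: quadrature_ge0; rewrite // => x.
- by rewrite !addr_ge0 ?density_ge0//; apply: sumr_ge0 => i _; exact: density_ge0.
- by rewrite !addr_ge0 ?density_ge0//; apply: sumr_ge0 => i _; exact: density_ge0.
- by rewrite sqr_ge0.
- by rewrite !addr_ge0 ?density_ge0//; apply: sumr_ge0 => i _; exact: density_ge0.
Qed.

End Bounds.

(** * Bounds on the data of the equations *)

Section Data.
Variables (R : realType) (h s : nat).

Lemma finite_bound (I : finType) (P : I -> R -> Prop) :
  (forall i, exists A, P i A) -> (forall i A B, A <= B -> P i A -> P i B) ->
  exists2 A, 0 <= A & forall i, P i A.
Proof.
move=> /choice[A hA] mono; exists (\sum_i `|A i|); first exact: sumr_ge0.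
move=> i; apply: mono (hA i); rewrite (bigD1 i)//=.
by apply: le_trans (ler_norm _) _; rewrite lerDl sumr_ge0.
Qed.

Lemma order_regularity (r : R) j : (2 * (s + 2) + h.+1)%:R <= r -> (j <= s)%N ->
  (2 * (j + 2) + h.+1)%:R <= r.
Proof.
by move=> sr js; apply: le_trans sr; rewrite ler_nat leq_add2r leq_mul2l leq_add2r js.
Qed.

Lemma source_bound (T r : R) k Q : 0 < T -> (3 <= k)%N ->
  (2 * (s + 2) + h.+1)%:R <= r -> source_assumption k T r Q ->
  exists2 q, 0 <= q &
    (forall i : multiindex h.+1 s, (mi_order i <= s)%N -> c11 T q (fun t => Dmulti i (Q t)))
    /\ forall t, 0 <= t <= T -> ndiff s (Q t).
Proof.
move=> T0 k3 sr [CQ _].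
have k2 : (2 <= k.-1)%N by case: k k3 {CQ} => [|[|[|k]]].
have [q q0 hq] : exists2 q, 0 <= q & forall i : multiindex h.+1 s, (mi_order i <= s)%N ->
    c11 T q (fun t => Dmulti i (Q t)).
  apply: finite_bound => [i|i A B AB h1 h2]; last exact: c11_le AB (h1 h2).
  have [si|si] := boolP (mi_order i <= s)%N; last by exists 0.
  have [l sl lE] := Dmulti_dpart R i.
  have [[A hA] _] := Cj_Hr_c11 T0 k2 (order_regularity sr (leq_trans (eq_leq sl) si)) CQ.
  exists A => _; rewrite (_ : (fun t => Dmulti i (Q t)) = fun t => dpart l (Q t))//.
  by apply/funext => t; rewrite lE.
exists q => //; split=> // t tT.
have := Cj_Hr_c11 (l := nseq s ord0) T0 k2 _ CQ; rewrite size_nseq => /(_ sr)[_]; exact.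
Qed.

Lemma initial_data_bound (r : R) V0 T0 : (2 * (s + 2) + h.+1)%:R <= r ->
  initial_assumption r V0 T0 ->
  exists2 v, 0 <= v &
    [/\ forall (j : 'I_h) (i : multiindex h.+1 s), (mi_order i <= s)%N -> csp v (Dmulti i (V0 j)),
        forall i : multiindex h.+1 s, (mi_order i <= s)%N -> csp v (Dmulti i T0),
        forall j, ndiff s (V0 j)
      & ndiff s T0].
Proof.
move=> sr [hV _ [hT _]].
have key f : periodic_Hr r f ->
    (forall i : multiindex h.+1 s, exists A, (mi_order i <= s)%N -> csp A (Dmulti i f)) /\ ndiff s f.
  move=> Hf; split=> [i|]; last first.
    have := periodic_Hr_csp (l := nseq s ord0) _ Hf; rewrite size_nseq => /(_ sr)[_]; exact.
  have [si|si] := boolP (mi_order i <= s)%N; last by exists 0.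
  have [l sl lE] := Dmulti_dpart R i.
  have [[A hA] _] := periodic_Hr_csp (order_regularity sr (leq_trans (eq_leq sl) si)) Hf.
  by exists A; rewrite lE.
have [v1 v10 h1] : exists2 v, 0 <= v & forall ji : 'I_h * multiindex h.+1 s,
    (mi_order ji.2 <= s)%N -> csp v (Dmulti ji.2 (V0 ji.1)).
  apply: finite_bound => [[j i]|ji A B AB h1 h2]; last exact: csp_le AB (h1 h2).
  by have [hj _] := hV j; have [kj _] := key _ hj; exact: kj.
have [v2 v20 h2] : exists2 v, 0 <= v & forall i : multiindex h.+1 s,
    (mi_order i <= s)%N -> csp v (Dmulti i T0).
  apply: finite_bound => [i|i A B AB h2 h3]; last exact: csp_le AB (h2 h3).
  by have [kj _] := key _ hT; exact: kj.
exists (v1 + v2); first exact: addr_ge0.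
split=> [j i si|i si|j|].
- by apply: csp_le (h1 (j, i) si); rewrite lerDl.
- by apply: csp_le (h2 i si); rewrite lerDr.
- by have [hj _] := hV j; have [_ kj] := key _ hj.
- by have [_ kj] := key _ hT.
Qed.

End Data.

(** * Growth in the size of the network *)

Section Growth.
Variable R : realType.

(** Because ln 4 = 2 ln 2 and ln 2 >= 1 / 2. *)
Lemma ln_ge1 (N : nat) : (5 < N)%N -> 1 <= ln (N%:R : R).
Proof.
move=> N5.
have l2 : 2^-1 <= ln (2 : R).
  have := @expR_ge1Dx R (- ln 2); rewrite expRN lnK ?posrE//; lra.
have : ln (2 * 2 : R) <= ln N%:R.
  rewrite ler_ln ?posrE//; last by rewrite ltr0n (leq_trans _ N5).
  by rewrite -natrM ler_nat; exact: leq_trans N5.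
rewrite lnM ?posrE//; lra.
Qed.

Lemma mx_bounded_le m n (A : 'M[R]_(m, n)) B B' : B <= B' -> mx_bounded B A -> mx_bounded B' A.
Proof. by move=> BB AB i j; exact: le_trans (AB i j) BB. Qed.

Lemma net_bounded_le di do' (u : tanh_net R di do') W W' B B' : W <= W' -> B <= B' ->
  net_bounded W B u -> net_bounded W' B' u.
Proof.
move=> WW BB [[w1 w2] [a1 a2] [b1 b2] [c1 c2]].
by split; split; rewrite ?(le_trans w1)// ?(le_trans w2)//; exact: mx_bounded_le BB _.
Qed.

(** For a network with W of order X^(d+1) and B of order X Y, the value size a and
the derivative scale lam are multiples of X^(d+2) Y and X^(d+3) Y^2, where
d = h + 1.  As X and Y are at least 1, it is enough that E and F are at
least the resulting exponents. *)
Lemma growth (ka kl X Y : R) h p q E F : 1 <= X -> 1 <= Y ->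
  (2 * (p * (h + 3) + q * (h + 4)) <= E)%N -> (2 * (p + 2 * q) <= F)%N ->
  ((ka * (X ^+ (h + 3) * Y)) ^+ p * (kl * (X ^+ (h + 4) * Y ^+ 2)) ^+ q) ^+ 2
  <= (ka ^+ p * kl ^+ q) ^+ 2 * (X ^+ E * Y ^+ F).
Proof.
move=> X1 Y1 hE hF.
move: (h + 3)%N (h + 4)%N hE => e3 e4 hE.
have -> : ((ka * (X ^+ e3 * Y)) ^+ p * (kl * (X ^+ e4 * Y ^+ 2)) ^+ q) ^+ 2 =
  (ka ^+ p * kl ^+ q) ^+ 2 * (X ^+ (2 * (p * e3 + q * e4)) * Y ^+ (2 * (p + 2 * q))).
  rewrite [(2 * (p * _ + _))%N]mulnC [(2 * (p + _))%N]mulnC !(exprM _ _ 2) (exprD X) (exprD Y).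
  rewrite [(p * e3)%N]mulnC [(q * e4)%N]mulnC (exprM X e3) (exprM X e4) (exprM Y 2 q).
  by rewrite !exprMn; ring.
have X0 : 0 <= X by apply: le_trans X1.
have Y0 : 0 <= Y by apply: le_trans Y1.
rewrite ler_wpM2l ?sqr_ge0// ler_pM ?exprn_ge0//; exact: ler_weXn2l.
Qed.

Lemma res_sizeE h s c (a lam : R) :
  res_size h s c a lam = res_const h s c ^+ 2 * (a ^+ 2 * lam ^+ (s + 4)) ^+ 2.
Proof.
rewrite /res_size (_ : (s + 4 = 2 + (s + 2))%N); last by lia.
by rewrite (exprD lam 2); move: (lam ^+ (s + 2)) (res_const _ _ _) => z y; ring.
Qed.

Lemma interior_exponents h s :
  (2 * (2 * (h + 3) + (s + 4) * (h + 4)) <= (3 * h.+1 + s + 7) * (6 * s + 24))%N /\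
  (2 * (2 + 2 * (s + 4)) <= 6 * (s + 4) ^ 2)%N.
Proof. by rewrite -mulnn; split; nia. Qed.

Lemma penalty_exponents h s :
  (2 * (1 * (h + 3) + (s + 5) * (h + 4)) <= (3 * h.+1 + s + 8) * (6 * s + 30))%N /\
  (2 * (1 + 2 * (s + 5)) <= 6 * (s + 5) ^ 2)%N.
Proof. by rewrite -mulnn; split; nia. Qed.

Lemma trace_exponents h s :
  (2 * (1 * (h + 3) + (s + 2) * (h + 4)) <= (3 * h.+1 + s + 5) * (6 * s + 12))%N /\
  (2 * (1 + 2 * (s + 2)) <= 6 * (s + 2) ^ 2)%N.
Proof. by rewrite -mulnn; split; nia. Qed.

Lemma network_value_size (C K X Y : R) h :
  2 * C * (K * X ^+ h.+2 * (K * X * Y)) = 2 * C * K ^+ 2 * (X ^+ (h + 3) * Y).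
Proof. by rewrite addn3 !exprS; ring. Qed.

Lemma network_scale_size (C K X Y : R) h :
  C * (K * X ^+ h.+2 * (K * X * Y) ^+ 2) = C * K ^+ 3 * (X ^+ (h + 4) * Y ^+ 2).
Proof. by rewrite addn4 !exprS; ring. Qed.

Lemma combine_errors (di dt db dp lambda ci cp ct cb Cs CQ mi mp mb ei et eb : R) :
  0 <= lambda -> 0 <= ci -> 0 <= cp -> 0 <= ct -> 0 <= cb ->
  0 <= mi -> 0 <= mp -> 0 <= mb -> 0 <= ei -> 0 <= et -> 0 <= eb ->
  `|di| <= (ci * mi + CQ) * ei -> `|dp| <= cp * mp * ei ->
  `|dt| <= ct * mb * et -> `|db| <= cb * mb * eb ->
  Cs = ci + cp + ct + cb + 1 ->
  `|di + dt + db + lambda * dp| <=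
  (Cs * mi + CQ + lambda * (Cs * mp)) * ei + Cs * mb * et + Cs * mb * eb.
Proof.
move=> l0 i0 p0 t0 b0 mi0 mp0 mb0 ei0 et0 eb0 hi hp ht hb CsE.
have le1 : ci <= Cs by rewrite CsE; lra.
have le2 : cp <= Cs by rewrite CsE; lra.
have le3 : ct <= Cs by rewrite CsE; lra.
have le4 : cb <= Cs by rewrite CsE; lra.
have -> : (Cs * mi + CQ + lambda * (Cs * mp)) * ei + Cs * mb * et + Cs * mb * eb =
  (Cs * mi + CQ) * ei + Cs * mb * et + Cs * mb * eb + lambda * (Cs * mp * ei) by ring.
apply: le_trans (ler_normD _ _) _; apply: lerD; last first.
  rewrite normrM (ger0_norm l0) ler_wpM2l//; apply: le_trans hp _.
  by rewrite !ler_wpM2r.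
apply: le_trans (ler_normD _ _) _; apply: lerD; last first.
  by apply: le_trans hb _; rewrite !ler_wpM2r.
apply: le_trans (ler_normD _ _) _; apply: lerD; last first.
  by apply: le_trans ht _; rewrite !ler_wpM2r.
by apply: le_trans hi _; rewrite ler_wpM2r// lerD2r ler_wpM2r.
Qed.

End Growth.

(* h.+1 is the space dimension d *)
Theorem theorem4p3 (R : realType) (h : nat) (hh : h = 1%N \/ h = 2%N)
    (Tf : R) (Tf_gt0 : 0 < Tf) (k s n : nat)
    (hk : (5 <= k)%N) (hs : (s <= k - 5)%N)
    (hn : n = maxn (k ^ 2)%N (h.+1 * (s ^ 2 - s + k + h.+1))%N)
    (c : pe_coefs R) (hc : viscosity_assumption c)
    (r : R) (hr : h.+1%:R / 2 + 2 * k%:R < r)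
    (V0 : 'I_h -> 'rV[R]_h.+1 -> R) (T0 : 'rV[R]_h.+1 -> R)
    (h0 : initial_assumption r V0 T0)
    (K : R) (K_gt0 : 0 < K) (L : R) (L_gt0 : 0 < L) :
  exists2 Cs : R, 0 < Cs &
  forall Q : R -> 'rV[R]_h.+1 -> R, source_assumption k Tf r Q ->
  exists2 CQ : R, 0 < CQ &
  forall (lambda : R) (N : nat) (theta : pinn R h)
    (Si : seq (R * 'rV[R]_h.+1)) (St : seq 'rV[R]_h.+1)
    (Sb : seq (R * 'rV[R]_h.+1)),
  0 < lambda -> (5 < N)%N -> in_architecture K N theta ->
  interior_samples Tf L Si -> initial_samples L St ->
  boundary_samples Tf L Sb ->
  let d := h.+1 in
  let X : R := N%:R in
  let Ci := Cs * X ^+ ((3 * d + s + 7) * (6 * s + 24))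
              * ln X ^+ (6 * (s + 4) ^ 2)
            + CQ
            + lambda * Cs * X ^+ ((3 * d + s + 8) * (6 * s + 30))
              * ln X ^+ (6 * (s + 5) ^ 2) in
  let Ct := Cs * X ^+ ((3 * d + s + 5) * (6 * s + 12))
              * ln X ^+ (6 * (s + 2) ^ 2) in
  let Cb := Ct in
  `| EG Tf c Q V0 T0 theta lambda s ^+ 2
     - ET Tf c Q V0 T0 theta lambda s Si St Sb ^+ 2 |
  <= Ci * (size Si)%:R `^ (- (2 / d.+1%:R))
     + Ct * (size St)%:R `^ (- (2 / d%:R))
     + Cb * (size Sb)%:R `^ (- (2 / d%:R)).
Proof.
(* As r > d / 2 + 2 k with k >= s + 5 and d <= 3, there is room for s + 2
   derivatives with absolutely summable coefficients. *)
have sr : (2 * (s + 2) + h.+1)%:R <= r.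
  apply: le_trans (ltW hr).
  have sk : (s + 5 <= k)%N by lia.
  have h3 : h.+1%:R <= 3 :> R by case: hh => ->; rewrite ler_nat.
  have : (s%:R + 5 <= k%:R :> R) by rewrite -natrD ler_nat.
  have h1 : 0 <= h.+1%:R :> R by [].
  rewrite natrD natrM natrD; lra.
have [v v0 [vV vT dV dT]] := initial_data_bound sr h0.
(* K is replaced by K' >= 1 so that all sizes below are at least 1. *)
pose C0 : R := tanh_const R (s + 5); pose K' := Num.max K 1.
pose ka := 2 * C0 * K' ^+ 2; pose kl := C0 * K' ^+ 3.
pose rc := res_const h s c.
pose kr := rc ^+ 2 * (ka ^+ 2 * kl ^+ (s + 4)) ^+ 2.
pose kp := (ka ^+ 1 * kl ^+ (s + 5)) ^+ 2.
pose kn := (ka ^+ 1 * kl ^+ (s + 2)) ^+ 2.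
pose nm := num_mi R h s; pose nm3 := num_mi R h (s + 3).
pose ci := Tf * (nm * ((16 * h%:R + 64) * kr)) * (h.+2%:R * L ^+ 2).
pose cp := Tf * (nm3 * ((16 * h%:R + 48) * kp)) * (h.+2%:R * L ^+ 2).
pose ct := nm * (h.+1%:R * (32 * kn + 8 * v ^+ 2)) * (h.+1%:R * L ^+ 2).
pose cb := 2 * h.+1%:R * Tf * (nm * ((h%:R + 3) * (h.+1%:R * (64 * kn)) + 32 * kn))
           * (h.+1%:R * L ^+ 2).
have Tf0 := ltW Tf_gt0.
have nm0 : 0 <= nm by exact: num_mi_ge0.
have nm30 : 0 <= nm3 by exact: num_mi_ge0.
have kr0 : 0 <= kr by rewrite mulr_ge0 ?sqr_ge0.
have kp0 : 0 <= kp by rewrite sqr_ge0.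
have kn0 : 0 <= kn by rewrite sqr_ge0.
have L20 : 0 <= L ^+ 2 by rewrite sqr_ge0.
have hn0 : 0 <= h%:R :> R by [].
have ci0 : 0 <= ci.
  by rewrite /ci; apply: mulr_ge0; apply: mulr_ge0 => //; apply: mulr_ge0 => //; apply: mulr_ge0 => //; lra.
have cp0 : 0 <= cp.
  by rewrite /cp; apply: mulr_ge0; apply: mulr_ge0 => //; apply: mulr_ge0 => //; apply: mulr_ge0 => //; lra.
have ct0 : 0 <= ct.
  rewrite /ct; apply: mulr_ge0; apply: mulr_ge0 => //; apply: mulr_ge0 => //.
  by have := sqr_ge0 v; lra.
have cb0 : 0 <= cb.
  rewrite /cb; apply: mulr_ge0; apply: mulr_ge0 => //; first by rewrite mulr_ge0.
  apply: mulr_ge0 => //; apply: addr_ge0; last by lra.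
  apply: mulr_ge0; first lra.
  by apply: mulr_ge0 => //; lra.
exists (ci + cp + ct + cb + 1); first by rewrite ltr_wpDl// !addr_ge0.
move=> Q hQ.
have [q q0 [qQ dQ]] := source_bound Tf_gt0 (leq_trans (isT : (3 <= 5)%N) hk) sr hQ.
pose CQ := Tf * (nm * (8 * q ^+ 2)) * (h.+2%:R * L ^+ 2).
have CQ0 : 0 <= CQ.
  rewrite /CQ; apply: mulr_ge0; apply: mulr_ge0 => //; apply: mulr_ge0 => //.
  by have := sqr_ge0 q; lra.
(* The added 1 makes the constant positive when the bound on Q vanishes. *)
exists (CQ + 1); first by rewrite ltr_wpDl.
move=> lambda N theta Si St Sb lambda0 N5 [aV aw ap aT] hSi hSt hSb.
cbv zeta; set X : R := N%:R.
have X1 : 1 <= X by rewrite /X ler1n (leq_trans _ N5).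
have Y1 : 1 <= ln X := ln_ge1 R N5.
have X0 : 0 <= X by apply: le_trans X1.
have Y0 : 0 <= ln X by apply: le_trans Y1.
have K1 : 1 <= K' by rewrite /K' le_max lexx orbT.
have KK : K <= K' by rewrite /K' le_max lexx.
have K'0 : 0 <= K' by apply: le_trans K1.
pose W := K' * X ^+ h.+2; pose B := K' * X * ln X.
have WW : K * X ^+ h.+2 <= W by rewrite ler_wpM2r ?exprn_ge0.
have BB : K * X * ln X <= B by rewrite !ler_wpM2r.
have W1 : 1 <= W by rewrite -[leLHS]mulr1 ler_pM ?exprn_ege1.
have XY1 : 1 <= X * ln X by rewrite -[leLHS]mulr1 ler_pM.
have B1 : 1 <= B by rewrite /B -mulrA -[leLHS]mulr1 ler_pM.
pose a := ka * (X ^+ (h + 3) * ln X); pose lam := kl * (X ^+ (h + 4) * ln X ^+ 2).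
have aE : 2 * tanh_const R (s + 5) * (W * B) = a.
  exact: network_value_size.
have lE : tanh_const R (s + 5) * (W * B ^+ 2) = lam by exact: network_scale_size.
have C01 : 1 <= C0 := tanh_const_ge1 R (s + 5).
have W0 : 0 <= W by apply: le_trans W1.
have B0 : 0 <= B by apply: le_trans B1.
have WB1 : 1 <= W * B by rewrite -[leLHS]mulr1 ler_pM.
have a1 : 1 <= a.
  rewrite -aE -/C0; have : 1 <= C0 * (W * B) by rewrite -[leLHS]mulr1 ler_pM.
  by rewrite -mulrA; lra.
have lam1 : 1 <= lam.
  rewrite -lE -/C0 expr2 mulrA -[leLHS]mulr1 ler_pM// -[leLHS]mulr1 ler_pM//.
have net dout (u : tanh_net R (h.+1 + 1) dout) i : net_bounded (K * X ^+ h.+2) (K * X * ln X) u ->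
    Cw (s + 5) a lam (fun t x => net_eval u (space_time x t) i 0).
  by move=> /(net_bounded_le WW BB) ub; rewrite -aE -lE; exact: net_Cw.
have VC i : Cw (s + 5) a lam (V_ theta i) by exact: net.
have wC : Cw (s + 5) a lam (w_ theta) by exact: net.
have pC : Cw (s + 5) a lam (p_ theta) by exact: net.
have TC : Cw (s + 5) a lam (T_ theta) by exact: net.
pose mi := X ^+ ((3 * h.+1 + s + 7) * (6 * s + 24)) * ln X ^+ (6 * (s + 4) ^ 2).
pose mp := X ^+ ((3 * h.+1 + s + 8) * (6 * s + 30)) * ln X ^+ (6 * (s + 5) ^ 2).
pose mb := X ^+ ((3 * h.+1 + s + 5) * (6 * s + 12)) * ln X ^+ (6 * (s + 2) ^ 2).
have mb1 : 1 <= mb by rewrite -[leLHS]mulr1 ler_pM ?exprn_ege1.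
have mi0 : 0 <= mi by rewrite mulr_ge0 ?exprn_ge0.
have mp0 : 0 <= mp by rewrite mulr_ge0 ?exprn_ge0.
have mb0 : 0 <= mb by rewrite mulr_ge0 ?exprn_ge0.
have rs : res_size h s c a lam <= kr * mi.
  have [E F] := interior_exponents h s.
  by rewrite res_sizeE /kr -[leRHS]mulrA ler_wpM2l ?sqr_ge0//; exact: (growth ka kl X1 Y1 E F).
have ps : (a * lam ^+ (s + 5)) ^+ 2 <= kp * mp.
  by have [E F] := penalty_exponents h s; exact: (growth ka kl X1 Y1 E F).
have ns : net_size s a lam <= kn * mb.
  by have [E F] := trace_exponents h s; exact: (growth ka kl X1 Y1 E F).
have bi := interior_bound Tf_gt0 c a1 lam1 VC wC pC TC L_gt0 q0 qQ dQ hSi.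
have bp := penalty_bound Tf_gt0 lam1 VC wC pC TC L_gt0 hSi.
have bt := initial_bound Tf_gt0 a1 lam1 VC TC L_gt0 v0 vV vT dV dT hSt.
have bb := boundary_bound Tf_gt0 lam1 VC wC pC TC L_gt0 hSb.
have {}bi : `|EG_i2 Tf c Q theta s - ET_i2 Tf c Q theta s Si|
    <= (ci * mi + (CQ + 1)) * (size Si)%:R `^ (- (2 / h.+2%:R)).
  apply: le_trans bi _; rewrite ler_wpM2r ?powR_ge0//.
  apply: (@le_trans _ _ (ci * mi + CQ)); last by rewrite lerD2l lerDl.
  have -> : ci * mi + CQ = Tf * (nm * ((16 * h%:R + 64) * (kr * mi) + 8 * q ^+ 2))
      * (h.+2%:R * L ^+ 2) by rewrite /ci /CQ; ring.
  apply: ler_wpM2r; first exact: mulr_ge0.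
  do 2!apply: ler_wpM2l => //; rewrite lerD2r; apply: ler_wpM2l rs; lra.
have {}bp : `|EG_p2 Tf theta s - ET_p2 Tf theta s Si|
    <= cp * mp * (size Si)%:R `^ (- (2 / h.+2%:R)).
  apply: le_trans bp _; rewrite ler_wpM2r ?powR_ge0//.
  have -> : cp * mp = Tf * (nm3 * ((16 * h%:R + 48) * (kp * mp))) * (h.+2%:R * L ^+ 2).
    by rewrite /cp; ring.
  apply: ler_wpM2r; first exact: mulr_ge0.
  do 2!apply: ler_wpM2l => //; apply: ler_wpM2l ps; lra.
have {}bt : `|EG_t2 V0 T0 theta s - ET_t2 V0 T0 theta s St|
    <= ct * mb * (size St)%:R `^ (- (2 / h.+1%:R)).
  apply: le_trans bt _; rewrite ler_wpM2r ?powR_ge0//.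
  have -> : ct * mb = nm * (h.+1%:R * (32 * (kn * mb) + 8 * v ^+ 2 * mb)) * (h.+1%:R * L ^+ 2).
    by rewrite /ct; ring.
  apply: ler_wpM2r; first exact: mulr_ge0.
  do 2!apply: ler_wpM2l => //; apply: lerD; first by apply: ler_wpM2l ns.
  (* The bound on the initial data is multiplied by mb >= 1 to join C_s. *)
  by rewrite ler_peMr// mulr_ge0// sqr_ge0.
have {}bb : `|EG_b2 Tf theta s - ET_b2 Tf theta s Sb|
    <= cb * mb * (size Sb)%:R `^ (- (2 / h.+1%:R)).
  apply: le_trans bb _; rewrite ler_wpM2r ?powR_ge0//.
  have -> : cb * mb = 2 * h.+1%:R * Tf
     * (nm * ((h%:R + 3) * (h.+1%:R * (64 * (kn * mb))) + 32 * (kn * mb)))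
     * (h.+1%:R * L ^+ 2) by rewrite /cb; ring.
  apply: ler_wpM2r; first exact: mulr_ge0.
  apply: ler_wpM2l; first by rewrite !mulr_ge0.
  apply: ler_wpM2l => //; apply: lerD; last by apply: ler_wpM2l ns.
  apply: ler_wpM2l; first by rewrite addr_ge0.
  by do 2!apply: ler_wpM2l => //.
have := combine_errors (ltW lambda0) ci0 cp0 ct0 cb0 mi0 mp0 mb0
  (powR_ge0 _ _) (powR_ge0 _ _) (powR_ge0 _ _) bi bp bt bb erefl.
rewrite EG_sqr ?(ltW lambda0)// (ET_sqr _ Tf_gt0) ?(ltW lambda0)//.
move: (EG_i2 _ _ _ _ _) (ET_i2 _ _ _ _ _ _) (EG_p2 _ _ _) (ET_p2 _ _ _ _)
  (EG_t2 _ _ _ _) (ET_t2 _ _ _ _ _) (EG_b2 _ _ _) (ET_b2 _ _ _ _) => e1 e1' e2 e2' e3 e3' e4 e4'.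
have -> : e1 + e3 + e4 + lambda * e2 - (e1' + e3' + e4' + lambda * e2') =
  e1 - e1' + (e3 - e3') + (e4 - e4') + lambda * (e2 - e2') by ring.
by rewrite /mi /mp /mb !mulrA.
Qed.
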